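(* For every $n\ge 1$, the homomorphism $B_n\to R_n=\pi_1\mathcal R_n$ from the braid group sending the standard generators of $B_n$ to the elements $\rho_1,\dots,\rho_{n-1}$ is injective.
   Context: $B_n$ is the braid group with its standard (Artin) generators. A ring is a Euclidean (round) circle in $\mathbb R^3$. $\mathcal R_n$ is the space of unordered configurations of $n$ disjoint, pairwise unlinked (unoriented) rings in $\mathbb R^3$, topologized by the centers, radii and planes of the rings; it is path-connected. Products of loops are composed from left to right. Take as basepoint the configuration in which the $i$th ring has radius $1$, center $(4i,0,0)$ and lies in the plane $x=4i$, $i=1,\dots,n$. For $1\le i\le n-1$, $\rho_i\in R_n$ is represented by a loop of configurations in which all rings stay in planes perpendicular to the $x$-axis, all rings other than the $i$th and $(i+1)$st are fixed, and the $i$th and $(i+1)$st rings exchange places, their planes coinciding at exactly one moment (and not coinciding with the planes of other rings), at which moment the $i$th ring is nested inside the $(i+1)$st; thus the $i$th ring passes through the $(i+1)$st ring. The $\rho_i$ satisfy the braid relations. *)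

(* Defs.v *)
From HB Require Import structures.
From mathcomp Require Import all_boot all_order all_algebra.
From mathcomp Require Import all_classical all_reals topology.
From mathcomp Require Import normedtype homotopy.
From mathcomp Require Import ring lra.
Set Implicit Arguments.
Unset Strict Implicit.
Unset Printing Implicit Defensive.
Import Order.TTheory GRing.Theory Num.Theory.
Import numFieldNormedType.Exports.
Local Open Scope classical_set_scope.
Local Open Scope ring_scope.
Local Open Scope quotient_scope.

Section PresentedGroup.
Context (S : choiceType).

(* The letter (s, false) stands for s and (s, true) for its inverse. *)
Definition word := seq (S * bool).

Definition gen_word (s : S) : word := [:: (s, false)].

Definition inv_word (w : word) : word := [seq (l.1, ~~ l.2) | l <- rev w].

Context (rels : word -> word -> Prop).

Inductive word_eq : word -> word -> Prop :=
| word_eq_refl u : word_eq u u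
| word_eq_sym u v : word_eq u v -> word_eq v u
| word_eq_trans u v w : word_eq u v -> word_eq v w -> word_eq u w
| word_eq_cat u u' v v' :
    word_eq u u' -> word_eq v v' -> word_eq (u ++ v) (u' ++ v')
| word_eq_cancel s b : word_eq [:: (s, b); (s, ~~ b)] [::]
| word_eq_rel u v : rels u v -> word_eq u v.

Let word_eqb u v := `[< word_eq u v >].

Let word_eqb_refl : reflexive word_eqb.
Proof. by move=> u; apply/asboolP; exact: word_eq_refl. Qed.

Let word_eqb_sym : symmetric word_eqb.
Proof.
by move=> u v; apply/idP/idP => /asboolP h; apply/asboolP; exact: word_eq_sym.
Qed.

Let word_eqb_trans : transitive word_eqb.
Proof.
move=> v u w /asboolP uv /asboolP vw; apply/asboolP.
exact: word_eq_trans uv vw.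
Qed.

Definition word_equiv := EquivRel _ word_eqb_refl word_eqb_sym word_eqb_trans.

Definition presented_group := {eq_quot word_equiv}.
Local Notation G := presented_group.
HB.instance Definition _ := Choice.on G.
HB.instance Definition _ := EqQuotient.on G.

Lemma pi_wordP u v : (\pi_G u = \pi_G v) <-> word_eq u v.
Proof.
split=> [h|h].
- by apply/(@asboolP (word_eq u v))/(@eqmodP _ word_equiv).
- by apply/(@eqmodP _ word_equiv)/(@asboolP (word_eq u v)).
Qed.

Lemma repr_wordP u : word_eq (repr (\pi_G u)) u.
Proof. by apply/pi_wordP; rewrite reprK. Qed.

Definition presented_mul (x y : G) : G := \pi_G (repr x ++ repr y).
Definition presented_one : G := \pi_G [::].
Definition presented_inv (x : G) : G := \pi_G (inv_word (repr x)).

Lemma word_eq_mulV u : word_eq (u ++ inv_word u) [::].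
Proof.
elim: u => [|[s b] u IH]; first exact: word_eq_refl.
have -> : ((s, b) :: u) ++ inv_word ((s, b) :: u) =
    [:: (s, b)] ++ (u ++ inv_word u) ++ [:: (s, ~~ b)].
  by rewrite /inv_word rev_cons map_rcons -cats1 /= -catA.
apply: word_eq_trans (word_eq_cancel s b).
rewrite -[X in word_eq _ X]/([:: (s, b)] ++ [::] ++ [:: (s, ~~ b)]).
apply: word_eq_cat; first exact: word_eq_refl.
by apply: word_eq_cat; [exact: IH|exact: word_eq_refl].
Qed.

Lemma inv_wordK u : inv_word (inv_word u) = u.
Proof.
rewrite /inv_word -map_rev revK -map_comp -[RHS]map_id.
by apply: eq_map => -[s b] /=; rewrite negbK.
Qed.

Lemma word_eq_mulVw u : word_eq (inv_word u ++ u) [::].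
Proof. by rewrite -{2}(inv_wordK u); exact: word_eq_mulV. Qed.

Let mulA : associative presented_mul.
Proof.
move=> x y z; apply/pi_wordP.
apply: (@word_eq_trans _ (repr x ++ repr y ++ repr z)).
  by apply: word_eq_cat; [exact: word_eq_refl|exact: repr_wordP].
rewrite catA; apply: word_eq_sym.
by apply: word_eq_cat; [exact: repr_wordP|exact: word_eq_refl].
Qed.

Let mul1 : left_id presented_one presented_mul.
Proof.
move=> x; rewrite -[RHS]reprK; apply/pi_wordP.
rewrite -[X in word_eq _ X]cat0s.
by apply: word_eq_cat; [exact: repr_wordP|exact: word_eq_refl].
Qed.

Let mulr1 : right_id presented_one presented_mul.
Proof.
move=> x; rewrite -[RHS]reprK; apply/pi_wordP.
rewrite -[X in word_eq _ X]cats0.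
by apply: word_eq_cat; [exact: word_eq_refl|exact: repr_wordP].
Qed.

Let mulV : left_inverse presented_one presented_inv presented_mul.
Proof.
move=> x; apply/pi_wordP.
apply: word_eq_trans (word_eq_mulVw (repr x)).
by apply: word_eq_cat; [exact: repr_wordP|exact: word_eq_refl].
Qed.

Let mulrV : right_inverse presented_one presented_inv presented_mul.
Proof.
move=> x; apply/pi_wordP.
apply: word_eq_trans (word_eq_mulV (repr x)).
by apply: word_eq_cat; [exact: word_eq_refl|exact: repr_wordP].
Qed.

HB.instance Definition _ := isGroup.Build G mulA mul1 mulr1 mulV mulrV.

End PresentedGroup.

(* The n - 1 standard generators are indexed from 0. *)
Inductive braid_rel (n : nat) : word 'I_n.-1 -> word 'I_n.-1 -> Prop :=
| braid_rel_comm (i j : 'I_n.-1) : (i.+1 < j)%N ->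
    braid_rel (gen_word i ++ gen_word j) (gen_word j ++ gen_word i)
| braid_rel_braid (i j : 'I_n.-1) : j = i.+1 :> nat ->
    braid_rel (gen_word i ++ gen_word j ++ gen_word i)
              (gen_word j ++ gen_word i ++ gen_word j).

Definition braid_group (n : nat) := presented_group (@braid_rel n).
HB.instance Definition _ n := monoid.Group.on (braid_group n).

Definition sigma (n : nat) (i : 'I_n.-1) : braid_group n :=
  \pi_(braid_group n) (gen_word i).

Section UnitInterval.
Context (R : realType).

Definition unit_itv : Type := `[0%R, 1%R : R]%classic.
HB.instance Definition _ := Topological.on unit_itv.

Definition clip (t : R) : R := Num.max 0 (Num.min 1 t).

Lemma clip_in t : clip t \in (`[0%R, 1%R : R]%classic).
Proof.
by rewrite inE /= in_itv /= /clip le_max lexx /= ge_max ler01 ge_min lexx.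
Qed.

Definition to_itv (t : R) : unit_itv := exist _ (clip t) (clip_in t).

Lemma val_to_itv t : \val (to_itv t) = clip t.
Proof. by []. Qed.

Lemma itv_inj (s t : unit_itv) : \val s = \val t -> s = t.
Proof. exact: val_inj. Qed.

Lemma itv_bound (t : unit_itv) : 0 <= \val t <= 1.
Proof. by case: t => t /= /set_mem; rewrite /= in_itv. Qed.

Lemma clip_id t : 0 <= t <= 1 -> clip t = t.
Proof.
by move=> /andP[t0 t1]; rewrite /clip; move/min_idPr: t1 => ->; apply/max_idPr.
Qed.

Lemma clip0 : clip 0 = 0. Proof. by rewrite clip_id// lexx ler01. Qed.
Lemma clip1 : clip 1 = 1. Proof. by rewrite clip_id// lexx ler01. Qed.

Lemma to_itvK (t : unit_itv) : to_itv (\val t) = t.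
Proof. by apply: itv_inj; rewrite val_to_itv clip_id// itv_bound. Qed.

Lemma clip_continuous : continuous clip.
Proof.
move=> t; apply: continuous_max; first exact: cvg_cst.
by apply: continuous_min; [exact: cvg_cst|exact: cvg_id].
Qed.

Lemma continuous_to_itv (X : topologicalType) (f : X -> R) :
  continuous f -> continuous (to_itv \o f).
Proof.
move=> cf; apply/(@continuous_comp_initial unit_itv X R \val) => x.
exact: (@continuous_comp _ _ _ f clip _ (cf x) (@clip_continuous _)).
Qed.

Lemma continuous_val : continuous (\val : unit_itv -> R).
Proof. exact: initial_continuous. Qed.

Fact itv_zero_neq_one : to_itv 0 != to_itv 1.
Proof.
by apply/eqP => /(congr1 \val); rewrite !val_to_itv !clip_id ?lexx ?ler01//;
  move/eqP; rewrite eq_sym oner_eq0.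
Qed.

HB.instance Definition _ :=
  @isBiPointed.Build unit_itv (to_itv 0) (to_itv 1) itv_zero_neq_one.

End UnitInterval.

Section Homotopy.
Context (R : realType) (X : topologicalType).
Local Notation I := (unit_itv R).
Implicit Types x y z : X.

Lemma glue_continuous (T Y : topologicalType) (phi : T -> R) (c : R)
    (f g : T -> Y) :
  continuous phi -> continuous f -> continuous g ->
  (forall u, phi u = c -> f u = g u) ->
  continuous (fun u => if phi u <= c then f u else g u).
Proof.
move=> cphi cf cg fg; set h := fun u => _.
have clA : closed [set u | phi u <= c].
  by apply: (@preimage_closed _ _ phi [set r | r <= c] (in1W cphi)); exact: closed_le.
have clB : closed [set u | c <= phi u].
  by apply: (@preimage_closed _ _ phi [set r | c <= r] (in1W cphi)); exact: closed_ge.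
have : {within [set u | phi u <= c] `|` [set u | c <= phi u], continuous h}.
  apply: withinU_continuous => //.
  - apply: (@subspace_eq_continuous _ _ _ f); last exact: continuous_subspaceT.
    by move=> u /set_mem /= uc; rewrite /from_subspace /h uc.
  - apply: (@subspace_eq_continuous _ _ _ g); last exact: continuous_subspaceT.
    move=> u /set_mem /= uc; rewrite /from_subspace /h; case: ifPn => // cu.
    by apply/esym/fg/eqP; rewrite eq_le cu uc.
have -> : [set u | phi u <= c] `|` [set u | c <= phi u] = setT.
  by apply/seteqP; split=> // u _ /=; apply/orP; exact: le_total.
by move=> ch; apply/continuous_subspace_setT.
Qed.

Definition homotopic x y (p q : {path I from x to y}) : Prop :=
  exists H : I * I -> X,
    [/\ continuous H,
        (forall t, H (t, zero) = p t) /\ (forall t, H (t, one) = q t)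
      & (forall s, H (zero, s) = x) /\ (forall s, H (one, s) = y)].

Definition concat_fun x y z (p : {path I from x to y})
    (q : {path I from y to z}) (t : I) : X :=
  if \val t <= 2^-1 then p (to_itv (2 * \val t)) else q (to_itv (2 * \val t - 1)).

Definition reverse_fun x y (p : {path I from x to y}) (t : I) : X :=
  p (to_itv (1 - \val t)).

Lemma continuous_affine_val (a b : R) (T : topologicalType) (u : T -> R) :
  continuous u -> continuous (fun t => a * u t + b).
Proof.
move=> cu t; apply: cvgD; last exact: cvg_cst.
by apply: cvgM; [exact: cvg_cst|exact: cu].
Qed.

Lemma continuous_scale_val (a : R) (T : topologicalType) (u : T -> R) :
  continuous u -> continuous (fun t => a * u t).
Proof. by move=> cu t; apply: cvgM; [exact: cvg_cst|exact: cu]. Qed.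

Lemma continuous_onem_val (T : topologicalType) (u : T -> R) :
  continuous u -> continuous (fun t => 1 - u t).
Proof. by move=> cu t; apply: cvgB; [exact: cvg_cst|exact: cu]. Qed.

Lemma continuous_path_clip x y (p : {path I from x to y})
    (T : topologicalType) (u : T -> R) :
  continuous u -> continuous (fun t => p (to_itv (u t))).
Proof.
move=> cu t; apply: (@continuous_comp _ _ _ (@to_itv R \o u) p).
  exact: continuous_to_itv.
exact: cts_fun.
Qed.

Lemma path_zero_le x y (p : {path I from x to y}) (t : R) :
  t <= 0 -> p (to_itv t) = x.
Proof.
move=> t0; rewrite -[RHS](path_zero (s := p)); congr (p _).
apply: itv_inj; rewrite !val_to_itv /clip.
rewrite (min_idPr _) ?(le_trans t0)// (max_idPl _)//.
by rewrite (min_idPr ler01) maxxx.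
Qed.

Lemma path_one_ge x y (p : {path I from x to y}) (t : R) :
  1 <= t -> p (to_itv t) = y.
Proof.
move=> t0; rewrite -[RHS](path_one (s := p)); congr (p _).
by apply: itv_inj; rewrite !val_to_itv /clip (min_idPl t0) minxx.
Qed.

Lemma val_zero : \val (zero : I) = 0.
Proof. by rewrite [LHS]clip_id// lexx ler01. Qed.

Lemma val_one : \val (one : I) = 1.
Proof. by rewrite [LHS]clip_id// lexx ler01. Qed.

Section Concat.
Context (x y z : X) (p : {path I from x to y}) (q : {path I from y to z}).

Fact concat_continuous : continuous (concat_fun p q).
Proof.
apply: glue_continuous.
- exact: continuous_val.
- apply: continuous_path_clip; apply: continuous_scale_val.
  exact: continuous_val.
- apply: continuous_path_clip; apply: continuous_affine_val.
  exact: continuous_val.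
- by move=> t ->; rewrite path_one_ge ?path_zero_le//; lra.
Qed.

Fact concat_zero : concat_fun p q zero = x.
Proof. by rewrite /concat_fun val_zero path_zero_le ?mulr0// ifT//; lra. Qed.

Fact concat_one : concat_fun p q one = z.
Proof. by rewrite /concat_fun val_one ifF ?path_one_ge//; lra. Qed.

Definition concat : {path I from x to z} :=
  mk_path concat_continuous concat_zero concat_one.

End Concat.

Section Reverse.
Context (x y : X) (p : {path I from x to y}).

Fact reverse_continuous : continuous (reverse_fun p).
Proof.
apply: continuous_path_clip; apply: continuous_onem_val.
exact: continuous_val.
Qed.

Fact reverse_zero : reverse_fun p zero = y.
Proof. by rewrite /reverse_fun val_zero path_one_ge// subr0. Qed.

Fact reverse_one : reverse_fun p one = x.
Proof. by rewrite /reverse_fun val_one path_zero_le// subrr. Qed.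

Definition reverse : {path I from y to x} :=
  mk_path reverse_continuous reverse_zero reverse_one.

End Reverse.

Definition const_path x : {path I from x to x} := cst x.

Lemma homotopic_refl x y (p : {path I from x to y}) : homotopic p p.
Proof.
exists (p \o fst); split=> /=; last by split=> _; rewrite ?path_zero ?path_one.
- by move=> u; apply: continuous_comp; [exact: cvg_fst|exact: cts_fun].
- by split.
Qed.

Lemma continuous_pair (T U V : topologicalType) (f : T -> U) (g : T -> V) :
  continuous f -> continuous g -> continuous (fun t => (f t, g t)).
Proof. by move=> cf cg t; apply: cvg_pair; [exact: cf|exact: cg]. Qed.

Lemma continuous_proj1 : continuous (fun u : I * I => \val u.1).
Proof.
move=> u; apply: (@continuous_comp _ _ _ fst (\val : I -> R)).
  exact: cvg_fst.
exact: continuous_val.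
Qed.

Lemma continuous_proj2 : continuous (fun u : I * I => \val u.2).
Proof.
move=> u; apply: (@continuous_comp _ _ _ snd (\val : I -> R)).
  exact: cvg_snd.
exact: continuous_val.
Qed.

Lemma continuous_homot (H : I * I -> X) (T : topologicalType) (u v : T -> R) :
  continuous H -> continuous u -> continuous v ->
  continuous (fun t => H (to_itv (u t), to_itv (v t))).
Proof.
move=> cH cu cv t.
apply: (@continuous_comp _ _ _ (fun t => (to_itv (u t), to_itv (v t))) H).
  by apply: continuous_pair; exact: continuous_to_itv.
exact: cH.
Qed.

Lemma to_itv0 : to_itv 0 = zero :> I. Proof. by []. Qed.
Lemma to_itv1 : to_itv 1 = one :> I. Proof. by []. Qed.

Lemma to_itv_le0 (t : R) : t <= 0 -> to_itv t = zero.
Proof.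
move=> t0; apply: itv_inj; rewrite val_zero val_to_itv /clip.
by rewrite (min_idPr _) ?(le_trans t0)// (max_idPl _).
Qed.

Lemma to_itv_ge1 (t : R) : 1 <= t -> to_itv t = one.
Proof.
move=> t0; apply: itv_inj; rewrite val_one val_to_itv /clip.
by rewrite (min_idPl t0); apply/max_idPr.
Qed.

Lemma homotopic_sym x y (p q : {path I from x to y}) :
  homotopic p q -> homotopic q p.
Proof.
move=> [H [cH [H0 H1] [Hx Hy]]].
exists (fun u => H (to_itv (\val u.1), to_itv (1 - \val u.2))); split => /=.
- apply: continuous_homot => //; first exact: continuous_proj1.
  by apply: continuous_onem_val; exact: continuous_proj2.
- by split=> t; rewrite to_itvK ?clip0 ?clip1 ?subr0 ?subrr ?to_itv0 ?to_itv1.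
- by split=> s; rewrite ?clip0 ?clip1 ?to_itv0 ?to_itv1.
Qed.

Lemma homotopic_trans x y (p q r : {path I from x to y}) :
  homotopic p q -> homotopic q r -> homotopic p r.
Proof.
move=> [H [cH [H0 H1] [Hx Hy]]] [K [cK [K0 K1] [Kx Ky]]].
exists (fun u => if \val u.2 <= 2^-1 then H (to_itv (\val u.1), to_itv (2 * \val u.2 + 0))
   else K (to_itv (\val u.1), to_itv (2 * \val u.2 - 1))); split => /=.
- apply: glue_continuous.
  + exact: continuous_proj2.
  + apply: continuous_homot => //; first exact: continuous_proj1.
    by apply: continuous_affine_val; exact: continuous_proj2.
  + apply: continuous_homot => //; first exact: continuous_proj1.
    by apply: continuous_affine_val; exact: continuous_proj2.
  + move=> u ->; rewrite to_itvK to_itv_ge1 ?H1 ?to_itv_le0 ?K0//; lra.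
- split=> t; rewrite to_itvK.
    by rewrite clip0 ifT ?to_itv_le0 ?H0//; lra.
  by rewrite clip1 ifF ?to_itv_ge1 ?K1//; lra.
- by split=> s; rewrite ?clip0 ?clip1 ?to_itv0 ?to_itv1 ?Hx ?Hy ?Kx ?Ky if_same.
Qed.

Lemma homotopic_concat x y z (p p' : {path I from x to y})
    (q q' : {path I from y to z}) :
  homotopic p p' -> homotopic q q' -> homotopic (concat p q) (concat p' q').
Proof.
move=> [H [cH [H0 H1] [Hx Hy]]] [K [cK [K0 K1] [Kx Ky]]].
exists (fun u => if \val u.1 <= 2^-1
   then H (to_itv (2 * \val u.1 + 0), to_itv (\val u.2))
   else K (to_itv (2 * \val u.1 - 1), to_itv (\val u.2))); split => /=.
- apply: glue_continuous.
  + exact: continuous_proj1.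
  + apply: continuous_homot => //; last exact: continuous_proj2.
    by apply: continuous_affine_val; exact: continuous_proj1.
  + apply: continuous_homot => //; last exact: continuous_proj2.
    by apply: continuous_affine_val; exact: continuous_proj1.
  + move=> u ->; rewrite to_itvK to_itv_ge1 ?Hy ?to_itv_le0 ?Kx//; lra.
- by split=> t; rewrite addr0 ?clip0 ?clip1 ?to_itv0 ?to_itv1 ?H0 ?K0 ?H1 ?K1.
- split=> s; rewrite to_itvK.
    by rewrite clip0 ifT ?to_itv_le0 ?Hx//; lra.
  by rewrite clip1 ifF ?to_itv_ge1 ?Ky//; lra.
Qed.

Lemma homotopic_reverse x y (p p' : {path I from x to y}) :
  homotopic p p' -> homotopic (reverse p) (reverse p').
Proof.
move=> [H [cH [H0 H1] [Hx Hy]]].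
exists (fun u => H (to_itv (1 - \val u.1), to_itv (\val u.2))); split => /=.
- apply: continuous_homot => //; last exact: continuous_proj2.
  by apply: continuous_onem_val; exact: continuous_proj1.
- by split=> t; rewrite ?clip0 ?clip1 ?to_itv0 ?to_itv1 ?H0 ?H1.
- split=> s; rewrite to_itvK.
    by rewrite clip0 subr0 to_itv1 Hy.
  by rewrite clip1 subrr to_itv0 Hx.
Qed.

Lemma homotopic_reparam x y a b (p : {path I from x to y})
    (q r : {path I from a to b}) (phi psi : R -> R) :
  continuous phi -> continuous psi -> phi 0 = psi 0 -> phi 1 = psi 1 ->
  (forall t : I, q t = p (to_itv (phi (\val t)))) ->
  (forall t : I, r t = p (to_itv (psi (\val t)))) -> homotopic q r.
Proof.
move=> cphi cpsi e0 e1 qE rE.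
exists (fun u => p (to_itv ((1 - \val u.2) * phi (\val u.1)
                            + \val u.2 * psi (\val u.1)))); split => /=.
- apply: continuous_path_clip => u.
  have cc (f : R -> R) : continuous f ->
      f (\val v.1) @[v --> u] --> f (\val u.1).
    move=> cf.
    exact: (@continuous_comp _ _ _ (fun u : I * I => \val u.1) f _
      (@continuous_proj1 u) (cf _)).
  apply: cvgD; apply: cvgM; [|exact: cc|exact: continuous_proj2|exact: cc].
  exact: continuous_onem_val continuous_proj2 u.
- split=> t; rewrite ?clip0 ?clip1.
    by rewrite subr0 mul1r mul0r addr0 qE.
  by rewrite subrr mul0r add0r mul1r rE.
- split=> s; rewrite ?clip0 ?clip1.
    rewrite -[RHS](path_zero (s := q)) qE val_zero -e0; congr (p (to_itv _)).
    by rewrite -mulrDl subrK mul1r.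
  rewrite -[RHS](path_one (s := q)) qE val_one -e1; congr (p (to_itv _)).
  by rewrite -mulrDl subrK mul1r.
Qed.

Lemma concatE x y z (p : {path I from x to y}) (q : {path I from y to z}) t :
  0 <= t <= 1 -> concat p q (to_itv t) =
  if t <= 2^-1 then p (to_itv (2 * t)) else q (to_itv (2 * t - 1)).
Proof. by move=> t01; rewrite /= /mk_path /concat_fun val_to_itv clip_id. Qed.

Lemma concatvE x y z (p : {path I from x to y}) (q : {path I from y to z})
    (t : I) : concat p q t =
  if \val t <= 2^-1 then p (to_itv (2 * \val t))
  else q (to_itv (2 * \val t - 1)).
Proof. by []. Qed.

Lemma reversevE x y (p : {path I from x to y}) (t : I) :
  reverse p t = p (to_itv (1 - \val t)).
Proof. by []. Qed.

Lemma continuous_line (a b : R) : continuous (fun t : R => a * t + b).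
Proof. by apply: continuous_affine_val => t; exact: cvg_id. Qed.

Lemma continuous_minf (f g : R -> R) :
  continuous f -> continuous g -> continuous (fun t => Num.min (f t) (g t)).
Proof. by move=> cf cg t; apply: continuous_min; [exact: cf|exact: cg]. Qed.

Lemma continuous_maxf (f g : R -> R) :
  continuous f -> continuous g -> continuous (fun t => Num.max (f t) (g t)).
Proof. by move=> cf cg t; apply: continuous_max; [exact: cf|exact: cg]. Qed.

Lemma concatA x y z w (p : {path I from x to y}) (q : {path I from y to z})
    (r : {path I from z to w}) :
  homotopic (concat p (concat q r)) (concat (concat p q) r).
Proof.
pose phi (t : R) := Num.min (2 * t + 0) (Num.min (1 * t + 4^-1) (2^-1 * t + 2^-1)).
have phiE (t : R) : phi t = if t <= 4^-1 then 2 * t else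
    if t <= 2^-1 then t + 4^-1 else 2^-1 * t + 2^-1.
  rewrite /phi mul1r addr0; case: ifPn => h1; last case: ifPn => h2.
  - apply/min_idPl; rewrite le_min; apply/andP; split; lra.
  - by rewrite (min_idPl (_ : t + 4^-1 <= _)) ?(min_idPr _)//; lra.
  - by rewrite (min_idPr (_ : 2^-1 * t + 2^-1 <= _)) ?(min_idPr _)//; lra.
apply: (@homotopic_reparam _ _ _ _ (concat p (concat q r)) _ _ id phi).
- by move=> t; exact: cvg_id.
- apply: continuous_minf; first exact: continuous_line.
  by apply: continuous_minf; exact: continuous_line.
- by rewrite phiE ifT ?mulr0//; lra.
- by rewrite phiE !ifF; lra.
- by move=> t; rewrite to_itvK.
- move=> t; have := itv_bound t; move: (\val t) (concatvE (concat p q) r t).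
  move=> {}t -> t01; rewrite phiE.
  case: ifPn => h2; last first.
    rewrite ifF; last lra.
    rewrite concatE; last lra.
    rewrite ifF; last lra.
    rewrite concatE; last lra.
    rewrite ifF; last lra.
    by congr (r (to_itv _)); lra.
  rewrite concatE; last lra.
  case: (boolP (t <= 4^-1)) => h4.
    rewrite ifT; last lra.
    by rewrite concatE; [rewrite ifT//|]; lra.
  rewrite ifF; last lra.
  rewrite concatE; last lra.
  rewrite ifF; last lra.
  rewrite concatE; last lra.
  rewrite ifT; last lra.
  by congr (q (to_itv _)); lra.
Qed.

Lemma concat1p x y (p : {path I from x to y}) :
  homotopic (concat (const_path x) p) p.
Proof.
apply: (@homotopic_reparam _ _ _ _ p _ _
  (fun t => Num.max 0 (2 * t - 1)) id).
- apply: continuous_maxf; last exact: continuous_line.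
  by move=> t; exact: cvg_cst.
- by move=> t; exact: cvg_id.
- by apply/max_idPl => /=; lra.
- by rewrite (max_idPr _) /=; lra.
- move=> t; rewrite concatvE; case: ifPn => h.
    by rewrite (max_idPl _) ?[RHS]path_zero_le//; lra.
  by rewrite (max_idPr _)//; lra.
- by move=> t; rewrite to_itvK.
Qed.

Lemma concatp1 x y (p : {path I from x to y}) :
  homotopic (concat p (const_path y)) p.
Proof.
apply: (@homotopic_reparam _ _ _ _ p _ _
  (fun t => Num.min 1 (2 * t + 0)) id).
- apply: continuous_minf; last exact: continuous_line.
  by move=> t; exact: cvg_cst.
- by move=> t; exact: cvg_id.
- by rewrite (min_idPr _) /=; lra.
- by apply/min_idPl => /=; lra.
- move=> t; rewrite concatvE addr0; case: ifPn => h.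
    by rewrite (min_idPr _)//; lra.
  by rewrite (min_idPl _) ?[RHS]path_one_ge//; lra.
- by move=> t; rewrite to_itvK.
Qed.

Lemma concatpV x y (p : {path I from x to y}) :
  homotopic (concat p (reverse p)) (const_path x).
Proof.
apply: (@homotopic_reparam _ _ _ _ p _ _
  (fun t => Num.min (2 * t + 0) ((-2) * t + 2)) (fun=> 0)).
- by apply: continuous_minf; exact: continuous_line.
- by move=> t; exact: cvg_cst.
- by rewrite (min_idPl _); lra.
- by rewrite (min_idPr _) /=; lra.
- move=> t; have t01 := itv_bound t; rewrite concatvE addr0; case: ifPn => h.
    by rewrite (min_idPl _)//; lra.
  rewrite reversevE val_to_itv clip_id; last lra.
  by rewrite (min_idPr _); [congr (p (to_itv _))|]; lra.
- by move=> t; rewrite [RHS]path_zero_le.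
Qed.

Lemma concatVp x y (p : {path I from x to y}) :
  homotopic (concat (reverse p) p) (const_path y).
Proof.
apply: (@homotopic_reparam _ _ _ _ p _ _
  (fun t => Num.max ((-2) * t + 1) (2 * t - 1)) (fun=> 1)).
- by apply: continuous_maxf; exact: continuous_line.
- by move=> t; exact: cvg_cst.
- by rewrite (max_idPl _); lra.
- by rewrite (max_idPr _) /=; lra.
- move=> t; have t01 := itv_bound t; rewrite concatvE; case: ifPn => h.
    rewrite reversevE val_to_itv clip_id; last lra.
    by rewrite (max_idPl _); [congr (p (to_itv _))|]; lra.
  by rewrite (max_idPr _)//; lra.
- by move=> t; rewrite [RHS]path_one_ge.
Qed.

End Homotopy.

Section FundamentalGroup.
Context (R : realType) (X : topologicalType) (x0 : X).
Local Notation loop := {path (unit_itv R) from x0 to x0}.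

Let homotopicb (p q : loop) := `[< homotopic p q >].

Let homotopicb_refl : reflexive homotopicb.
Proof. by move=> p; apply/asboolP; exact: homotopic_refl. Qed.

Let homotopicb_sym : symmetric homotopicb.
Proof.
by move=> p q; apply/idP/idP => /asboolP h; apply/asboolP; exact: homotopic_sym.
Qed.

Let homotopicb_trans : transitive homotopicb.
Proof.
move=> q p r /asboolP pq /asboolP qr; apply/asboolP.
exact: homotopic_trans pq qr.
Qed.

Definition homotopy_equiv :=
  EquivRel _ homotopicb_refl homotopicb_sym homotopicb_trans.

Definition fundamental_group := {eq_quot homotopy_equiv}.
Local Notation pi1 := fundamental_group.
HB.instance Definition _ := Choice.on pi1.
HB.instance Definition _ := EqQuotient.on pi1.

Lemma pi_homotopicP (p q : loop) : (\pi_pi1 p = \pi_pi1 q) <-> homotopic p q.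
Proof.
split=> [h|h].
- by apply/(@asboolP (homotopic p q))/(@eqmodP _ homotopy_equiv).
- by apply/(@eqmodP _ homotopy_equiv)/(@asboolP (homotopic p q)).
Qed.

Lemma repr_homotopic (p : loop) : homotopic (repr (\pi_pi1 p)) p.
Proof. by apply/pi_homotopicP; rewrite reprK. Qed.

Definition pi1_mul (a b : pi1) : pi1 := \pi_pi1 (concat (repr a) (repr b)).
Definition pi1_one : pi1 := \pi_pi1 (const_path R x0).
Definition pi1_inv (a : pi1) : pi1 := \pi_pi1 (reverse (repr a)).

Let mulA : associative pi1_mul.
Proof.
move=> a b c; apply/pi_homotopicP.
apply: (homotopic_trans
  (homotopic_concat (homotopic_refl (repr a)) (repr_homotopic _))).
apply: (homotopic_trans (concatA _ _ _)); apply: homotopic_concat.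
  exact/homotopic_sym/repr_homotopic.
exact: homotopic_refl.
Qed.

Let mul1 : left_id pi1_one pi1_mul.
Proof.
move=> a; rewrite -[RHS]reprK; apply/pi_homotopicP.
apply: homotopic_trans (concat1p _); apply: homotopic_concat.
  exact: repr_homotopic.
exact: homotopic_refl.
Qed.

Let mulr1 : right_id pi1_one pi1_mul.
Proof.
move=> a; rewrite -[RHS]reprK; apply/pi_homotopicP.
apply: homotopic_trans (concatp1 _); apply: homotopic_concat.
  exact: homotopic_refl.
exact: repr_homotopic.
Qed.

Let mulV : left_inverse pi1_one pi1_inv pi1_mul.
Proof.
move=> a; apply/pi_homotopicP.
apply: homotopic_trans (concatVp (repr a)); apply: homotopic_concat.
  exact: repr_homotopic.
exact: homotopic_refl.
Qed.

Let mulrV : right_inverse pi1_one pi1_inv pi1_mul.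
Proof.
move=> a; apply/pi_homotopicP.
apply: homotopic_trans (concatpV (repr a)); apply: homotopic_concat.
  exact: homotopic_refl.
exact: repr_homotopic.
Qed.

HB.instance Definition _ := isGroup.Build pi1 mulA mul1 mulr1 mulV mulrV.

End FundamentalGroup.

Section Rings.
Context (R : realType).
Local Notation E3 := 'rV[R]_3.

Definition dot (u v : E3) : R := \sum_(k < 3) u 0 k * v 0 k.

(* (c, r, u): centre, radius, and a normal vector of the plane. *)
Definition ring_data : Type := (E3 * R * E3)%type.
HB.instance Definition _ := Topological.on ring_data.

Definition is_ring_data (a : ring_data) : Prop :=
  0 < a.1.2 /\ dot a.2 a.2 = 1.

Definition ring_of (a : ring_data) : set E3 :=
  [set x | dot (x - a.1.1) a.2 = 0 /\
           dot (x - a.1.1) (x - a.1.1) = a.1.2 ^+ 2].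

Definition unit_disc : set (R * R) := [set z | z.1 ^+ 2 + z.2 ^+ 2 <= 1].
Definition unit_circle : set (R * R) := [set z | z.1 ^+ 2 + z.2 ^+ 2 = 1].

Definition spans_disc (C : set E3) (f : R * R -> E3) : Prop :=
  [/\ {within unit_disc, continuous f},
      set_inj unit_disc f & f @` unit_circle = C].

(* The two-component link A, B is trivial when its components bound disjoint
   embedded discs. *)
Definition unlinked (A B : set E3) : Prop :=
  exists f g : R * R -> E3, [/\ spans_disc A f, spans_disc B g &
    (f @` unit_disc) `&` (g @` unit_disc) = set0].

Definition labelled_data (n : nat) : Type := {ptws 'I_n -> ring_data}.
HB.instance Definition _ n := Topological.on (labelled_data n).

Definition ring_config_set (n : nat) : set (labelled_data n) :=
  [set a | (forall i, is_ring_data (a i)) /\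
           (forall i j, i != j -> ring_of (a i) `&` ring_of (a j) = set0 /\
                                  unlinked (ring_of (a i)) (ring_of (a j)))].

Definition labelled_config (n : nat) : Type := @ring_config_set n.
HB.instance Definition _ n := Topological.on (labelled_config n).

Definition mk_config n (a : labelled_data n) (ha : ring_config_set a) :
  labelled_config n := exist _ a (mem_set ha).

Definition rings n (a : labelled_config n) : set (set E3) :=
  [set ring_of (\val a i) | i in [set: 'I_n]].

Let same_ringsb n (a b : labelled_config n) := `[< rings a = rings b >].

Let same_ringsb_refl n : reflexive (@same_ringsb n).
Proof. by move=> a; apply/asboolP. Qed.

Let same_ringsb_sym n : symmetric (@same_ringsb n).
Proof. by move=> a b; apply/idP/idP => /asboolP h; apply/asboolP. Qed.

Let same_ringsb_trans n : transitive (@same_ringsb n).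
Proof. by move=> b a c /asboolP ab /asboolP bc; apply/asboolP; rewrite ab. Qed.

Definition same_rings n := EquivRel _
  (@same_ringsb_refl n) (@same_ringsb_sym n) (@same_ringsb_trans n).

(* A configuration is a set of n rings; the identification forgets both the
   labels of the rings and the signs of the normal vectors. *)
Definition ring_space (n : nat) : Type :=
  quotient_topology {eq_quot (same_rings n)}.
HB.instance Definition _ n := Topological.on (ring_space n).
HB.instance Definition _ n := Quotient.on (ring_space n).

Definition config_of n (a : labelled_config n) : ring_space n :=
  \pi_(ring_space n) a.

Lemma config_ofP n (a b : labelled_config n) :
  config_of a = config_of b <-> rings a = rings b.
Proof.
split=> [h|h].
- by apply/(@asboolP (rings a = rings b))/(@eqmodP _ (same_rings n)).
- by apply/(@eqmodP _ (same_rings n))/(@asboolP (rings a = rings b)).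
Qed.

Lemma config_of_continuous n : continuous (@config_of n).
Proof. exact: pi_continuous. Qed.

Definition e_x : E3 := \row_(k < 3) (k == 0)%:R.

Definition axial (a r : R) : ring_data := (a *: e_x, r, e_x).

Definition vec3 (x y z : R) : E3 := \row_(k < 3) nth 0 [:: x; y; z] k.

Lemma dotE (u v : E3) :
  dot u v = u 0 0 * v 0 0 + u 0 1 * v 0 1 + u 0 2%:R * v 0 2%:R.
Proof.
rewrite /dot !big_ord_recr big_ord0 /= add0r.
by congr (_ + _ + _); congr (u _ _ * v _ _); apply/val_inj.
Qed.

Lemma is_ring_data_axial (a r : R) : 0 < r -> is_ring_data (axial a r).
Proof. by move=> r0; split=> //=; rewrite dotE !mxE /=; lra. Qed.

Lemma ring_axialP (a r : R) (x : E3) : ring_of (axial a r) x <->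
  x 0 0 = a /\ x 0 1 ^+ 2 + x 0 2%:R ^+ 2 = r ^+ 2.
Proof.
rewrite /ring_of /= !dotE !mxE /= !mulr0 !addr0 !mulr1 !subr0.
split=> -[h1 h2]; split; try lra.
- by rewrite -h2 h1 mul0r add0r -!expr2.
- by rewrite h1 subrr mul0r add0r -!expr2.
Qed.

Definition axial_disc (a r h : R) (z : R * R) : E3 :=
  vec3 (a + h * (1 - (z.1 ^+ 2 + z.2 ^+ 2))) (r * z.1) (r * z.2).

Lemma vec3_0 x y z : vec3 x y z 0 0 = x. Proof. by rewrite mxE. Qed.
Lemma vec3_1 x y z : vec3 x y z 0 1 = y. Proof. by rewrite mxE. Qed.
Lemma vec3_2 x y z : vec3 x y z 0 2%:R = z. Proof. by rewrite mxE. Qed.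
Definition vec3E := (vec3_0, vec3_1, vec3_2).

Lemma vec3P (u v : E3) : u 0 0 = v 0 0 -> u 0 1 = v 0 1 ->
  u 0 2%:R = v 0 2%:R -> u = v.
Proof.
move=> h0 h1 h2; apply/rowP => -[[|[|[|//]]] Hk].
- by rewrite (_ : Ordinal _ = 0) //; exact/val_inj.
- by rewrite (_ : Ordinal _ = 1) //; exact/val_inj.
- by rewrite (_ : Ordinal _ = 2%:R) //; exact/val_inj.
Qed.

Lemma continuous_addf (T : topologicalType) (f g : T -> R) :
  continuous f -> continuous g -> continuous (fun t => f t + g t).
Proof. by move=> cf cg t; apply: cvgD; [exact: cf|exact: cg]. Qed.

Lemma continuous_subf (T : topologicalType) (f g : T -> R) :
  continuous f -> continuous g -> continuous (fun t => f t - g t).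
Proof. by move=> cf cg t; apply: cvgB; [exact: cf|exact: cg]. Qed.

Lemma continuous_mulf (T : topologicalType) (f g : T -> R) :
  continuous f -> continuous g -> continuous (fun t => f t * g t).
Proof. by move=> cf cg t; apply: cvgM; [exact: cf|exact: cg]. Qed.

Lemma continuous_vec3 (T : topologicalType) (f g h : T -> R) :
  continuous f -> continuous g -> continuous h ->
  continuous (fun t => vec3 (f t) (g t) (h t)).
Proof.
move=> cf cg ch t; apply/cvg_ballP => e e0.
have /cvg_ballP/(_ e e0) nf := cf t.
have /cvg_ballP/(_ e e0) ng := cg t.
have /cvg_ballP/(_ e e0) nh := ch t.
near=> u.
have bf : ball (f t) e (f u) by near: u.
have bg : ball (g t) e (g u) by near: u.
have bh : ball (h t) e (h u) by near: u.
by split=> // i [[|[|[|//]]] Hk]; rewrite !mxE.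
Unshelve. all: by end_near. Qed.

Lemma axial_disc_continuous (a r h : R) : continuous (axial_disc a r h).
Proof.
have c1 : continuous (fst : R * R -> R) by move=> z; exact: cvg_fst.
have c2 : continuous (snd : R * R -> R) by move=> z; exact: cvg_snd.
have cc (c : R) : continuous (fun _ : R * R => c) by exact: cst_continuous.
apply: continuous_vec3; [|exact: continuous_mulf|exact: continuous_mulf].
apply: (continuous_addf (cc a)); apply: (continuous_mulf (cc h)).
apply: (continuous_subf (cc 1)).
by apply: continuous_addf; exact: continuous_mulf.
Qed.

Lemma axial_disc_spans (a r h : R) : 0 < r ->
  spans_disc (ring_of (axial a r)) (axial_disc a r h).
Proof.
move=> r0; split.
- exact/continuous_subspaceT/axial_disc_continuous.
- move=> [x y] [x' y'] _ _ /= e.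
  have := congr1 (fun v : E3 => v 0 1) e.
  have := congr1 (fun v : E3 => v 0 2%:R) e.
  rewrite /axial_disc !vec3E /=.
  by move=> /(mulfI (lt0r_neq0 r0)) -> /(mulfI (lt0r_neq0 r0)) ->.
- apply/seteqP; split=> [_ [[y z] /= yz <-]|v].
    apply/ring_axialP; rewrite /axial_disc !vec3E /= yz subrr mulr0 addr0.
    by split=> //; rewrite !exprMn -mulrDr yz mulr1.
  move=> /ring_axialP[v0 v12].
  exists (r^-1 * v 0 1, r^-1 * v 0 2%:R).
    rewrite /unit_circle /= !exprMn -mulrDr v12 -exprMn.
    by rewrite mulVf ?expr1n ?lt0r_neq0.
  have vr : (r^-1 * v 0 1) ^+ 2 + (r^-1 * v 0 2%:R) ^+ 2 = 1.
    by rewrite !exprMn -mulrDr v12 -exprMn mulVf ?expr1n ?lt0r_neq0.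
  apply: vec3P; rewrite /axial_disc !vec3E /= ?mulVKf ?lt0r_neq0//.
  by rewrite vr subrr mulr0 addr0 v0.
Qed.

Lemma unlinked_sym (A B : set E3) : unlinked A B -> unlinked B A.
Proof. by move=> [f [g [hf hg fg]]]; exists g, f; split=> //; rewrite setIC. Qed.

Lemma unlinked_disjoint (A B : set E3) : unlinked A B -> A `&` B = set0.
Proof.
have sub : unit_circle `<=` unit_disc.
  by move=> z; rewrite /unit_circle /unit_disc /= => ->.
move=> [f [g [[_ _ <-] [_ _ <-] fg]]]; apply/seteqP; split=> // x [].
by move=> [z /sub zd fz] [w /sub wd gw]; rewrite -fg; split; [exists z|exists w].
Qed.

Lemma unlinked_axial (a r b s : R) : 0 < r -> 0 < s -> (a != b) || (r != s) ->
  unlinked (ring_of (axial a r)) (ring_of (axial b s)).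
Proof.
wlog rs : a r b s / r <= s => [wl r0 s0 abrs|].
  have [rs|/ltW sr] := leP r s; first exact: wl.
  by apply/unlinked_sym/wl => //; rewrite eq_sym (eq_sym s).
move=> r0 s0 abrs; exists (axial_disc a r 0), (axial_disc b s (a == b)%:R).
split; [exact: axial_disc_spans|exact: axial_disc_spans|].
apply/seteqP; split=> // _ [[[y z] /= yz <-] [[y' z'] /= yz' e]].
have := congr1 (fun v : E3 => v 0 0) e.
have := congr1 (fun v : E3 => v 0 1) e.
have := congr1 (fun v : E3 => v 0 2%:R) e.
rewrite /axial_disc !vec3E /= mul0r addr0 => e2 e1 e0.
move: abrs e0; case: eqP => [->|ab] /=; last by rewrite mul0r addr0 => _ /esym.
move=> rs' e0; have {}rs : r < s by rewrite lt_neqAle rs'.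
have one : y' ^+ 2 + z' ^+ 2 = 1 by lra.
have : s ^+ 2 <= r ^+ 2.
  have <- : r ^+ 2 * (y ^+ 2 + z ^+ 2) = s ^+ 2.
    by rewrite mulrDr -!exprMn -e1 -e2 !exprMn -mulrDr one mulr1.
  by rewrite ler_piMr ?sqr_ge0.
by rewrite leNgt ltr_sqr ?nnegrE ?ltW// rs.
Qed.

Lemma axial_config n (a r : 'I_n -> R) : (forall i, 0 < r i) ->
  (forall i j, i != j -> (a i != a j) || (r i != r j)) ->
  ring_config_set ((fun i => axial (a i) (r i)) : labelled_data n).
Proof.
move=> r0 ar; split=> [i|i j ij]; first exact: is_ring_data_axial.
have u : unlinked (ring_of (axial (a i) (r i))) (ring_of (axial (a j) (r j))).
  by apply: unlinked_axial => //; exact: ar.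
by split=> //; exact: unlinked_disjoint.
Qed.

Definition base_center (j : nat) : R := 4 * j.+1%:R.

Fact base_config_subproof n : ring_config_set
  ((fun j => axial (base_center j) 1) : labelled_data n).
Proof.
apply: axial_config => // i j ij; apply/orP; left.
apply: contra_neq ij => /(mulfI (lt0r_neq0 (ltr0n R 4))) /eqP.
by rewrite eqr_nat eqSS => /eqP/val_inj.
Qed.

Definition base_config n : labelled_config n :=
  mk_config (@base_config_subproof n).

Definition base_point n : ring_space n := config_of (base_config n).

Definition ring_group (n : nat) : Type := fundamental_group R (base_point n).
HB.instance Definition _ n := monoid.Group.on (ring_group n).

(* Rings i and i + 1 (counting from 0) exchange places along the axis; at
   t = 1/2 they lie in the same plane, with radii 1/2 and 1. *)
Definition rho_center (i : nat) (t : R) (j : nat) : R :=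
  if j == i then base_center j + 4 * t
  else if j == i.+1 then base_center j - 4 * t
  else base_center j.

Definition rho_radius (i : nat) (t : R) (j : nat) : R :=
  if j == i then 1 - 2 * t * (1 - t) else 1.

Fact rho_config_subproof n (i : 'I_n.-1) (t : R) : 0 <= t <= 1 ->
  ring_config_set
    ((fun j => axial (rho_center i t j) (rho_radius i t j)) : labelled_data n).
Proof.
move=> t01.
have rad : 0 < 1 - 2 * t * (1 - t).
  rewrite (_ : _ - _ = 2^-1 + 2 * (t - 2^-1) ^+ 2); last by field.
  by rewrite ltr_pwDl ?invr_gt0 ?ltr0n// mulr_ge0 ?sqr_ge0.
have half : 1 - 2 * 2^-1 * (1 - 2^-1) != 1 :> R by lra.
apply: axial_config => [j|].
  by rewrite /rho_radius; case: ifP.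
suff wl (j k : 'I_n) : (j < k)%N ->
    (rho_center i t j != rho_center i t k)
    || (rho_radius i t j != rho_radius i t k).
  move=> j k; rewrite -val_eqE neq_ltn => /orP[/wl //|/wl].
  by rewrite (eq_sym (rho_center _ _ k)) (eq_sym (rho_radius _ _ k)).
move=> jk.
have nat_le (a b : nat) : (a < b)%N -> 4 * a.+1%:R + 4 <= 4 * b.+1%:R :> R.
  by move=> ab; rewrite -(ler_nat R) -natr1 in ab; rewrite -!natr1; lra.
rewrite /rho_center /rho_radius /base_center.
case: (eqVneq (k : nat) i) => [ki|ki].
  rewrite -ki (ltn_eqF jk) (ltn_eqF (ltnW jk : (j < k.+1)%N)).
  by apply/orP; left; rewrite lt_eqF//; have := nat_le _ _ jk; lra.
case: (eqVneq (k : nat) i.+1) => [ki1|ki1].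
  case: (eqVneq (j : nat) i) => [ji|ji].
    have [->|th] := eqVneq t 2^-1; first by rewrite half orbT.
    apply/orP; left; rewrite ki1 ji -[i.+2%:R]natr1.
    by apply: contra_neq th => h; lra.
  rewrite ifN; last by rewrite -ki1 ltn_eqF.
  apply/orP; left; rewrite lt_eqF//.
  have ji' : (j < i)%N by rewrite ltn_neqAle ji -ltnS -ki1.
  by have := nat_le _ _ ji'; rewrite ki1 -[i.+2%:R]natr1; lra.
apply/orP; left; rewrite lt_eqF//; have := nat_le _ _ jk.
case: (eqVneq (j : nat) i) => [ji|ji]; last by case: ifP => _; lra.
have : (i.+1 < k)%N by rewrite ltn_neqAle eq_sym ki1 -ji.
by move=> /nat_le; rewrite ji -[i.+2%:R]natr1; lra.
Qed.

Definition rho_config n (i : 'I_n.-1) (t : unit_itv R) : labelled_config n :=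
  mk_config (rho_config_subproof i (itv_bound t)).

Lemma continuous_axial (c r : unit_itv R -> R) :
  continuous c -> continuous r -> continuous (fun t => axial (c t) (r t)).
Proof.
move=> cc cr.
apply: (@continuous_pair _ _ _ (fun t => (c t *: e_x, r t)) (fun=> e_x)).
  apply: (@continuous_pair _ _ _ (fun t => c t *: e_x) r) => //.
  have -> : (fun t => c t *: e_x) = fun t => vec3 (c t) 0 0.
    by apply/funext => v; apply: vec3P; rewrite vec3E !mxE /= ?mulr1 ?mulr0.
  by apply: continuous_vec3 => //; exact: cst_continuous.
exact: cst_continuous.
Qed.

Lemma rho_center_continuous (i j : nat) :
  continuous (fun t : unit_itv R => rho_center i (\val t) j).
Proof.
have cv : continuous (\val : unit_itv R -> R) := @continuous_val R.
have cc (c : R) : continuous (fun _ : unit_itv R => c).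
  exact: cst_continuous.
rewrite /rho_center; case: (j == i); last case: (j == i.+1); last exact: cc.
- exact: (continuous_addf (cc _) (continuous_mulf (cc _) cv)).
- exact: (continuous_subf (cc _) (continuous_mulf (cc _) cv)).
Qed.

Lemma rho_radius_continuous (i j : nat) :
  continuous (fun t : unit_itv R => rho_radius i (\val t) j).
Proof.
have cv : continuous (\val : unit_itv R -> R) := @continuous_val R.
have cc (c : R) : continuous (fun _ : unit_itv R => c).
  exact: cst_continuous.
rewrite /rho_radius; case: (j == i); last exact: cc.
apply: (continuous_subf (cc 1)); apply: continuous_mulf.
  exact: (continuous_mulf (cc _) cv).
exact: (continuous_subf (cc _) cv).
Qed.

Fact rho_continuous n (i : 'I_n.-1) :
  continuous (fun t => config_of (rho_config i t)).
Proof.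
suff c : continuous (rho_config i).
  by move=> t; apply: continuous_comp; [exact: c|exact: config_of_continuous].
apply: (@continuous_comp_initial (labelled_config n) _ _ \val) => t.
have F : Filter ((\val \o rho_config i) x @[x --> t]).
  exact/fmap_filter/nbhs_filter.
apply/(@cvg_sup _ _ _ _ _ F) => j.
apply: (@continuous_comp_initial (labelled_data n) _ _ (fun a => a j)).
apply: continuous_axial; first exact: rho_center_continuous.
exact: rho_radius_continuous.
Qed.

Lemma rho_at0 (i j : nat) :
  axial (rho_center i 0 j) (rho_radius i 0 j) = axial (base_center j) 1.
Proof.
by rewrite /rho_center /rho_radius !mulr0 mul0r addr0 !subr0 !if_same.
Qed.

Definition swap_ord n (i0 i1 j : 'I_n) : 'I_n :=
  if j == i0 then i1 else if j == i1 then i0 else j.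

Lemma swap_ordK n (i0 i1 : 'I_n) : involutive (swap_ord i0 i1).
Proof.
move=> j; rewrite /swap_ord; case: (eqVneq j i0) => [->|j0].
  by case: (eqVneq i1 i0) => [->|_] //; rewrite eqxx.
by case: (eqVneq j i1) => [->|/negPf j1]; rewrite ?eqxx// j1 (negPf j0).
Qed.

Lemma rho_at1 n (i : 'I_n.-1) (i0 i1 j : 'I_n) :
  i0 = i :> nat -> i1 = i.+1 :> nat ->
  axial (rho_center i 1 j) (rho_radius i 1 j) =
  axial (base_center (swap_ord i0 i1 j)) 1.
Proof.
move=> e0 e1; rewrite /rho_center /rho_radius subrr mulr0 subr0 if_same.
congr (axial _ 1); rewrite /base_center.
rewrite /swap_ord -e1 -e0 !(inj_eq val_inj).
case: (eqVneq j i0) => [->|j0].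
  by rewrite e1 e0 -[i.+2%:R]natr1; lra.
case: (eqVneq j i1) => [->|j1] //.
by rewrite e1 e0 -[i.+2%:R]natr1; lra.
Qed.

Fact rho_zero n (i : 'I_n.-1) : config_of (rho_config i zero) = base_point n.
Proof.
apply/config_ofP; rewrite /rings.
apply: eq_imagel => j _ /=.
by rewrite clip0 rho_at0.
Qed.

Fact rho_one n (i : 'I_n.-1) : config_of (rho_config i one) = base_point n.
Proof.
have i1n : (i.+1 < n)%N by rewrite -ltn_predRL.
pose i0 := Ordinal (ltnW i1n); pose i1 := Ordinal i1n.
apply/config_ofP; rewrite /rings.
apply/seteqP; split=> _ [j _ <-] /=.
- by exists (swap_ord i0 i1 j) => //=; rewrite clip1 (@rho_at1 _ _ i0 i1).
- by exists (swap_ord i0 i1 j) => //=; rewrite clip1 (@rho_at1 _ _ i0 i1)// swap_ordK.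
Qed.

Definition rho_loop n (i : 'I_n.-1) :
    {path (unit_itv R) from base_point n to base_point n} :=
  mk_path (@rho_continuous n i) (rho_zero i) (rho_one i).

Definition rho n (i : 'I_n.-1) : ring_group n :=
  \pi_(ring_group n) (rho_loop i).

End Rings.

(* Main.v *)
(* Pairs (q, x) of a ring configuration q and a point x off its rings form a
   space over the space of configurations. A point far away gives a section,
   so that the loops of configurations act by conjugation on the loops in the
   fibre over the base point. The fibre carries loops x_1, ..., x_n, where x_j
   goes once through the j-th ring, and rho_i conjugates them by the i-th Artin
   automorphism of the free group. Counting the passages through the rings
   shows that a word in the x_j that is trivial as a loop in the fibre is
   trivial in the free group. This remains so in the total space: a square of
   configurations is followed by a deformation of space, which pushes a
   null-homotopy into the fibre. Hence a braid that becomes trivial acts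
   trivially on the free group, and it is trivial by Artin's theorem; that
   theorem is proved by combing: by Fox calculus an element commuting with a free
   generator dies when this generator is deleted, so that the pure part in which
   the last strand moves is trivial, and one strand can be removed. *)

Require Import Defs.
From mathcomp Require Import all_boot all_order all_algebra.
From mathcomp Require Import all_classical all_reals topology.
From HB Require Import structures.
From mathcomp Require Import normedtype homotopy.
From mathcomp Require Import ring lra zify.
Set Implicit Arguments.
Unset Strict Implicit.
Unset Printing Implicit Defensive.
Import Order.TTheory GRing.Theory Num.Theory.
Import numFieldNormedType.Exports.

(** The group of the fibre is never computed. Two facts suffice: conjugation by the lift of [rho i]
    is known on explicit loops, and words in these loops stay distinct in the total space. A ring
    centred on the axis and orthogonal to it is a point (centre, radius) of the upper half-plane.
    Thus [rho i] becomes a motion of points, and the loops x_j are built from paths that descend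
    through the gaps between the points. The partial products x_0 ... x_{k-1} correspond to single
    gaps, and this isolates the difficulty: [rho i] disturbs only the gap between the rings i and i
    + 1. At time 1/2 both rings sit over that gap, at heights 1/2 and 1. The descending column is
    therefore cut at height 3/4; before that moment its upper part is bent to the left and its lower
    part to the right. Comparing paths at the times 0, 1/2 and 1 turns the gap path g_{i+1} into g_i
    g_{i+1}^-1 g_{i+2}, which is the Artin automorphism in disguise. The homomorphism itself exists
    by the braid relations, which come from explicit squares of points in the half-plane. *)

(** * Homomorphisms out of presented groups *)

Section PresentedLift.
Local Open Scope group_scope.
Local Open Scope quotient_scope.
Context (S : choiceType) (G : groupType) (h : S -> G).

Definition letter_ev (l : S * bool) : G := if l.2 then (h l.1)^-1 else h l.1.

Definition word_ev (w : word S) : G := foldr (fun l x => letter_ev l * x) 1 w.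

Lemma word_ev_cat u v : word_ev (u ++ v) = word_ev u * word_ev v.
Proof. by elim: u => [|l u IH] /=; rewrite ?mul1g// IH mulgA. Qed.

Lemma word_ev_eq (rels : word S -> word S -> Prop) :
  (forall u v, rels u v -> word_ev u = word_ev v) ->
  forall u v, word_eq rels u v -> word_ev u = word_ev v.
Proof.
move=> hr u v; elim=> {u v}//.
- by move=> u v w _ -> _ ->.
- by move=> u u' v v' _ eu _ ev; rewrite !word_ev_cat eu ev.
- by move=> s [] /=; rewrite /letter_ev /= mulg1 ?mulVg ?mulgV.
Qed.

Context (rels : word S -> word S -> Prop).
Hypothesis hr : forall u v, rels u v -> word_ev u = word_ev v.

(** The compatibility with the relations is an argument, so that the term itself carries what makes
    it multiplicative and the instance below can be attached to it. *)
Definition presented_lift of (forall u v, rels u v -> word_ev u = word_ev v)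
  : presented_group rels -> G := fun x => word_ev (repr x).

Lemma presented_lift_pi w :
  presented_lift hr (\pi_(presented_group rels) w) = word_ev w.
Proof. by apply: (word_ev_eq hr); exact: repr_wordP. Qed.

Lemma presented_liftM :
  {morph presented_lift hr : x y / x * y}.
Proof.
move=> x y; rewrite [LHS]presented_lift_pi word_ev_cat.
by [].
Qed.

HB.instance Definition _ :=
  isMultiplicative.Build _ _ (presented_lift hr) presented_liftM.

Lemma presented_lift_gen s :
  presented_lift hr (\pi_(presented_group rels) (gen_word s)) = h s.
Proof. by rewrite presented_lift_pi /= mulg1. Qed.

End PresentedLift.

Section MorphismTheory.
Local Open Scope group_scope.
Context (G H : groupType) (f : G -> H).
Hypothesis fM : {morph f : x y / x * y}.

Lemma morph_mul1 : f 1 = 1.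
Proof. by apply: (mulgI (f 1)); rewrite -fM !mulg1. Qed.

Lemma morph_mulV : {morph f : x / x^-1}.
Proof. by move=> x; apply/esym/mulg1_eq; rewrite -fM mulgV morph_mul1. Qed.

End MorphismTheory.

Section PresentedTheory.
Local Open Scope group_scope.
Local Open Scope quotient_scope.
Context (S : choiceType) (rels : word S -> word S -> Prop).
Local Notation P := (presented_group rels).

Lemma pi_catM u v : \pi_P (u ++ v) = \pi_P u * \pi_P v.
Proof.
apply/pi_wordP; apply: word_eq_sym.
by apply: word_eq_cat; exact: repr_wordP.
Qed.

Lemma pi_genV s : \pi_P [:: (s, true)] = (\pi_P (gen_word s))^-1.
Proof.
apply/esym/mulg1_eq; rewrite -pi_catM; apply/pi_wordP.
exact: (word_eq_cancel _ s false).
Qed.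

Lemma pi_letter_ev w : \pi_P w = word_ev (fun s => \pi_P (gen_word s)) w.
Proof.
elim: w => [//|[s b] w IH]; rewrite -cat1s pi_catM IH /=; congr (_ * _).
by case: b; rewrite /letter_ev /= ?pi_genV.
Qed.

Lemma presented_ind (Q : P -> Prop) : Q 1 ->
  (forall s x, Q x -> Q (\pi_P (gen_word s) * x)) ->
  (forall s x, Q x -> Q ((\pi_P (gen_word s))^-1 * x)) -> forall x, Q x.
Proof.
move=> Q1 Qg Qv x; rewrite -(reprK x) pi_letter_ev.
by elim: (repr x) => [//|[s []] w IH] /=; [exact: Qv|exact: Qg].
Qed.

Lemma presented_hom_eq (G : groupType) (f g : P -> G) :
  {morph f : x y / x * y} -> {morph g : x y / x * y} ->
  (forall s, f (\pi_P (gen_word s)) = g (\pi_P (gen_word s))) -> f =1 g.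
Proof.
move=> fM gM fg; apply: presented_ind => [|s x IH|s x IH].
- by rewrite !morph_mul1.
- by rewrite fM gM fg IH.
- by rewrite fM gM !morph_mulV// fg IH.
Qed.

End PresentedTheory.

(* Rewriting with [grpE] reduces words freely, products associating to the
   left. *)
Definition grpE (G : groupType) := (@mulgA G, @invgM G, @invgK G, @mulgK G,
  @mulgVK G, @mulgV G, @mulVg G, @mulg1 G, @mul1g G, @invg1 G).

(** * Free groups and the Artin action *)

Section FreeGroup.
Local Open Scope group_scope.
Local Open Scope quotient_scope.

(** One free group on countably many generators serves all braid groups at once, so that removing a
    strand changes no type. *)
Definition free_group : Type :=
  presented_group (fun _ _ : word nat => False).
HB.instance Definition _ := monoid.Group.on free_group.
Local Notation F := free_group.

Definition free_gen (j : nat) : F := \pi_F (gen_word j).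

Definition free_hom (G : groupType) (h : nat -> G) : F -> G :=
  presented_lift (fun u v (uv : False) => False_ind (word_ev h u = word_ev h v) uv).

Lemma free_homM (G : groupType) (h : nat -> G) :
  {morph free_hom h : x y / x * y}.
Proof. exact: presented_liftM. Qed.

Lemma free_homV (G : groupType) (h : nat -> G) :
  {morph free_hom h : x / x^-1}.
Proof. exact/morph_mulV/free_homM. Qed.

Lemma free_hom_gen (G : groupType) (h : nat -> G) j :
  free_hom h (free_gen j) = h j.
Proof. exact: presented_lift_gen. Qed.

Lemma free_hom_pi (G : groupType) (h : nat -> G) w :
  free_hom h (\pi_F w) = word_ev h w.
Proof. exact: presented_lift_pi. Qed.

Lemma free_ind (Q : F -> Prop) : Q 1 ->
  (forall s x, Q x -> Q (free_gen s * x)) ->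
  (forall s x, Q x -> Q ((free_gen s)^-1 * x)) -> forall x, Q x.
Proof. exact: presented_ind. Qed.

Lemma free_hom_eq (G : groupType) (f g : F -> G) :
  {morph f : x y / x * y} -> {morph g : x y / x * y} ->
  (forall s, f (free_gen s) = g (free_gen s)) -> f =1 g.
Proof. exact: presented_hom_eq. Qed.

(** The later generators are renumbered, as strands are when one of them is removed; this is what
    makes [del] compatible with the Artin automorphisms. *)
Definition del_gen (k j : nat) : F :=
  if j == k then 1 else if (j < k)%N then free_gen j else free_gen j.-1.

Definition del (k : nat) : F -> F := free_hom (del_gen k).

Lemma delM k : {morph del k : g h / g * h}. Proof. exact: free_homM. Qed.
Lemma delV k : {morph del k : g / g^-1}. Proof. exact: free_homV. Qed.

Lemma delE k j : del k (free_gen j) = del_gen k j.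
Proof. exact: free_hom_gen. Qed.

(* The Fox derivative with respect to the k-th generator, with coefficients
   pushed forward along [del k]: an element of Z[F], as a function F -> Z. *)
Fixpoint fox (k : nat) (w : word nat) (g : F) : int :=
  if w is l :: w' then
    ((l.1 == k)%:Z * (-1) ^+ l.2 * (g == 1%g)%:Z
       + fox k w' ((letter_ev (del_gen k) l)^-1 * g)%g)%R
  else 0%R.

Lemma fox_cat k u v g :
  fox k (u ++ v) g = (fox k u g + fox k v ((word_ev (del_gen k) u)^-1 * g)%g)%R.
Proof.
elim: u g => [|l u IH] g /=; first by rewrite invg1 mul1g add0r.
by rewrite IH addrA invgM mulgA.
Qed.

(** The derivative of the inverse of x_k is -x_k^-1, which becomes -1 along [del k]. Hence a
    cancelling pair of letters contributes 1 and -1 at the same element. *)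
Lemma fox_eq k u v : word_eq (fun _ _ => False) u v -> fox k u =1 fox k v.
Proof.
elim=> {u v}//.
- by move=> u v _ IH g; rewrite IH.
- by move=> u v w _ uv _ vw g; rewrite uv vw.
- move=> u u' v v' uu' IHu _ IHv g.
  by rewrite !fox_cat IHu IHv (word_ev_eq _ uu').
- move=> s b g /=; rewrite /letter_ev /=.
  case: (eqVneq s k) => [->|_] /=; rewrite ?mul0r ?add0r//.
  by case: b; rewrite /del_gen eqxx ?invg1 !mul1g ?expr0 ?expr1; ring.
Qed.

Lemma free_gen_neq1 j : free_gen j <> 1.
Proof.
move=> /pi_wordP/(@fox_eq j)/(_ 1) /=.
by rewrite !eqxx.
Qed.

(** Along [del k] the derivatives of u x_k and x_k u become D u + u and 1 + D u, where u also
    denotes its image. Comparing the coefficients at the identity forces this image to be 1. *)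
Lemma commute_del k (u : F) : commute u (free_gen k) -> del k u = 1.
Proof.
rewrite /commute -(reprK u) /free_gen -!pi_catM.
move=> /pi_wordP/(@fox_eq k)/(_ 1); rewrite !fox_cat /=.
rewrite /letter_ev /= /del_gen !eqxx !(invg1, mul1g, mulg1) /= expr0 mulr1.
rewrite [del k _]free_hom_pi.
case: eqP => [e _|_].
  by apply: invg_inj; rewrite e invg1.
by rewrite mulr0 !addr0 => /esym/(canRL (addrK _)); rewrite subrr.
Qed.

End FreeGroup.

Section ArtinAction.
Local Open Scope group_scope.
Local Open Scope quotient_scope.
Local Notation F := free_group.
Local Notation x := free_gen.

(** This convention fixes x_i x_{i+1}, hence every partial product x_0 ... x_{k-1} except the one
    with k = i + 1. In this form the exchange of rings will act on the gaps. *)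
Definition artin_gen (i j : nat) : F :=
  if j == i then x i * x i.+1 * (x i)^-1 else if j == i.+1 then x i else x j.

Definition artin_inv_gen (i j : nat) : F :=
  if j == i then x i.+1
  else if j == i.+1 then (x i.+1)^-1 * x i * x i.+1 else x j.

Definition artin (i : nat) : F -> F := free_hom (artin_gen i).

Lemma artinM i : {morph artin i : g h / g * h}. Proof. exact: free_homM. Qed.
Lemma artinV i : {morph artin i : g / g^-1}. Proof. exact: free_homV. Qed.

Definition artin_inv (i : nat) : F -> F := free_hom (artin_inv_gen i).

Lemma artin_invM i : {morph artin_inv i : g h / g * h}. Proof. exact: free_homM. Qed.
Lemma artin_invV i : {morph artin_inv i : g / g^-1}. Proof. exact: free_homV. Qed.

Let homM := (artinM, artin_invM, delM).
Let homV := (artinV, artin_invV, delV).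

Lemma artin_eq i : artin i (x i) = x i * x i.+1 * (x i)^-1.
Proof. by rewrite [LHS]free_hom_gen /artin_gen eqxx. Qed.

Lemma artin_eqS i : artin i (x i.+1) = x i.
Proof. by rewrite [LHS]free_hom_gen /artin_gen gtn_eqF ?eqxx. Qed.

Lemma artin_neq i j : j != i -> j != i.+1 -> artin i (x j) = x j.
Proof.
by move=> ji jSi; rewrite [LHS]free_hom_gen /artin_gen (negPf ji) (negPf jSi).
Qed.

Lemma artin_inv_eq i : artin_inv i (x i) = x i.+1.
Proof. by rewrite [LHS]free_hom_gen /artin_inv_gen eqxx. Qed.

Lemma artin_inv_eqS i : artin_inv i (x i.+1) = (x i.+1)^-1 * x i * x i.+1.
Proof. by rewrite [LHS]free_hom_gen /artin_inv_gen gtn_eqF ?eqxx. Qed.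

Lemma artin_inv_neq i j : j != i -> j != i.+1 -> artin_inv i (x j) = x j.
Proof.
move=> ji jSi.
by rewrite [LHS]free_hom_gen /artin_inv_gen (negPf ji) (negPf jSi).
Qed.

Lemma artinK i : cancel (artin i) (artin_inv i).
Proof.
apply: free_hom_eq => [g h|g h|j] //=; first by rewrite !homM.
have [->|ji] := eqVneq j i.
  by rewrite artin_eq !homM homV artin_inv_eq artin_inv_eqS !grpE.
have [->|jSi] := eqVneq j i.+1; first by rewrite artin_eqS artin_inv_eq.
by rewrite artin_neq ?artin_inv_neq.
Qed.

Lemma artin_invK i : cancel (artin_inv i) (artin i).
Proof.
apply: free_hom_eq => [g h|g h|j] //=; first by rewrite !homM.
have [->|ji] := eqVneq j i; first by rewrite artin_inv_eq artin_eqS.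
have [->|jSi] := eqVneq j i.+1.
  by rewrite artin_inv_eqS !homM homV artin_eqS artin_eq !grpE.
by rewrite artin_inv_neq ?artin_neq.
Qed.

Lemma artin_comm i j : (i.+1 < j)%N ->
  artin j \o artin i =1 artin i \o artin j.
Proof.
move=> ij; apply: free_hom_eq => [g h|g h|k] /=; try by rewrite !homM.
have ji : artin j (x i) = x i by rewrite artin_neq//; lia.
have jSi : artin j (x i.+1) = x i.+1 by rewrite artin_neq//; lia.
have ij' : artin i (x j) = x j by rewrite artin_neq//; lia.
have iSj : artin i (x j.+1) = x j.+1 by rewrite artin_neq//; lia.
have [->|ki] := eqVneq k i; first by rewrite ji artin_eq !homM homV ji jSi.
have [->|kSi] := eqVneq k i.+1; first by rewrite jSi artin_eqS ji.
have [->|kj] := eqVneq k j; first by rewrite ij' artin_eq !homM homV ij' iSj.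
have [->|kSj] := eqVneq k j.+1; first by rewrite iSj artin_eqS ij'.
by rewrite !artin_neq.
Qed.

Lemma artin_braid i :
  artin i \o artin i.+1 \o artin i =1 artin i.+1 \o artin i \o artin i.+1.
Proof.
apply: free_hom_eq => [g h|g h|k] /=; try by rewrite !homM.
have n1 : i != i.+1 by lia.
have n2 : i != i.+2 by lia.
have n3 : i.+2 != i by lia.
have n4 : i.+2 != i.+1 by lia.
have n5 : i.+1 != i.+2 by lia.
have fx := (artin_eq, artin_eqS, artin_neq n1 n2, artin_neq n3 n4).
have [->|k0] := eqVneq k i.
  by rewrite !(fx, homM, homV) ?grpE.
have [->|k1] := eqVneq k i.+1.
  by rewrite !(fx, homM, homV) ?grpE.
have [->|k2] := eqVneq k i.+2.
  by rewrite !(fx, homM, homV) ?grpE.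
by rewrite !artin_neq.
Qed.

(** Removing one of two crossing strands leaves no crossing: once x_i is deleted, the image of x_i
    is x_{i+1} renumbered as x_i, and the image of x_{i+1} is gone. *)
Lemma del_artin i g : del i (artin i g) = del i.+1 g.
Proof.
move: g; apply: free_hom_eq => [g h|g h|j] /=; try by rewrite !homM.
have [->|ji] := eqVneq j i.
  rewrite artin_eq !homM homV !delE /del_gen eqxx !grpE.
  by rewrite gtn_eqF ?ltnn ?ltnSn ?ifF//; lia.
have [->|jSi] := eqVneq j i.+1; first by rewrite artin_eqS !delE /del_gen !eqxx.
rewrite artin_neq// !delE /del_gen (negPf ji) (negPf jSi).
by congr (if _ then _ else _); lia.
Qed.

Lemma delS_artin i g : del i.+1 (artin i g) = del i g.
Proof.
move: g; apply: free_hom_eq => [g h|g h|j] /=; try by rewrite !homM.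
have [->|ji] := eqVneq j i.
  by rewrite artin_eq !homM homV !delE /del_gen !eqxx !grpE.
have [->|jSi] := eqVneq j i.+1.
  rewrite artin_eqS !delE /del_gen (ltn_eqF (ltnSn i)) (gtn_eqF (ltnSn i)).
  by rewrite ltnSn ltnNge leqnSn.
rewrite artin_neq// !delE /del_gen (negPf ji) (negPf jSi).
by congr (if _ then _ else _); lia.
Qed.

End ArtinAction.

Section BraidAction.
Local Open Scope group_scope.
Local Open Scope quotient_scope.
Local Notation F := free_group.
Local Notation x := free_gen.
Context (n : nat).
Local Notation B := (braid_group n).

Definition letter_act (g : F) (l : 'I_n.-1 * bool) : F :=
  if l.2 then artin_inv l.1 g else artin l.1 g.

(** The leftmost letter acts first. This right action is the one that matches conjugation [x ^ y] in
    a group. *)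
Definition word_act (w : word 'I_n.-1) (g : F) : F := foldl letter_act g w.

Lemma word_act_cat u v g : word_act (u ++ v) g = word_act v (word_act u g).
Proof. exact: foldl_cat. Qed.

Lemma word_actM w : {morph word_act w : g h / g * h}.
Proof.
elim: w => [//|[i b] w IH] g h /=; rewrite -IH.
by case: b; rewrite /letter_act /= ?artinM ?artin_invM.
Qed.

Lemma word_act_eq u v : word_eq (@braid_rel n) u v -> word_act u =1 word_act v.
Proof.
elim=> {u v}//.
- by move=> u v _ IH g; rewrite IH.
- by move=> u v w _ uv _ vw g; rewrite uv vw.
- by move=> u u' v v' _ eu _ ev g; rewrite !word_act_cat eu ev.
- by move=> s [] g /=; rewrite /letter_act /= ?artinK ?artin_invK.
- move=> _ _ [i j ij|i j ij] g /=; rewrite /letter_act /=.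
    exact: artin_comm.
  by rewrite ij; exact: artin_braid.
Qed.

Definition braid_act (b : B) : F -> F := word_act (repr b).

Lemma braid_act_pi w : braid_act (\pi_B w) =1 word_act w.
Proof. by apply: word_act_eq; exact: repr_wordP. Qed.

Lemma braid_act1 g : braid_act 1 g = g.
Proof. exact: braid_act_pi. Qed.

Lemma braid_actM a b g : braid_act (a * b) g = braid_act b (braid_act a g).
Proof. by rewrite [LHS]braid_act_pi word_act_cat. Qed.

Lemma braid_act_mulg b : {morph braid_act b : g h / g * h}.
Proof. exact: word_actM. Qed.

Lemma braid_act_invg b : {morph braid_act b : g / g^-1}.
Proof. exact/morph_mulV/braid_act_mulg. Qed.

Lemma braid_actK b : cancel (braid_act b) (braid_act b^-1).
Proof. by move=> g; rewrite -braid_actM mulgV braid_act1. Qed.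

Lemma braid_actKV b : cancel (braid_act b^-1) (braid_act b).
Proof. by move=> g; rewrite -braid_actM mulVg braid_act1. Qed.

Lemma braid_act_sigma i g : braid_act (sigma i) g = artin i g.
Proof. exact: braid_act_pi. Qed.

(** The value 1 out of range lets the combing work with natural numbers as indices. *)
Definition sig (i : nat) : B :=
  if insub i is Some j then sigma (j : 'I_n.-1) else 1.

Lemma sig_ord (i : 'I_n.-1) : sig i = sigma i.
Proof. by rewrite /sig valK. Qed.

Lemma braid_act_sig i g : (i < n.-1)%N -> braid_act (sig i) g = artin i g.
Proof. by move=> lt_i; rewrite (sig_ord (Ordinal lt_i)) braid_act_sigma. Qed.

Lemma sig_comm i j : (i.+1 < j)%N -> commute (sig i) (sig j).
Proof.
move=> ij; rewrite /sig; case: insubP => [i' _ ei|_]; last exact/commute_sym/commute1.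
case: insubP => [j' _ ej|_]; last exact/commute1.
rewrite /commute /sigma -!pi_catM; apply/pi_wordP/word_eq_rel.
by apply: braid_rel_comm; rewrite ei ej.
Qed.

Lemma sig_braid i : (i.+1 < n.-1)%N ->
  sig i * sig i.+1 * sig i = sig i.+1 * sig i * sig i.+1.
Proof.
move=> lt_i; rewrite (sig_ord (Ordinal lt_i)) (sig_ord (Ordinal (ltnW lt_i))).
have pi3 (u v w : word 'I_n.-1) :
    \pi_B u * \pi_B v * \pi_B w = \pi_B (u ++ v ++ w).
  by rewrite !pi_catM mulgA.
rewrite /sigma !pi3; apply/pi_wordP/word_eq_rel.
exact: (@braid_rel_braid _ (Ordinal (ltnW lt_i)) (Ordinal lt_i)).
Qed.

End BraidAction.

Section BraidIdentities.
Local Open Scope group_scope.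
Context (G : groupType) (a b r : G).

Lemma braid_slide : b * r = r * b -> a * b * a = b * a * b ->
  b * (a * r) * b = a * (b * (a * r)).
Proof. by move=> c e; rewrite -!mulgA -c !mulgA -e. Qed.

Lemma commute_conj_sqr t : a * r = r * b -> b * t = t * b ->
  commute a (r * t * t * r^-1).
Proof.
move=> e c; apply: (mulIg r); rewrite !grpE e -[RHS]mulgA e !grpE.
by rewrite -!(mulgA r) c -(mulgA t b) c !mulgA.
Qed.

(** Conjugation by [a] sends p to q and fixes p q; these two facts determine its inverse on p. *)
Lemma conj_inv_solve p q : a * p / a = q -> a * q / a = q^-1 * p * q ->
  a^-1 * p * a = p * q / p.
Proof.
move=> e1 e2; apply: (mulgI a); apply: (mulIg a^-1); rewrite !grpE.
have -> : a * p * q * p^-1 * a^-1 = (a * p / a) * (a * q / a) / (a * p / a).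
  by rewrite !grpE.
by rewrite e1 e2 !grpE.
Qed.

Hypotheses (ar : a * r = r * a) (ab : a * b * a = b * a * b).

(** For a = s_i, b = s_{i+1} and r = [strand m i.+2] the two conjugated squares are [pure_gen m i]
    and [pure_gen m i.+1]. *)
Lemma braid_conj_sqr :
  a * (r * b * a * a * (r * b)^-1) * a^-1 = r * b * b * r^-1.
Proof.
apply: (mulIg (a * r * b)); rewrite !grpE ar.
have -> : r * b * b * r^-1 * a * r * b = r * b * (b * a * b).
  by rewrite -(mulgA _ a r) ar !grpE.
by rewrite -ab -!mulgA; congr (r * _); rewrite !mulgA ab.
Qed.

Lemma braid_conj_sqrV :
  a * (r * b * b * r^-1) * a^-1 =
  (r * b * b * r^-1)^-1 * (r * b * a * a * (r * b)^-1) * (r * b * b * r^-1).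
Proof.
have -> : (r * b * b * r^-1)^-1 * (r * b * a * a * (r * b)^-1)
    * (r * b * b * r^-1) = r * b^-1 * a * a * b * r^-1 by rewrite !grpE.
apply: (mulIg (a * r)); rewrite !grpE ar -[RHS]mulgA ar !grpE.
rewrite -!mulgA; congr (r * _); apply: (mulgI b); rewrite !grpE -ab.
by rewrite -!mulgA; congr (a * _); rewrite !mulgA ab.
Qed.

End BraidIdentities.

(** * Faithfulness of the Artin action *)

Section Combing.
Local Open Scope group_scope.
Local Open Scope quotient_scope.
Local Notation F := free_group.
Local Notation x := free_gen.
Context (n : nat).
Local Notation B := (braid_group n).
Local Notation s := (@sig n).

(** The braids on the first m strands. Only right multiplications are constructors, which gives the
    induction that the normal form needs. *)
Inductive parabolic (m : nat) : B -> Prop :=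
| parabolic1 : parabolic m 1
| parabolicM b i : parabolic m b -> (i.+1 < m)%N -> parabolic m (b * s i)
| parabolicV b i : parabolic m b -> (i.+1 < m)%N -> parabolic m (b * (s i)^-1).

Lemma parabolic_mul m a b : parabolic m a -> parabolic m b -> parabolic m (a * b).
Proof.
move=> pa; elim=> [|{}b i _ IH im|{}b i _ IH im]; first by rewrite mulg1.
- by rewrite mulgA; exact: parabolicM.
- by rewrite mulgA; exact: parabolicV.
Qed.

(* Brings the m-th strand to position k. *)
Fixpoint strand (m k : nat) : B :=
  if m is m'.+1 then (if (k <= m')%N then s m' * strand m' k else 1) else 1.

Lemma strandS m k : (k <= m)%N -> strand m.+1 k = s m * strand m k.
Proof. by move=> /= ->. Qed.

Lemma strandmm m : strand m m = 1.
Proof. by case: m => //= m; rewrite ltnn. Qed.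

Lemma strand_last m k : (k < m)%N -> strand m k = strand m k.+1 * s k.
Proof.
elim: m => // m IH; rewrite ltnS leq_eqVlt => /orP[/eqP ->|km].
  by rewrite strandS// !strandmm mulg1 mul1g.
by rewrite !strandS// ?IH ?mulgA// ltnW.
Qed.

Lemma strand_comm_lt m k i : (i.+1 < k)%N -> commute (s i) (strand m k).
Proof.
move=> ik; elim: m => [|m IH] /=; first exact: commute1.
case: leqP => [km|_]; last exact: commute1.
by apply: commuteM IH; apply: sig_comm; exact: leq_trans km.
Qed.

Lemma strand_comm_gt m k i : (m < i)%N -> commute (s i) (strand m k).
Proof.
elim: m => [|m IH] mi /=; first exact: commute1.
case: leqP => [km|_]; last exact: commute1.
apply: commuteM; last by apply: IH; exact: ltnW.
by apply/commute_sym/sig_comm.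
Qed.

(** The generator commutes with all factors of the strand except two neighbouring ones, where the
    braid relation lowers its index. *)
Lemma strand_shift m k i : (k <= i)%N -> (i.+1 < m)%N -> (m <= n.-1)%N ->
  strand m k * s i.+1 = s i * strand m k.
Proof.
move=> ki; elim: m => // m IH; rewrite ltnS leq_eqVlt => /orP[/eqP im|im] mn.
  rewrite -im strandS; last by exact: leqW.
  rewrite strandS//; apply: braid_slide; first exact: strand_comm_gt.
  by apply: sig_braid; rewrite im.
rewrite strandS; last by lia.
have c : s i * s m = s m * s i by exact: sig_comm.
by rewrite -mulgA (IH im (ltnW mn)) !mulgA c.
Qed.

(* The pure braid in which the m-th strand goes once around the j-th one. *)
Definition pure_gen (m j : nat) : B :=
  strand m j.+1 * s j * s j * (strand m j.+1)^-1.

Lemma strand_mul_sig m j : (j < m)%N ->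
  strand m j * s j = pure_gen m j * strand m j.+1.
Proof. by move=> jm; rewrite strand_last// /pure_gen !grpE. Qed.

Definition pure_lift (m : nat) : F -> B :=
  free_hom (fun j => if (j < m)%N then pure_gen m j else 1).

Lemma pure_liftM m : {morph pure_lift m : g h / g * h}.
Proof. exact: free_homM. Qed.

Lemma pure_liftV m : {morph pure_lift m : g / g^-1}.
Proof. exact: free_homV. Qed.

Lemma pure_lift1 m : pure_lift m 1 = 1.
Proof. exact/morph_mul1/pure_liftM. Qed.

Lemma pure_lift_gen m j : pure_lift m (x j) = if (j < m)%N then pure_gen m j else 1.
Proof. exact: free_hom_gen. Qed.

Lemma pure_gen_conj_neq m i j : (i.+1 < m)%N -> (j < m)%N -> (m <= n.-1)%N ->
  i != j -> i.+1 != j -> commute (s i) (pure_gen m j).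
Proof.
move=> im jm mn ij iSj.
have [lt_ij|lt_ji] : (i.+1 < j)%N \/ (j < i)%N by lia.
  have c1 : commute (s i) (strand m j.+1) by apply: strand_comm_lt; exact: ltnW.
  have c2 : commute (s i) (s j) by exact: sig_comm.
  by do 3?[apply: commuteM => //]; exact: commuteV.
have e : s i * strand m j.+1 = strand m j.+1 * s i.+1 by rewrite strand_shift.
have c : s i.+1 * s j = s j * s i.+1 by apply/commute_sym/sig_comm.
exact: commute_conj_sqr e c.
Qed.

Lemma pure_gen_conj_eq m i : (i.+1 < m)%N -> (m <= n.-1)%N ->
  s i * pure_gen m i / s i = pure_gen m i.+1.
Proof.
move=> im mn; rewrite /pure_gen (strand_last im); apply: braid_conj_sqr.
  exact: strand_comm_lt.
exact/sig_braid/(leq_trans im).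
Qed.

Lemma pure_gen_conj_eqS m i : (i.+1 < m)%N -> (m <= n.-1)%N ->
  s i * pure_gen m i.+1 / s i =
  (pure_gen m i.+1)^-1 * pure_gen m i * pure_gen m i.+1.
Proof.
move=> im mn; rewrite /pure_gen (strand_last im); apply: braid_conj_sqrV.
  exact: strand_comm_lt.
exact/sig_braid/(leq_trans im).
Qed.

Let pure_img m (b : B) := exists g, b = pure_lift m g.

Lemma pure_img_conj m a : (forall j, (j < m)%N -> pure_img m (a * pure_gen m j / a)) ->
  forall g, pure_img m (a * pure_lift m g / a).
Proof.
move=> h; apply: free_ind => [|j g [u eu]|j g [u eu]].
- by exists 1; rewrite pure_lift1 mulg1 mulgV.
- have -> : a * pure_lift m (x j * g) / a =
    (a * pure_lift m (x j) / a) * (a * pure_lift m g / a).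
    by rewrite pure_liftM !grpE.
  rewrite eu pure_lift_gen; case: ifPn => [jm|_].
    by have [v ->] := h _ jm; exists (v * u); rewrite pure_liftM.
  by exists u; rewrite !grpE.
- have -> : a * pure_lift m ((x j)^-1 * g) / a =
    (a * pure_lift m (x j) / a)^-1 * (a * pure_lift m g / a).
    by rewrite pure_liftM pure_liftV !grpE.
  rewrite eu pure_lift_gen; case: ifPn => [jm|_].
    have [v ->] := h _ jm; exists (v^-1 * u).
    by rewrite pure_liftM pure_liftV.
  by exists u; rewrite !grpE.
Qed.

(** Conjugation by [s i] acts on the generators of the pure part by formulas of Artin type, so it
    preserves the image of [pure_lift m]; this is the normality used in the combing. *)
Lemma pure_gen_conj m i j : (i.+1 < m)%N -> (j < m)%N -> (m <= n.-1)%N ->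
  pure_img m (s i * pure_gen m j / s i) /\
  pure_img m ((s i)^-1 * pure_gen m j / (s i)^-1).
Proof.
move=> im jm mn.
have E k : (k < m)%N -> pure_gen m k = pure_lift m (x k).
  by move=> km; rewrite pure_lift_gen km.
have im' := ltnW im.
have e1 := pure_gen_conj_eq im mn.
have e2 := pure_gen_conj_eqS im mn.
have [->|ij] := eqVneq j i.
  split; first by exists (x i.+1); rewrite e1 E.
  exists (x i * x i.+1 * (x i)^-1); rewrite !pure_liftM pure_liftV -!E//.
  by rewrite invgK; exact: conj_inv_solve e1 e2.
have [->|iSj] := eqVneq j i.+1.
  split; last by exists (x i); rewrite -E// -e1 !grpE.
  exists ((x i.+1)^-1 * x i * x i.+1).
  by rewrite e2 !pure_liftM pure_liftV -!E.
have c : commute (s i) (pure_gen m j).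
  by apply: pure_gen_conj_neq => //; rewrite eq_sym.
split; exists (x j); rewrite -E//.
  by rewrite (c : _ = _) !grpE.
by rewrite invgK -mulgA -(c : _ = _) !grpE.
Qed.

Lemma parabolic_conj m b g : (m <= n.-1)%N -> parabolic m b ->
  pure_img m (b * pure_lift m g / b).
Proof.
move=> mn pb; elim: pb g => [|{}b i _ IH im|{}b i _ IH im] g.
- by exists g; rewrite !grpE.
- have [u eu] : pure_img m (s i * pure_lift m g / s i).
    by apply: pure_img_conj => j jm; have [] := pure_gen_conj im jm mn.
  by have [v ev] := IH u; exists v; rewrite -ev -eu !grpE.
- have [u eu] : pure_img m ((s i)^-1 * pure_lift m g / (s i)^-1).
    by apply: pure_img_conj => j jm; have [] := pure_gen_conj im jm mn.
  by have [v ev] := IH u; exists v; rewrite -ev -eu !grpE.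
Qed.

(** Combing: the [strand m k] represent the cosets. A generator on the right of [strand m k] slides
    through it into the smaller braid group, or changes k by one, possibly at the cost of a pure
    generator. This one is moved to the left of c by [parabolic_conj]. *)
Lemma parabolic_normal_form m b : (m <= n.-1)%N -> parabolic m.+1 b ->
  exists g c k, [/\ (k <= m)%N, parabolic m c & b = pure_lift m g * c * strand m k].
Proof.
move=> mn; elim=> {b} [|b i _ [g [c [k [km pc ->]]]] im
                        |b i _ [g [c [k [km pc ->]]]] im].
- exists 1, 1, m; split=> //; first exact: parabolic1.
  by rewrite strandmm pure_lift1 !mulg1.
- have [ik|ki|ki] := ltngtP i k.
  + have [ik1|ik1] := ltnP i.+1 k.
      exists g, (c * s i), k; split=> //.
        by apply: parabolicM => //; exact: leq_trans km.
      by rewrite -!mulgA -(strand_comm_lt m ik1 : _ = _).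
    have ek : k = i.+1 by lia.
    exists g, c, i; split=> //; first by lia.
    by rewrite ek -mulgA -strand_last//; lia.
  + case: i ki im => // i ki im.
    exists g, (c * s i), k; split=> //; first exact: parabolicM.
    by rewrite -!mulgA strand_shift.
  + rewrite ki in im *.
    have [v ev] := parabolic_conj (x k) mn pc.
    exists (g * v), c, k.+1; split=> //.
    rewrite -mulgA strand_mul_sig// pure_liftM -ev pure_lift_gen.
    by rewrite (im : (k < m)%N) !grpE.
- have [ik|ki|ki] := ltngtP i k.
  + have [ik1|ik1] := ltnP i.+1 k.
      exists g, (c * (s i)^-1), k; split=> //.
        by apply: parabolicV => //; exact: leq_trans km.
      have := commute_sym (commuteV (commute_sym (strand_comm_lt m ik1))).
      by rewrite -!mulgA => /= <-.
    have ek : k = i.+1 by lia.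
    have [v ev] := parabolic_conj (x i) mn pc.
    exists (g * v^-1), c, i; split=> //; first by lia.
    rewrite ek pure_liftM pure_liftV -ev pure_lift_gen.
    have lt_i : (i < m)%N by lia.
    by rewrite lt_i (strand_last lt_i) /pure_gen !grpE.
  + case: i ki im => // i ki im.
    exists g, (c * (s i)^-1), k; split=> //; first exact: parabolicV.
    have e : strand m k / s i.+1 = (s i)^-1 * strand m k.
      apply: (mulgI (s i)); apply: (mulIg (s i.+1)).
      by rewrite !grpE strand_shift.
    by rewrite -!mulgA e.
  + rewrite ki in im *.
    exists g, c, k.+1; split=> //.
    by rewrite strand_last// !grpE.
Qed.

Lemma parabolic_act m b j : parabolic m b -> (m <= j)%N -> (m <= n)%N ->
  braid_act b (x j) = x j.
Proof.
move=> pb mj mn; have fixV i : (i.+1 < m)%N -> braid_act (s i) (x j) = x j.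
  by move=> im; rewrite braid_act_sig ?artin_neq//; lia.
elim: pb => [|{}b i _ IH im|{}b i _ IH im]; first exact: braid_act1.
- by rewrite braid_actM IH fixV.
- by rewrite braid_actM IH -{1}(fixV i)// braid_actK.
Qed.

Lemma del_strand m k g : (k <= m)%N -> (m <= n.-1)%N ->
  del k (braid_act (strand m k) g) = del m g.
Proof.
elim: m g => [|m IH] g; first by case: k => // _ _; rewrite braid_act1.
rewrite leq_eqVlt ltnS => /orP[/eqP -> _|km mn].
  by rewrite strandmm braid_act1.
rewrite strandS// braid_actM IH ?braid_act_sig ?del_artin//; exact: ltnW.
Qed.

Lemma strand_act_last m k : (k <= m)%N -> (m <= n.-1)%N ->
  braid_act (strand m k) (x m) = x k.
Proof.
elim: m => [|m IH]; first by case: k => // _ _; rewrite braid_act1.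
rewrite leq_eqVlt ltnS => /orP[/eqP -> _|km mn].
  by rewrite strandmm braid_act1.
by rewrite strandS// braid_actM braid_act_sig// artin_eqS IH//; exact: ltnW.
Qed.

Lemma strand_act_lt m k j : (j < k)%N -> (k <= m)%N -> (m <= n.-1)%N ->
  braid_act (strand m k) (x j) = x j.
Proof.
move=> jk; elim: m => [|m IH] km mn; first by rewrite braid_act1.
move: km; rewrite leq_eqVlt ltnS => /orP[/eqP ->|km].
  by rewrite strandmm braid_act1.
by rewrite strandS// braid_actM braid_act_sig// artin_neq ?IH//; lia.
Qed.

Lemma del_pure_gen m j g : (j < m)%N -> (m <= n.-1)%N ->
  del m (braid_act (pure_gen m j) g) = del m g.
Proof.
move=> jm mn; rewrite /pure_gen !braid_actM.
rewrite -(@del_strand m j.+1)// braid_actKV !braid_act_sig; [|lia|lia].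
by rewrite delS_artin del_artin del_strand.
Qed.

Lemma pure_gen_act m j : (j < m)%N -> (m <= n.-1)%N ->
  braid_act (pure_gen m j) (x m) = x j * x m * (x j)^-1.
Proof.
move=> jm mn; apply: (can_inj (braid_actK (strand m j.+1))).
rewrite /pure_gen 3!braid_actM braid_actKV strand_act_last//.
rewrite !braid_act_sig; [|lia|lia].
rewrite artin_eqS artin_eq !braid_act_mulg braid_act_invg strand_act_last//.
by rewrite strand_act_lt.
Qed.

(** The word g can be read off from the action: it is the conjugator of x_m after x_m is deleted.
    The first conjunct, triviality modulo x_m, is what carries the induction, as the conjugators are
    themselves acted upon. *)
Lemma pure_lift_act m g : (m <= n.-1)%N ->
  (forall h, del m (braid_act (pure_lift m g) h) = del m h) /\
  exists u, braid_act (pure_lift m g) (x m) = u * x m * u^-1 /\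
            del m u = free_hom (fun j => if (j < m)%N then x j else 1) g.
Proof.
move=> mn; move: g.
have delx j : (j < m)%N -> del m (x j) = x j.
  by move=> jm; rewrite delE /del_gen jm ltn_eqF.
apply: free_ind => [|j g [IH [u [eu du]]]|j g [IH [u [eu du]]]].
- rewrite pure_lift1 (morph_mul1 (@free_homM _ _)).
  split=> [h|]; first by rewrite braid_act1.
  by exists 1; rewrite braid_act1 (morph_mul1 (@delM _)) ?grpE.
- rewrite pure_liftM free_homM free_hom_gen pure_lift_gen.
  case: ifPn => [jm|_]; last by rewrite !mul1g; split=> //; exists u.
  split=> [h|]; first by rewrite braid_actM IH del_pure_gen.
  exists (braid_act (pure_lift m g) (x j) * u); split.
    rewrite braid_actM pure_gen_act// !braid_act_mulg braid_act_invg eu.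
    by rewrite !grpE.
  by rewrite delM IH du delx.
- rewrite pure_liftM pure_liftV free_homM free_homV free_hom_gen pure_lift_gen.
  case: ifPn => [jm|_]; last by rewrite !invg1 !mul1g; split=> //; exists u.
  set a := pure_gen m j.
  have da h : del m (braid_act a^-1 h) = del m h.
    by rewrite -(del_pure_gen _ jm mn) braid_actKV.
  split=> [h|]; first by rewrite braid_actM IH da.
  pose v := braid_act a^-1 (x j).
  exists (braid_act (pure_lift m g) v^-1 * u); split.
    have -> : braid_act (a^-1 * pure_lift m g) (x m) =
        braid_act (pure_lift m g) (v^-1 * x m * v).
      rewrite braid_actM; congr (braid_act _ _).
      apply: (can_inj (braid_actK a)).
      rewrite braid_actKV !braid_act_mulg braid_act_invg braid_actKV.
      by rewrite pure_gen_act// !grpE.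
    by rewrite !braid_act_mulg !braid_act_invg eu !grpE.
  by rewrite delM IH du delV da delx.
Qed.

(** The image of x_m decides. It is a conjugate of x_k, so k = m; then the conjugator commutes with
    x_m and dies under [del m], which by [pure_lift_act] kills the pure factor. *)
Lemma parabolic_faithful m b : (m <= n)%N -> parabolic m b ->
  (forall j, braid_act b (x j) = x j) -> b = 1.
Proof.
elim: m b => [|m IH] b mn pb bx.
  by case: pb => // ? ?.
have mn1 : (m <= n.-1)%N by lia.
have [g [c [k [km pc eb]]]] := parabolic_normal_form mn1 pb.
have [_ [u [eu du]]] := pure_lift_act g mn1.
have cxm : braid_act c (x m) = x m by apply: (parabolic_act pc) => //; exact: ltnW.
have := bx m; rewrite eb !braid_actM eu !braid_act_mulg !braid_act_invg cxm.
rewrite strand_act_last//.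
set w := braid_act (strand m k) _ => ew.
have ekm : k = m.
  apply/eqP; apply: contraT => km'; have lt_km : (k < m)%N by rewrite ltn_neqAle km'.
  (* Deleting x_k kills a conjugate of x_k, whereas x_m with m > k becomes x_{m-1}. *)
  have := congr1 (del k) ew; rewrite !delM delV !delE /del_gen eqxx.
  rewrite gtn_eqF// ltnNge km /= !grpE => /esym.
  by move=> /free_gen_neq1.
move: ew eb; rewrite /w ekm strandmm braid_act1 mulg1 => ew eb.
have ux : commute u (x m).
  rewrite /commute; apply: (mulIg u^-1); rewrite mulgK.
  apply: (can_inj (braid_actK c)).
  by rewrite !braid_act_mulg braid_act_invg cxm ew.
(* [pure_lift m] factors through the truncation to the first m generators, the form in which g
   appears in [du]. *)
have g1 : pure_lift m g = 1.
  rewrite -(pure_lift1 m) -(commute_del ux) du; move: (g).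
  apply: free_hom_eq => [|g1 g2|j]; [exact: pure_liftM| |].
    by rewrite free_homM pure_liftM.
  rewrite free_hom_gen pure_lift_gen; case: ifPn => jm.
    by rewrite pure_lift_gen jm.
  by rewrite pure_lift1.
move: eb; rewrite g1 mul1g => eb.
by apply: (IH c (ltnW mn) pc) => j; rewrite -[RHS](bx j) eb.
Qed.

Lemma parabolicT b : parabolic n b.
Proof.
move: b.
have lt_n (i : 'I_n.-1) : (i.+1 < n)%N by case: i => i /=; lia.
apply: presented_ind => [|i b pb|i b pb]; first exact: parabolic1.
- rewrite -[X in X * b]/(sigma i) -sig_ord; apply: parabolic_mul pb.
  by rewrite -[s i]mul1g; apply: parabolicM (lt_n i); exact: parabolic1.
- rewrite -[X in X^-1 * b]/(sigma i) -sig_ord; apply: parabolic_mul pb.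
  by rewrite -[(s i)^-1]mul1g; apply: parabolicV (lt_n i); exact: parabolic1.
Qed.

Theorem braid_act_faithful (b : B) :
  (forall j, braid_act b (x j) = x j) -> b = 1.
Proof. exact: parabolic_faithful (leqnn n) (parabolicT b). Qed.

Definition free_trunc : F -> F :=
  free_hom (fun j => if (j < n)%N then x j else 1).

Lemma free_truncM : {morph free_trunc : g h / g * h}.
Proof. exact: free_homM. Qed.

Lemma free_trunc_gen j : free_trunc (x j) = if (j < n)%N then x j else 1.
Proof. exact: free_hom_gen. Qed.

Lemma free_trunc_act (b : B) g : free_trunc (braid_act b g) = braid_act b (free_trunc g).
Proof.
have truncV := morph_mulV free_truncM.
have h (i : 'I_n.-1) g' : free_trunc (artin i g') = artin i (free_trunc g').
  have i1n : (i.+1 < n)%N by case: i => i /=; lia.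
  have it : free_trunc (x i) = x i by rewrite free_trunc_gen ltnW.
  have i1t : free_trunc (x i.+1) = x i.+1 by rewrite free_trunc_gen i1n.
  move: g'; apply: free_hom_eq => [g1 g2|g1 g2|j].
  - by rewrite artinM free_truncM.
  - by rewrite free_truncM artinM.
  have [->|ji] := eqVneq j i; first by rewrite it artin_eq !free_truncM truncV it i1t.
  have [->|jSi] := eqVneq j i.+1; first by rewrite i1t artin_eqS it.
  rewrite artin_neq// free_trunc_gen; case: ifP => _; first by rewrite artin_neq.
  exact/esym/morph_mul1/artinM.
move: b g; apply: presented_ind => [|i b IH|i b IH] g.
- by rewrite !braid_act1.
- by rewrite !braid_actM IH -[\pi_B (gen_word i)]/(sigma i) !braid_act_sigma h.
- rewrite !braid_actM IH -[\pi_B (gen_word i)]/(sigma i); congr (braid_act _ _).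
  apply: (can_inj (braid_actK (sigma i))).
  by rewrite braid_actKV !braid_act_sigma -h -braid_act_sigma braid_actKV.
Qed.

(** In the application [f] is the lift to the total space and [e] the realisation of words by loops
    in the fibre. Words are recovered up to [free_trunc] only; the x_j with j >= n are fixed by
    every braid. *)
Theorem braid_hom_faithful (G : groupType) (f : B -> G) (e : F -> G) :
  {morph f : a b / a * b} -> {morph e : g h / g * h} ->
  (forall (i : 'I_n.-1) j, e (x j) ^ f (sigma i) = e (artin i (x j))) ->
  (forall g, e g = 1 -> free_trunc g = 1) ->
  forall b, f b = 1 -> b = 1.
Proof.
move=> fM eM fe e_inj b fb.
have act_sigma (i : 'I_n.-1) g : e g ^ f (sigma i) = e (artin i g).
  move: g; apply: free_hom_eq => [g h|g h|j]; rewrite ?eM ?conjMg//.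
  by rewrite artinM eM.
have act c g : e g ^ f c = e (braid_act c g).
  move: c g; apply: presented_ind => [|i c IH|i c IH] g.
  - by rewrite morph_mul1// conjg1 braid_act1.
  - by rewrite fM conjgM -[\pi_B (gen_word i)]/(sigma i) act_sigma IH braid_actM
      braid_act_sigma.
  - rewrite fM (morph_mulV fM) conjgM -[\pi_B (gen_word i)]/(sigma i) braid_actM -IH.
    congr (_ ^ _); apply: (@conjg_inj _ (f (sigma i))).
    by rewrite conjgKV act_sigma -braid_act_sigma braid_actKV.
apply: braid_act_faithful => j.
have [nj|jn] := leqP n j; first by apply: (parabolic_act (parabolicT b)).
have xj : free_trunc (x j) = x j by rewrite free_trunc_gen jn.
rewrite -xj -free_trunc_act; apply: divg1_eq; rewrite -(morph_mulV free_truncM).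
rewrite -free_truncM; apply: e_inj; rewrite eM (morph_mulV eM) -act fb conjg1.
exact: mulgV.
Qed.

End Combing.

(** * Classes of paths *)

Section PathClass.
Local Open Scope ring_scope.
Local Open Scope group_scope.
Local Open Scope quotient_scope.
Context (R : realType) (X : topologicalType) (x0 : X).
Local Notation I := (unit_itv R).
Local Notation pi1 := (fundamental_group R x0).

Lemma pi1_concat (p q : {path I from x0 to x0}) :
  \pi_pi1 (concat p q) = \pi_pi1 p * \pi_pi1 q.
Proof.
apply/pi_homotopicP; apply: homotopic_sym.
by apply: homotopic_concat; exact: repr_homotopic.
Qed.

(* An arbitrary path from the base point to x, normalised to be null-homotopic
   for x = x0; it turns the fundamental groupoid into a group. *)
Definition some_path (x : X) : option {path I from x0 to x} :=
  if pselect (exists p : {path I from x0 to x}, True) is left h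
  then Some (projT1 (cid h)) else None.

Definition base_path (x : X) : option {path I from x0 to x} :=
  if some_path x0 is Some u then
    (if some_path x is Some v then Some (concat (reverse u) v) else None)
  else None.

Lemma base_path_exists x : {path I from x0 to x} -> exists p, base_path x = Some p.
Proof.
move=> p; rewrite /base_path /some_path.
case: pselect => [h0|[]]; last by exists (const_path R x0).
by case: pselect => [h|[]]; [eexists|exists p].
Qed.

Lemma base_path0 : exists2 p, base_path x0 = Some p & homotopic p (const_path R x0).
Proof.
rewrite /base_path; case e : (some_path x0) => [u|].
  by eexists; [by []|exact: concatVp].
by move: e; rewrite /some_path; case: pselect => // -[]; exists (const_path R x0).
Qed.

(** Paths with arbitrary ends get multiplicative values in one group, so that identities between
    paths become identities between words. The value is 1 on components not reached from the base
    point. *)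
Definition path_class (x y : X) (p : {path I from x to y}) : pi1 :=
  if base_path x is Some u then
    (if base_path y is Some v
     then \pi_pi1 (concat (concat u p) (reverse v)) else 1)
  else 1.

Lemma base_path_None x y (p : {path I from x to y}) :
  base_path x = None -> base_path y = None.
Proof.
move=> ex; case ey : (base_path y) => [v|//].
by have [u] := base_path_exists (concat v (reverse p)); rewrite ex.
Qed.

Lemma path_class_homotopic x y (p q : {path I from x to y}) :
  homotopic p q -> path_class p = path_class q.
Proof.
move=> pq; rewrite /path_class; case: base_path => [u|//].
case: base_path => [v|//]; apply/pi_homotopicP.
apply: homotopic_concat (homotopic_refl _).
exact: homotopic_concat (homotopic_refl _) pq.
Qed.

Lemma path_class_concat x y z (p : {path I from x to y}) (q : {path I from y to z}) :
  path_class (concat p q) = path_class p * path_class q.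
Proof.
rewrite /path_class; case ex : (base_path x) => [u|]; last first.
  by rewrite (base_path_None p ex) mulg1.
have [v ->] := base_path_exists (concat u p).
have [w ->] := base_path_exists (concat (concat u p) q).
rewrite -pi1_concat; apply/pi_homotopicP/homotopic_sym.
apply: homotopic_trans (homotopic_sym (concatA _ _ _)) _.
have r := @homotopic_refl R X.
apply: (@homotopic_trans _ _ _ _ _ (concat (concat u p) (concat q (reverse w)))).
  apply: homotopic_concat (r _ _ _) _.
  apply: homotopic_trans (concatA _ _ _) _.
  apply: homotopic_concat (r _ _ _).
  apply: homotopic_trans (concatA _ _ _) _.
  apply: homotopic_trans (homotopic_concat (concatVp _) (r _ _ _)) _.
  exact: concat1p.
apply: homotopic_trans (concatA _ _ _) _.
apply: homotopic_concat (r _ _ _).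
exact/homotopic_sym/concatA.
Qed.

Lemma path_class_const x : path_class (const_path R x) = 1.
Proof.
apply: (mulgI (path_class (const_path R x))).
by rewrite -path_class_concat mulg1; apply/path_class_homotopic/concat1p.
Qed.

Lemma path_class_reverse x y (p : {path I from x to y}) :
  path_class (reverse p) = (path_class p)^-1.
Proof.
apply/esym/mulg1_eq; rewrite -path_class_concat -[RHS](path_class_const x).
exact/path_class_homotopic/concatpV.
Qed.

Lemma path_class_loop (p : {path I from x0 to x0}) : path_class p = \pi_pi1 p.
Proof.
have [u eu hu] := base_path0; rewrite /path_class eu.
apply/pi_homotopicP.
apply: homotopic_trans (homotopic_concat (homotopic_refl _) (homotopic_reverse hu)) _.
apply: homotopic_trans (homotopic_concat (homotopic_concat hu (homotopic_refl _)) (homotopic_refl _)) _.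
apply: homotopic_trans (homotopic_concat (concat1p _) (homotopic_refl _)) _.
apply: homotopic_trans (concatp1 (p : {path I from x0 to x0})).
apply: homotopic_concat; first exact: homotopic_refl.
apply: homotopic_trans (concatVp (const_path R x0)).
exact/homotopic_sym/concatp1.
Qed.

Local Close Scope group_scope.

(** The two boundary paths of the square have the parametrisations (f, g) and (g, f), and the square
    is convex, so they are joined by a linear interpolation. *)
Lemma square_homotopic (K : I * I -> X) (a b c d : X)
    (bot : {path I from a to b}) (right : {path I from b to d})
    (left : {path I from a to c}) (top : {path I from c to d}) :
  continuous K ->
  (forall t, bot t = K (t, zero)) -> (forall t, right t = K (one, t)) ->
  (forall t, left t = K (zero, t)) -> (forall t, top t = K (t, one)) ->
  homotopic (concat bot right) (concat left top).
Proof.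
move=> cK botE rightE leftE topE.
pose f (t : R) := Num.min (2 * t + 0) 1; pose g (t : R) := Num.max (2 * t - 1) 0.
have cf : continuous f.
  by apply: continuous_minf; [exact: continuous_line|move=> t; exact: cvg_cst].
have cg : continuous g.
  by apply: continuous_maxf; [exact: continuous_line|move=> t; exact: cvg_cst].
have f0 : f 0 = 0 by rewrite /f (min_idPl _); lra.
have f1 : f 1 = 1 by rewrite /f (min_idPr _)//; lra.
have g0 : g 0 = 0 by rewrite /g (max_idPr _)//; lra.
have g1 : g 1 = 1 by rewrite /g (max_idPl _); lra.
have cmp (h : R -> R) : continuous h -> continuous (fun u : I * I => h (\val u.1)).
  move=> ch u; apply: (@continuous_comp _ _ _ (fun u : I * I => \val u.1) h).
    exact: continuous_proj1.
  exact: ch.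
have cF (h1 h2 : R -> R) : continuous h1 -> continuous h2 -> continuous
    (fun u : I * I => (1 - \val u.2) * h1 (\val u.1) + \val u.2 * h2 (\val u.1)).
  move=> ch1 ch2; apply: continuous_addf; apply: continuous_mulf.
  - exact: (continuous_onem_val (@continuous_proj2 R)).
  - exact: cmp.
  - exact: continuous_proj2.
  - exact: cmp.
exists (fun u => K (to_itv ((1 - \val u.2) * f (\val u.1) + \val u.2 * g (\val u.1)),
                    to_itv ((1 - \val u.2) * g (\val u.1) + \val u.2 * f (\val u.1)))).
split => /=.
- by apply: continuous_homot => //; exact: cF.
- split=> t; have /= t01 := Defs.itv_bound t; rewrite ?clip0 ?clip1.
    rewrite !subr0 !mul1r !mul0r !addr0 concatvE /f /g /=; case: ifPn => h.
      by rewrite (min_idPl _) ?(max_idPr _) ?addr0 ?botE//; lra.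
    by rewrite (min_idPr _) ?(max_idPl _) ?rightE//; lra.
  rewrite !subrr !mul1r !mul0r !add0r concatvE /f /g /=; case: ifPn => h.
    by rewrite (min_idPl _) ?(max_idPr _) ?addr0 ?leftE//; lra.
  by rewrite (min_idPr _) ?(max_idPl _) ?topE//; lra.
- split=> s; rewrite ?clip0 ?clip1 ?f0 ?g0 ?f1 ?g1 ?mulr0 ?mulr1 ?addr0 ?subrK.
    by rewrite to_itv0 -botE path_zero.
  by rewrite to_itv1 -topE path_one.
Qed.

Lemma square_class (K : I * I -> X) (a b c d : X)
    (bot : {path I from a to b}) (right : {path I from b to d})
    (left : {path I from a to c}) (top : {path I from c to d}) :
  continuous K ->
  (forall t, bot t = K (t, zero)) -> (forall t, right t = K (one, t)) ->
  (forall t, left t = K (zero, t)) -> (forall t, top t = K (t, one)) ->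
  (path_class bot * path_class right = path_class left * path_class top)%g.
Proof.
move=> cK e1 e2 e3 e4; rewrite -!path_class_concat.
exact/path_class_homotopic/(square_homotopic cK).
Qed.

End PathClass.

Section PathMap.
Context (R : realType) (X Y : topologicalType) (h : X -> Y).
Hypothesis ch : continuous h.
Local Notation I := (unit_itv R).

Section OnePath.
Context (x y : X) (p : {path I from x to y}).

Fact path_map_continuous : continuous (h \o p).
Proof. by move=> t; apply: continuous_comp; [exact: cts_fun|exact: ch]. Qed.

Fact path_map_zero : (h \o p) zero = h x. Proof. by rewrite /= path_zero. Qed.
Fact path_map_one : (h \o p) one = h y. Proof. by rewrite /= path_one. Qed.

Definition path_map : {path I from h x to h y} :=
  mk_path path_map_continuous path_map_zero path_map_one.

End OnePath.

Lemma path_map_homotopic x y (p q : {path I from x to y}) :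
  homotopic p q -> homotopic (path_map p) (path_map q).
Proof.
move=> [H [cH [H0 H1] [Hx Hy]]]; exists (h \o H); split=> /=.
- by move=> u; apply: continuous_comp; [exact: cH|exact: ch].
- by split=> t; rewrite ?H0 ?H1.
- by split=> t; rewrite ?Hx ?Hy.
Qed.

Lemma path_map_concat x y z (p : {path I from x to y}) (q : {path I from y to z}) :
  path_map (concat p q) = concat (path_map p) (path_map q).
Proof.
by apply/path_eqP => t /=; rewrite /mk_path /= /concat_fun; case: ifP.
Qed.

Local Open Scope group_scope.
Local Open Scope quotient_scope.
Context (x0 : X).
Local Notation pi1X := (fundamental_group R x0).
Local Notation pi1Y := (fundamental_group R (h x0)).

Definition pi1_map (a : pi1X) : pi1Y := \pi_pi1Y (path_map (repr a)).

Lemma pi1_map_pi p : pi1_map (\pi_pi1X p) = \pi_pi1Y (path_map p).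
Proof. apply/pi_homotopicP/path_map_homotopic; exact: repr_homotopic. Qed.

Lemma pi1_mapM : {morph pi1_map : a b / a * b}.
Proof. by move=> a b; rewrite [LHS]pi1_map_pi path_map_concat pi1_concat. Qed.

End PathMap.

Local Open Scope classical_set_scope.
Local Open Scope ring_scope.
Local Open Scope quotient_scope.

(** * The braid relations for rings *)

Section PlanarConfigurations.
Context (R : realType) (n : nat).
Local Notation E3 := 'rV[R]_3.
Implicit Types a r : 'I_n -> R.

(* The ring with centre (a, 0, 0) and radius r in a plane orthogonal to the
   axis is encoded by the point (a, r) of the upper half-plane. *)
Definition planar_conf a r : Prop := (forall i, 0 < r i) /\
  (forall i j, i != j -> (a i != a j) || (r i != r j)).

(** The base point is a default value; it makes this a total function of the coordinates. *)
Definition planar_point a r : ring_space R n :=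
  if pselect (planar_conf a r) is left h
  then config_of (mk_config (axial_config h.1 h.2)) else base_point R n.

Lemma planar_pointE a r (h : planar_conf a r) :
  planar_point a r = config_of (mk_config (axial_config h.1 h.2)).
Proof.
rewrite /planar_point; case: pselect => // h'.
by congr config_of; apply: val_inj.
Qed.

Lemma continuous_vec_axial (T : topologicalType) (c r : T -> R) :
  continuous c -> continuous r -> continuous (fun t => axial (c t) (r t)).
Proof.
move=> cc cr.
apply: (@continuous_pair _ _ _ (fun t => (c t *: e_x R, r t)) (fun=> e_x R)).
  apply: (@continuous_pair _ _ _ (fun t => c t *: e_x R) r) => //.
  have -> : (fun t => c t *: e_x R) = fun t => vec3 (c t) 0 0.
    by apply/funext => v; apply: vec3P; rewrite vec3E !mxE /= ?mulr1 ?mulr0.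
  by apply: continuous_vec3 => //; exact: cst_continuous.
exact: cst_continuous.
Qed.

Lemma continuous_config (T : topologicalType) (f : T -> labelled_config R n) :
  (forall i, continuous (fun t => \val (f t) i)) -> continuous f.
Proof.
move=> cf; apply: (@continuous_comp_initial (labelled_config R n) _ _ \val) => t.
have F : Filter ((\val \o f) x @[x --> t]).
  by apply: fmap_filter; exact: nbhs_filter.
apply/(@cvg_sup _ _ _ _ _ F) => j.
apply: (@continuous_comp_initial (labelled_data R n) _ _ (fun d => d j)).
exact: (cf j).
Qed.

Lemma continuous_planar_point (T : topologicalType) (a r : T -> 'I_n -> R) :
  (forall i, continuous (a ^~ i)) -> (forall i, continuous (r ^~ i)) ->
  (forall t, planar_conf (a t) (r t)) ->
  continuous (fun t => planar_point (a t) (r t)).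
Proof.
move=> ca cr h.
have -> : (fun t => planar_point (a t) (r t)) =
    @config_of R n \o (fun t => mk_config (axial_config (h t).1 (h t).2)).
  by apply/funext => t; exact: planar_pointE.
move=> t; apply: continuous_comp; last exact: config_of_continuous.
apply: continuous_config => i.
exact: (continuous_vec_axial (ca i) (cr i)).
Qed.

Lemma planar_conf_perm a r (s : 'I_n -> 'I_n) : injective s ->
  planar_conf a r -> planar_conf (a \o s) (r \o s).
Proof.
move=> s_inj [r0 d]; split=> [i|i j ij]; first exact: r0.
by apply: d; rewrite inj_eq.
Qed.

Lemma planar_point_perm a r (s : 'I_n -> 'I_n) : injective s ->
  planar_conf a r -> planar_point (a \o s) (r \o s) = planar_point a r.
Proof.
move=> s_inj h; rewrite (planar_pointE h) (planar_pointE (planar_conf_perm s_inj h)).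
have [s' s'K sK] := injF_bij s_inj.
apply/config_ofP/seteqP; split=> _ [j _ <-] /=; first by exists (s j).
by exists (s' j) => //=; rewrite sK.
Qed.

Lemma rho_planar_conf (i : 'I_n.-1) (t : unit_itv R) :
  planar_conf (fun j => rho_center i (\val t) j) (fun j => rho_radius i (\val t) j).
Proof.
have [hd dj] := rho_config_subproof i (Defs.itv_bound t).
split=> [j|j k jk]; first by have [] := hd j.
apply: contraT; rewrite negb_or !negbK => /andP[/eqP e1 /eqP e2].
have [] := dj _ _ jk; rewrite e1 e2 setIid => h _.
have [rk _] := hd k; move: h rk => /=.
set c := rho_center _ _ _; set r := rho_radius _ _ _ => h r0.
suff : ring_of (axial c r) (vec3 c r 0) by rewrite h.
by apply/ring_axialP; rewrite !vec3E expr0n addr0.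
Qed.

Lemma rho_loopE (i : 'I_n.-1) (t : unit_itv R) : rho_loop R i t =
  planar_point (fun j => rho_center i (\val t) j) (fun j => rho_radius i (\val t) j).
Proof.
rewrite (planar_pointE (rho_planar_conf i t)) /=; congr config_of.
exact: val_inj.
Qed.

End PlanarConfigurations.

Section RingBraidRelations.
Context (R : realType) (n : nat).
Local Notation I := (unit_itv R).

Lemma continuous_rho_center (T : topologicalType) (u : T -> I) (i j : nat) :
  continuous u -> continuous (fun t => rho_center i (\val (u t)) j).
Proof.
move=> cu t; apply: (@continuous_comp _ _ _ u (fun v : I => rho_center i (\val v) j)).
  exact: cu.
exact: rho_center_continuous.
Qed.

Lemma continuous_rho_radius (T : topologicalType) (u : T -> I) (i j : nat) :
  continuous u -> continuous (fun t => rho_radius i (\val (u t)) j).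
Proof.
move=> cu t; apply: (@continuous_comp _ _ _ u (fun v : I => rho_radius i (\val v) j)).
  exact: cu.
exact: rho_radius_continuous.
Qed.

Lemma base_centerS j : base_center R j.+1 = base_center R j + 4.
Proof. by rewrite /base_center -[j.+2%:R]natr1; ring. Qed.

Lemma base_center_lt j k : (j < k)%N -> base_center R j + 4 <= base_center R k.
Proof.
move=> jk; rewrite -base_centerS /base_center ler_pM2l ?ltr0n// ler_nat.
by rewrite ltnS.
Qed.

Lemma rho_center_bounds i (t : R) j : 0 <= t <= 1 -> (j == i) || (j == i.+1) ->
  base_center R i <= rho_center i t j <= base_center R i.+1.
Proof.
move=> t01; rewrite /rho_center base_centerS.
case: (eqVneq j i) => [->|ji] /=; first lra.
by move=> /eqP ->; rewrite eqxx base_centerS; lra.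
Qed.

Lemma rho_center_id i (t : R) j : j != i -> j != i.+1 ->
  rho_center i t j = base_center R j.
Proof. by move=> /negPf ji /negPf jSi; rewrite /rho_center ji jSi. Qed.

Lemma rho_radius_id i (t : R) j : j != i -> rho_radius i t j = 1.
Proof. by move=> /negPf ji; rewrite /rho_radius ji. Qed.

Lemma rho_center0 i j : rho_center i 0 j = base_center R j.
Proof. by rewrite /rho_center mulr0 addr0 subr0 !if_same. Qed.

Lemma rho_radius0 i j : rho_radius i 0 j = 1 :> R.
Proof. by rewrite /rho_radius mulr0 mul0r subr0 if_same. Qed.

Lemma rho_radius1 i j : rho_radius i 1 j = 1 :> R.
Proof. by rewrite /rho_radius subrr mulr0 subr0 if_same. Qed.

Lemma rho_center1 (i : 'I_n.-1) (i0 i1 j : 'I_n) :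
  i0 = i :> nat -> i1 = i.+1 :> nat ->
  rho_center i 1 j = base_center R (swap_ord i0 i1 j).
Proof.
move=> e0 e1; have [/rowP/(_ 0) h _] := @rho_at1 R _ _ _ _ j e0 e1.
by move: h; rewrite !mxE /= !mulr1.
Qed.

Definition comm_center (i j : nat) (t s : R) (k : nat) : R :=
  if (k == j) || (k == j.+1) then rho_center j s k else rho_center i t k.

Definition comm_radius (i j : nat) (t s : R) (k : nat) : R :=
  if k == j then rho_radius j s k else rho_radius i t k.

(** The rings j and j + 1 stay between their initial centres, and all other rings stay outside of
    this interval. *)
Lemma comm_planar_conf (i j : 'I_n.-1) (t s : I) : (i.+1 < j)%N ->
  planar_conf (fun k : 'I_n => comm_center i j (\val t) (\val s) k)
              (fun k : 'I_n => comm_radius i j (\val t) (\val s) k).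
Proof.
move=> ij; have [ri di] := rho_planar_conf i t; have [rj dj] := rho_planar_conf j s.
have t01 := Defs.itv_bound t; have s01 := Defs.itv_bound s.
split=> [k|k l kl].
  by rewrite /comm_radius; case: ifP.
rewrite /comm_center.
have ltJ (k' : nat) : ~~ ((k' == j :> nat) || (k' == j.+1)) -> (k' < j)%N ->
    rho_center i (\val t) k' < base_center R j.
  move=> _ kj; have [h|] := boolP ((k' == i :> nat) || (k' == i.+1)).
    have /andP[_] := rho_center_bounds t01 h.
    have := base_center_lt ij; lra.
  rewrite negb_or => /andP[h1 h2]; rewrite rho_center_id//.
  by have := base_center_lt kj; lra.
have gtJ (k' : nat) : (j.+1 < k')%N -> base_center R j.+1 < rho_center i (\val t) k'.
  move=> kj; rewrite rho_center_id; [|lia|lia].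
  by have := base_center_lt kj; lra.
have mixed (k' l' : nat) : (k' == j :> nat) || (k' == j.+1) -> ~~ ((l' == j :> nat) || (l' == j.+1)) ->
    rho_center j (\val s) k' != rho_center i (\val t) l'.
  move=> hk hl; have /andP[b1 b2] := rho_center_bounds s01 hk.
  have [lj|jl] := ltnP l' j.
    by rewrite gt_eqF//; have := ltJ _ hl lj; lra.
  rewrite lt_eqF//; have : (j.+1 < l')%N.
    by move: hl jl; clear; rewrite negb_or; lia.
  by move=> /gtJ; lra.
have [hk|hk] := boolP ((val k == j :> nat) || (val k == j.+1)); rewrite /= in hk; rewrite ?hk ?(negPf hk);
 have [hl|hl] := boolP ((val l == j :> nat) || (val l == j.+1)); rewrite /= in hl; rewrite ?hl ?(negPf hl).
- have e (m : nat) : (m == j :> nat) || (m == j.+1) ->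
      comm_radius i j (\val t) (\val s) m = rho_radius j (\val s) m.
    rewrite /comm_radius; case: (eqVneq m (j : nat)) => //= mj mj1.
    by rewrite !rho_radius_id//; move: mj1; lia.
  by rewrite !e//; exact: dj.
- by rewrite mixed.
- by rewrite eq_sym mixed.
- move: hk hl; rewrite !negb_or /comm_radius => /andP[/negPf -> _] /andP[/negPf -> _].
  exact: di.
Qed.

Lemma val_swap_ord (i0 i1 k : 'I_n) : swap_ord i0 i1 k =
  (if k == i0 :> nat then nat_of_ord i1
   else if k == i1 :> nat then nat_of_ord i0 else k) :> nat.
Proof. by rewrite /swap_ord -!val_eqE /=; do 2?case: ifP. Qed.

Lemma swap_ord_cases (i0 i1 k : 'I_n) :
  [\/ k = i0 :> nat /\ swap_ord i0 i1 k = i1 :> nat,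
      k = i1 :> nat /\ swap_ord i0 i1 k = i0 :> nat
    | swap_ord i0 i1 k = k :> nat].
Proof.
rewrite val_swap_ord; case: eqP => [->|_]; first by constructor.
by case: eqP => [->|_]; constructor.
Qed.

Lemma swap_ord_neq (i0 i1 k : 'I_n) :
  k != i0 :> nat -> k != i1 :> nat -> swap_ord i0 i1 k = k.
Proof. by move=> k0 k1; apply: val_inj; rewrite /= val_swap_ord !ifN. Qed.

Lemma rho_comm (i j : 'I_n.-1) : (i.+1 < j)%N ->
  homotopic (concat (rho_loop R i) (rho_loop R j)) (concat (rho_loop R j) (rho_loop R i)).
Proof.
move=> ij.
pose K (u : I * I) := planar_point
  (fun k : 'I_n => comm_center i j (\val u.1) (\val u.2) k)
  (fun k : 'I_n => comm_radius i j (\val u.1) (\val u.2) k).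
have i1n : (i.+1 < n)%N by case: (i) => ? /=; lia.
have j1n : (j.+1 < n)%N by case: (j) => ? /=; lia.
have [i0 ei0] : exists i0 : 'I_n, i0 = i :> nat by exists (Ordinal (ltnW i1n)).
have [i1 ei1] : exists i1 : 'I_n, i1 = i.+1 :> nat by exists (Ordinal i1n).
have [j0 ej0] : exists j0 : 'I_n, j0 = j :> nat by exists (Ordinal (ltnW j1n)).
have [j1 ej1] : exists j1 : 'I_n, j1 = j.+1 :> nat by exists (Ordinal j1n).
apply: (square_homotopic (K := K)).
- apply: continuous_planar_point => [k|k|u]; last exact: comm_planar_conf.
  + rewrite /comm_center; case: ((k == j :> nat) || (k == j.+1 :> nat));
      apply: continuous_rho_center => u.
      exact: cvg_snd.
    exact: cvg_fst.
  + rewrite /comm_radius; case: (k == j :> nat);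
      apply: continuous_rho_radius => u.
      exact: cvg_snd.
    exact: cvg_fst.
- move=> t; rewrite rho_loopE /K /= clip0; congr planar_point; apply/funext => k.
    rewrite /comm_center rho_center0; case: ifP => // h.
    by rewrite rho_center_id//; move: h; lia.
  rewrite /comm_radius rho_radius0; case: ifP => // h.
  by rewrite rho_radius_id//; move: h; lia.
- move=> t; rewrite rho_loopE /K /= clip1.
  (* At the end of the first motion the rings i and i + 1 have exchanged places, so this side of the
     square is the loop of j after a relabelling. *)
  rewrite -(planar_point_perm (inv_inj (swap_ordK i0 i1)) (rho_planar_conf j t)).
  congr planar_point; apply/funext => k /=.
    rewrite /comm_center (rho_center1 (i0 := i0) (i1 := i1))//; case: ifP => h.
      by rewrite swap_ord_neq//; move: h; lia.
    by rewrite rho_center_id//; move: h;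
      case: (swap_ord_cases i0 i1 k) => [[]|[]|];
      case: (swap_ord_cases j0 j1 k) => [[]|[]|]; lia.
  rewrite /comm_radius rho_radius1; case: ifP => h.
    by rewrite swap_ord_neq//; move: h; lia.
  by rewrite rho_radius_id//; move: h;
      case: (swap_ord_cases i0 i1 k) => [[]|[]|];
      case: (swap_ord_cases j0 j1 k) => [[]|[]|]; lia.
- move=> t; rewrite rho_loopE /K /= clip0; congr planar_point; apply/funext => k.
    rewrite /comm_center rho_center0; case: ifP => // h.
    by rewrite rho_center_id//; move: h; lia.
  rewrite /comm_radius rho_radius0; case: ifP => // h.
  by rewrite rho_radius_id//; move: h; lia.
- move=> t; rewrite rho_loopE /K /= clip1.
  rewrite -(planar_point_perm (inv_inj (swap_ordK j0 j1)) (rho_planar_conf i t)).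
  congr planar_point; apply/funext => k /=.
    rewrite /comm_center (rho_center1 (i0 := j0) (i1 := j1))//; case: ifP => h.
      by rewrite rho_center_id//; move: h;
      case: (swap_ord_cases i0 i1 k) => [[]|[]|];
      case: (swap_ord_cases j0 j1 k) => [[]|[]|]; lia.
    by rewrite swap_ord_neq//; move: h; lia.
  rewrite /comm_radius rho_radius1; case: ifP => h.
    by rewrite rho_radius_id//; move: h;
      case: (swap_ord_cases i0 i1 k) => [[]|[]|];
      case: (swap_ord_cases j0 j1 k) => [[]|[]|]; lia.
  have [kj|kj] := eqVneq k j1; last first.
    by rewrite swap_ord_neq//; move: h kj; rewrite -val_eqE /=; lia.
  by rewrite !rho_radius_id//; case: (swap_ord_cases j0 j1 k) => [[]|[]|];
    move: (congr1 val kj) => /=; lia.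
Qed.

(* The ring i passes through the rings i + 1 and i + 2 during the time t,
   while these two exchange places during the time s; [b] and [g] are the
   progress of the two passages. *)
Definition slide_center (i : nat) (b g s : R) (k : nat) : R :=
  if k == i then base_center R i + 4 * b + 4 * g
  else if k == i.+1 then
    base_center R i + (1 - s) * (4 - 4 * b) + s * (8 - 4 * g)
  else if k == i.+2 then
    base_center R i + (1 - s) * (8 - 4 * g) + s * (4 - 4 * b)
  else base_center R k.

(* The last summand keeps the two exchanging rings above the passing one. *)
Definition slide_radius (i : nat) (b g s : R) (k : nat) : R :=
  if k == i then 1 - 2 * b * (1 - b) - 2 * g * (1 - g)
  else if k == i.+1 then
    1 - 2 * s * (1 - s) + 4 * s * (1 - s) * (b + g) * (2 - b - g)
  else if k == i.+2 then 1 + 4 * s * (1 - s) * (b + g) * (2 - b - g)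
  else 1.

Lemma slide_planar_conf (i : nat) (b g s : R) :
  0 <= b <= 1 -> 0 <= g <= 1 -> 0 <= s <= 1 -> g = 0 \/ b = 1 ->
  planar_conf (fun k : 'I_n => slide_center i b g s k)
              (fun k : 'I_n => slide_radius i b g s k).
Proof.
move=> b01 g01 s01 bg.
have e0 : 0 <= 4 * s * (1 - s) * (b + g) * (2 - b - g).
  by rewrite !mulr_ge0//; lra.
split=> [k|].
  rewrite /slide_radius; case: ifP => _; last case: ifP => _; last case: ifP => _.
  - by case: bg => ->; nra.
  - by nra.
  - by lra.
  - by lra.
have cent (k : nat) : (k == i) || (k == i.+1) || (k == i.+2) ->
    base_center R i <= slide_center i b g s k <= base_center R i + 8.
  rewrite /slide_center; case: eqP => //= _; first by move=> _; lra.
  case: eqP => //= _ => [_|]; first by nra.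
  by case: eqP => //= _ _; nra.
suff wl (j k : 'I_n) : (j < k)%N ->
    (slide_center i b g s j != slide_center i b g s k)
    || (slide_radius i b g s j != slide_radius i b g s k).
  move=> j k; rewrite -val_eqE neq_ltn => /orP[/wl //|/wl].
  by rewrite (eq_sym (slide_center _ _ _ _ k)) (eq_sym (slide_radius _ _ _ _ k)).
move=> jk.
have base_id (l : nat) : ~~ ((l == i) || (l == i.+1) || (l == i.+2)) ->
    slide_center i b g s l = base_center R l.
  by rewrite /slide_center !negb_or => /andP[/andP[/negPf -> /negPf ->] /negPf ->].
have [hj|hj] := boolP ((j == i :> nat) || (j == i.+1 :> nat) || (j == i.+2 :> nat)); last first.
  rewrite base_id//; apply/orP; left.
  have [hk|hk] := boolP ((k == i :> nat) || (k == i.+1 :> nat) || (k == i.+2 :> nat)); last first.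
    by rewrite base_id// lt_eqF//; have := base_center_lt jk; lra.
  have ji : (j < i)%N by move: hj hk jk; rewrite !negb_or; lia.
  by rewrite lt_eqF//; have := base_center_lt ji; have := cent _ hk; lra.
have [hk|hk] := boolP ((k == i :> nat) || (k == i.+1 :> nat) || (k == i.+2 :> nat)); last first.
  apply/orP; left; rewrite [X in _ != X]base_id// lt_eqF//.
  have ki : (i.+2 < k)%N by move: hj hk jk; rewrite !negb_or; lia.
  have := base_center_lt ki; rewrite !base_centerS; have := cent _ hj; lra.
apply: contraT; rewrite negb_or !negbK => /andP[/eqP + /eqP].
have [[-> ->]|[-> ->]|[-> ->]] : [\/ j = i :> nat /\ k = i.+1 :> nat,
    j = i :> nat /\ k = i.+2 :> nat | j = i.+1 :> nat /\ k = i.+2 :> nat].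
  by move: hj hk jk => /orP[/orP[]|] /eqP -> /orP[/orP[]|] /eqP ->; try lia;
    [constructor 1|constructor 2|constructor 3].
- rewrite /slide_center /slide_radius !eqxx gtn_eqF// => ec er.
  have p0 : 0 <= s * (1 - s) by rewrite mulr_ge0; lra.
  case: bg => h; subst.
    (* Equal centres force b >= 1/2. For such b the equality of the radii is the vanishing of a sum
       of two nonnegative terms, so b = 1 and s is 0 or 1, against the equality of the centres. The
       other cases are similar. *)
    have b2 : 2^-1 <= b by nra.
    have q0 : 0 <= b * (1 - b) by rewrite mulr_ge0; lra.
    have h1 : b * (1 - b) + s * (1 - s) * (2 * b * (2 - b) - 1) = 0 by lra.
    have h2 : 2^-1 <= 2 * b * (2 - b) - 1 by nra.
    have p1 : s * (1 - s) = 0 by nra.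
    have q1 : b * (1 - b) = 0 by nra.
    nra.
  have g2 : g <= 2^-1 by nra.
  have q0 : 0 <= g * (1 - g) by rewrite mulr_ge0; lra.
  have h1 : g * (1 - g) + s * (1 - s) * (2 * (1 + g) * (1 - g) - 1) = 0 by lra.
  have h2 : 2^-1 <= 2 * (1 + g) * (1 - g) - 1 by nra.
  have p1 : s * (1 - s) = 0 by nra.
  have q1 : g * (1 - g) = 0 by nra.
  nra.
- rewrite /slide_center /slide_radius !eqxx !gtn_eqF// => ec er.
  have p0 : 0 <= s * (1 - s) by rewrite mulr_ge0; lra.
  case: bg => h; subst.
    have b2 : 2^-1 <= b by nra.
    have q0 : 0 <= b * (1 - b) by rewrite mulr_ge0; lra.
    have h1 : b * (1 - b) + s * (1 - s) * (2 * b * (2 - b)) = 0 by lra.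
    have h2 : 2^-1 <= 2 * b * (2 - b) by nra.
    have p1 : s * (1 - s) = 0 by nra.
    have q1 : b * (1 - b) = 0 by nra.
    nra.
  have g2 : g <= 2^-1 by nra.
  have q0 : 0 <= g * (1 - g) by rewrite mulr_ge0; lra.
  have h1 : g * (1 - g) + s * (1 - s) * (2 * (1 + g) * (1 - g)) = 0 by lra.
  have h2 : 2^-1 <= 2 * (1 + g) * (1 - g) by nra.
  have p1 : s * (1 - s) = 0 by nra.
  have q1 : g * (1 - g) = 0 by nra.
  nra.
- rewrite /slide_center /slide_radius !eqxx !gtn_eqF// => ec er.
  (* The rings i + 1 and i + 2 share a centre only at s = 1/2, where their radii differ by 1/2. *)
  have h1 : (1 - 2 * s) * (1 + b - g) = 0 by lra.
  have h2 : 1 <= 1 + b - g by case: bg => ->; lra.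
  have : s * (1 - s) = 0 by lra.
  move/eqP: h1; rewrite mulf_eq0 => /orP[/eqP s2|/eqP]; last by lra.
  have -> : s = 2^-1 by lra.
  lra.
Qed.

Lemma slide_center_continuous (T : topologicalType) (i k : nat) (b g s : T -> R) :
  continuous b -> continuous g -> continuous s ->
  continuous (fun u => slide_center i (b u) (g u) (s u) k).
Proof.
move=> cb cg cs; have cc (c : R) : continuous (fun _ : T => c) by exact: cst_continuous.
have c4 : continuous (fun u => 4 - 4 * b u).
  exact: (continuous_subf (cc _) (continuous_mulf (cc _) cb)).
have c8 : continuous (fun u => 8 - 4 * g u).
  exact: (continuous_subf (cc _) (continuous_mulf (cc _) cg)).
have cs' : continuous (fun u => 1 - s u) by exact: (continuous_subf (cc _) cs).
rewrite /slide_center; case: (k == i); last case: (k == i.+1);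
  last case: (k == i.+2); last exact: cc; do 2?[apply: continuous_addf];
  do ?[exact: cc]; exact: continuous_mulf.
Qed.

Lemma slide_radius_continuous (T : topologicalType) (i k : nat) (b g s : T -> R) :
  continuous b -> continuous g -> continuous s ->
  continuous (fun u => slide_radius i (b u) (g u) (s u) k).
Proof.
move=> cb cg cs; have cc (c : R) : continuous (fun _ : T => c) by exact: cst_continuous.
have c1 (f : T -> R) : continuous f -> continuous (fun u => 1 - f u).
  by move=> cf; exact: (continuous_subf (cc _) cf).
have c2 (f : T -> R) c : continuous f -> continuous (fun u => c * f u * (1 - f u)).
  by move=> cf; do 2?[apply: continuous_mulf] => //; exact: c1.
have cR : continuous
    (fun u => 4 * s u * (1 - s u) * (b u + g u) * (2 - b u - g u)).
  apply: continuous_mulf; last first.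
    by apply: continuous_subf => //; exact: (continuous_subf (cc _) cb).
  by apply: continuous_mulf; [exact: c2|exact: continuous_addf].
rewrite /slide_radius; case: (k == i); last case: (k == i.+1);
  last case: (k == i.+2); last exact: cc.
- by apply: continuous_subf; [apply: c1|]; exact: c2.
- by apply: continuous_addf => //; apply: c1; exact: c2.
- exact: (continuous_addf (cc _) cR).
Qed.

Lemma clip_le0 (t : R) : t <= 0 -> clip t = 0.
Proof. by move=> t0; rewrite -val_to_itv to_itv_le0// val_zero. Qed.

Lemma clip_ge1 (t : R) : 1 <= t -> clip t = 1.
Proof. by move=> t1; rewrite -val_to_itv to_itv_ge1// val_one. Qed.

Section Slide.
Context (i j : 'I_n.-1) (i0 i1 i2 : 'I_n).
Hypotheses (ji : j = i.+1 :> nat) (e0 : i0 = i :> nat) (e1 : i1 = i.+1 :> nat)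
  (e2 : i2 = i.+2 :> nat).

Let i1i : (i.+1 == nat_of_ord i) = false. Proof. by rewrite gtn_eqF. Qed.
Let i2i : (i.+2 == nat_of_ord i) = false. Proof. by rewrite gtn_eqF. Qed.
Let i2i1 : (i.+2 == i.+1) = false. Proof. by rewrite gtn_eqF. Qed.
Let ii1 : (nat_of_ord i == i.+1) = false. Proof. by rewrite ltn_eqF. Qed.
Let ii2 : (nat_of_ord i == i.+2) = false. Proof. by rewrite ltn_eqF. Qed.
Let i1i2 : (i.+1 == i.+2) = false. Proof. by rewrite ltn_eqF. Qed.
Let eqs := (i1i, i2i, i2i1, ii1, ii2, i1i2).

Let slide_cases (P : nat -> Prop) : P i -> P i.+1 -> P i.+2 ->
  (forall k : nat, (k == i) = false -> (k == i.+1) = false ->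
                   (k == i.+2) = false -> P k) -> forall k, P k.
Proof.
move=> p0 p1 p2 pk k; have [->//|/negPf n0] := eqVneq k (i : nat).
by have [->//|/negPf n1] := eqVneq k i.+1; have [->//|/negPf n2] := eqVneq k i.+2;
  exact: pk.
Qed.

Lemma slide_first b k : slide_center i b 0 0 k = rho_center i b k /\
  slide_radius i b 0 0 k = rho_radius i b k.
Proof.
move: k; rewrite /slide_center /slide_radius /rho_center /rho_radius.
apply: slide_cases => [|||k n0 n1 n2]; rewrite ?(eqs, eqxx) ?n0 ?n1 ?n2 ?base_centerS;
  by split; ring.
Qed.

Lemma slide_second g (k : 'I_n) :
  slide_center i 1 g 0 k = rho_center j g (swap_ord i0 i1 k) /\
  slide_radius i 1 g 0 k = rho_radius j g (swap_ord i0 i1 k).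
Proof.
rewrite val_swap_ord e0 e1; move: (k : nat).
rewrite /slide_center /slide_radius /rho_center /rho_radius ji.
apply: slide_cases => [|||m n0 n1 n2];
  rewrite ?(eqs, eqxx) ?n0 ?n1 ?n2 ?(eqs, eqxx) ?n0 ?n1 ?n2 ?base_centerS; by split; ring.
Qed.

Lemma slide_right s (k : 'I_n) :
  slide_center i 1 1 s k = rho_center i s (swap_ord i1 i2 (swap_ord i0 i1 k)) /\
  slide_radius i 1 1 s k = rho_radius i s (swap_ord i1 i2 (swap_ord i0 i1 k)).
Proof.
rewrite !val_swap_ord e0 e1 e2; move: (k : nat).
rewrite /slide_center /slide_radius /rho_center /rho_radius.
apply: slide_cases => [|||m n0 n1 n2];
  rewrite ?(eqs, eqxx) ?n0 ?n1 ?n2 ?(eqs, eqxx) ?n0 ?n1 ?n2 ?(eqs, eqxx) ?n0 ?n1 ?n2 ?base_centerS;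
  by split; ring.
Qed.

Lemma slide_left s k : slide_center i 0 0 s k = rho_center j s k /\
  slide_radius i 0 0 s k = rho_radius j s k.
Proof.
move: k; rewrite /slide_center /slide_radius /rho_center /rho_radius ji.
apply: slide_cases => [|||k n0 n1 n2]; rewrite ?(eqs, eqxx) ?n0 ?n1 ?n2 ?base_centerS;
  by split; ring.
Qed.

Lemma slide_top b g (k : 'I_n) :
  slide_center i b g 1 k = slide_center i b g 0 (swap_ord i1 i2 k) /\
  slide_radius i b g 1 k = slide_radius i b g 0 (swap_ord i1 i2 k).
Proof.
rewrite val_swap_ord e1 e2; move: (k : nat).
rewrite /slide_center /slide_radius.
apply: slide_cases => [|||m n0 n1 n2];
  rewrite ?(eqs, eqxx) ?n0 ?n1 ?n2 ?(eqs, eqxx) ?n0 ?n1 ?n2; by split; ring.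
Qed.

(** The two passages occupy the two halves of the first parameter, as in a concatenation of
    loops. *)
Let K (u : I * I) := planar_point
  (fun k : 'I_n => slide_center i (clip (2 * \val u.1)) (clip (2 * \val u.1 - 1)) (\val u.2) k)
  (fun k : 'I_n => slide_radius i (clip (2 * \val u.1)) (clip (2 * \val u.1 - 1)) (\val u.2) k).

Let Kconf (u : I * I) := @slide_planar_conf i (clip (2 * \val u.1))
  (clip (2 * \val u.1 - 1)) (\val u.2) (Defs.itv_bound (to_itv (2 * \val u.1)))
  (Defs.itv_bound (to_itv (2 * \val u.1 - 1))) (Defs.itv_bound u.2).

Let clip_or (t : R) : clip (2 * t - 1) = 0 \/ clip (2 * t) = 1.
Proof.
have [h|h] := leP t 2^-1; [left; apply: clip_le0|right; apply: clip_ge1]; lra.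
Qed.

Let K_bot (t : I) : concat (rho_loop R i) (rho_loop R j) t = K (t, zero).
Proof.
rewrite concatvE /K /= clip0; case: ifPn => h; rewrite rho_loopE /=.
  rewrite (clip_le0 (t := 2 * _ - 1)); last by lra.
  by congr planar_point; apply/funext => k; have [E1 E2] := slide_first (clip (2 * sval t)) k; rewrite ?E1 ?E2.
rewrite (clip_ge1 (t := 2 * _)); last by lra.
have c := rho_planar_conf j (to_itv (2 * sval t - 1)).
rewrite -(planar_point_perm (inv_inj (swap_ordK i0 i1)) c).
by congr planar_point; apply/funext => k /=; have [E1 E2] := slide_second (clip (2 * sval t - 1)) k; rewrite ?E1 ?E2.
Qed.

(** Up to relabelling, the lower and upper sides of the square [K] are both the loop of i followed
    by that of j, while its left side is the loop of j and its right side that of i. *)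
Lemma rho_braid :
  homotopic (concat (concat (rho_loop R i) (rho_loop R j)) (rho_loop R i))
            (concat (rho_loop R j) (concat (rho_loop R i) (rho_loop R j))).
Proof.
have cclip (c : R) : continuous (fun u : I * I => clip (2 * \val u.1 + c)).
  move=> u; apply: (@continuous_comp _ _ _ (fun u : I * I => 2 * \val u.1 + c)).
    exact: (continuous_affine_val (@continuous_proj1 R)).
  exact: clip_continuous.
have cb : continuous (fun u : I * I => clip (2 * \val u.1)).
  by under eq_fun do rewrite -[2 * _]addr0; exact: cclip.
have cg := cclip (-1).
apply: (square_homotopic (K := K)) => [|//|t|t|t].
- apply: continuous_planar_point => [k|k|u]; last by apply: Kconf; exact: clip_or.
  + exact: (@slide_center_continuous _ i k _ _ _ cb cg (@continuous_proj2 R)).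
  + exact: (@slide_radius_continuous _ i k _ _ _ cb cg (@continuous_proj2 R)).
- rewrite rho_loopE /K /= clip1 mulr1 (clip_ge1 (t := 2))//; last by lra.
  rewrite (clip_ge1 (t := 2 - 1)); last by lra.
  rewrite -(planar_point_perm (inv_inj (swap_ordK i1 i2)) (rho_planar_conf i t)).
  rewrite -(planar_point_perm (inv_inj (swap_ordK i0 i1))); last first.
    exact/planar_conf_perm/rho_planar_conf/inv_inj/swap_ordK.
  by congr planar_point; apply/funext => k /=; have [E1 E2] := slide_right (sval t) k; rewrite ?E1 ?E2.
- rewrite rho_loopE /K /= clip0 mulr0 clip0 (clip_le0 (t := 0 - 1)); last by lra.
  by congr planar_point; apply/funext => k; have [E1 E2] := slide_left (sval t) k; rewrite ?E1 ?E2.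
- rewrite K_bot /K.
  rewrite -(planar_point_perm (inv_inj (swap_ordK i1 i2))); last first.
    by apply: (Kconf (u := (t, zero))); exact: clip_or.
  congr planar_point; apply/funext => k /=; rewrite clip0 clip1.
    by have [-> _] := slide_top (clip (2 * sval t)) (clip (2 * sval t - 1)) k.
  by have [_ ->] := slide_top (clip (2 * sval t)) (clip (2 * sval t - 1)) k.
Qed.

End Slide.

Local Open Scope group_scope.
Local Open Scope quotient_scope.

Lemma rho_word_ev (u v : word 'I_n.-1) : braid_rel u v ->
  word_ev (@rho R n) u = word_ev (@rho R n) v.
Proof.
case=> [i j ij|i j ji] /=; rewrite /letter_ev /= !mulg1.
  by rewrite -!pi1_concat; apply/pi_homotopicP/rho_comm.
have i2n : (i.+2 < n)%N by case: (j) ji => /= k; lia.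
have pi3 (p q r : {path I from base_point R n to base_point R n}) :
  \pi_(ring_group R n) p * (\pi_(ring_group R n) q * \pi_(ring_group R n) r) =
  \pi_(ring_group R n) (concat p (concat q r)) by rewrite !pi1_concat.
rewrite /rho !pi3; apply/pi_homotopicP.
apply: homotopic_trans (concatA _ _ _) _.
exact: (rho_braid (i0 := Ordinal (ltnW (ltnW i2n))) (i1 := Ordinal (ltnW i2n))
  (i2 := Ordinal i2n)).
Qed.

Definition braid_to_ring : braid_group n -> ring_group R n :=
  presented_lift rho_word_ev.

Lemma braid_to_ringM : {morph braid_to_ring : a b / a * b}.
Proof. exact: presented_liftM. Qed.

Lemma braid_to_ring_sigma i : braid_to_ring (sigma i) = rho R i.
Proof. exact: presented_lift_gen. Qed.

End RingBraidRelations.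

(** * Configurations with a point off the rings *)

Section RingGeometry.
Context (R : realType).
Local Notation E3 := 'rV[R]_3.
Implicit Types (u v w : E3) (d e : ring_data R).

Lemma dotC u v : dot u v = dot v u.
Proof. by rewrite !dotE; ring. Qed.

Lemma dotDl u v w : dot (u + v) w = dot u w + dot v w.
Proof. by rewrite !dotE !mxE; ring. Qed.

Lemma dotZl k u w : dot (k *: u) w = k * dot u w.
Proof. by rewrite !dotE !mxE; ring. Qed.

Lemma dotNl u w : dot (- u) w = - dot u w.
Proof. by rewrite !dotE !mxE; ring. Qed.

Lemma dotBl u v w : dot (u - v) w = dot u w - dot v w.
Proof. by rewrite dotDl dotNl. Qed.

Lemma dotDr u v w : dot w (u + v) = dot w u + dot w v.
Proof. by rewrite ![dot w _]dotC dotDl. Qed.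

Lemma dotZr k u w : dot w (k *: u) = k * dot w u.
Proof. by rewrite ![dot w _]dotC dotZl. Qed.

Lemma dotNr u w : dot w (- u) = - dot w u.
Proof. by rewrite ![dot w _]dotC dotNl. Qed.

Lemma dotBr u v w : dot w (u - v) = dot w u - dot w v.
Proof. by rewrite ![dot w _]dotC dotBl. Qed.

Lemma dot_ge0 u : 0 <= dot u u.
Proof. by rewrite dotE -!expr2 !addr_ge0 ?sqr_ge0. Qed.

Lemma dot_eq0 u : dot u u = 0 -> u = 0.
Proof.
rewrite dotE => h; apply: vec3P; rewrite !mxE; nra.
Qed.

Definition dotE' := (dotDl, dotDr, dotBl, dotBr, dotNl, dotNr, dotZl, dotZr).

Lemma perp_exists (n : E3) : exists2 v, v != 0 & dot v n = 0.
Proof.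
have [h|h] := boolP ((n 0 0 == 0) && (n 0 1 == 0)).
  exists (vec3 1 0 0).
    by apply/eqP => /(congr1 (fun v : E3 => v 0 0))/eqP; rewrite vec3E mxE oner_eq0.
  by move: h => /andP[/eqP n0 /eqP n1]; rewrite dotE !vec3E n0 n1; ring.
exists (vec3 (- n 0 1) (n 0 0) 0).
  apply: contra h => /eqP h.
  have := congr1 (fun v : E3 => v 0 0) h; have := congr1 (fun v : E3 => v 0 1) h.
  by rewrite !vec3E !mxE => -> /eqP; rewrite oppr_eq0 => ->; rewrite eqxx.
by rewrite dotE !vec3E; ring.
Qed.

Lemma perp_on_ring d v : is_ring_data d -> v != 0 -> dot v d.2 = 0 ->
  exists k, [/\ k != 0, k ^+ 2 * dot v v = d.1.2 ^+ 2,
    ring_of d (d.1.1 + k *: v) & ring_of d (d.1.1 - k *: v)].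
Proof.
move=> [r0 _] v0 vn.
have vv : 0 < dot v v.
  by rewrite lt_def dot_ge0 andbT; apply: contra v0 => /eqP/dot_eq0 ->.
have s0 : 0 < Num.sqrt (dot v v) by rewrite sqrtr_gt0.
have kv : (d.1.2 / Num.sqrt (dot v v)) ^+ 2 * dot v v = d.1.2 ^+ 2.
  by rewrite expr_div_n sqr_sqrtr ?dot_ge0// divfK// gt_eqF.
exists (d.1.2 / Num.sqrt (dot v v)); split=> //.
- by rewrite mulf_neq0 ?invr_eq0 ?gt_eqF.
- by split; rewrite [_ + _ - _]addrC addKr !dotE' ?vn ?mulr0// mulrA -expr2.
- rewrite /ring_of /=; have -> : d.1.1 - (d.1.2 / Num.sqrt (dot v v)) *: v - d.1.1 =
     - ((d.1.2 / Num.sqrt (dot v v)) *: v) by rewrite addrC addKr.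
  by split; rewrite !dotE' ?vn -?kv; ring.
Qed.

Lemma ring_nonempty d : is_ring_data d -> exists x, ring_of d x.
Proof.
move=> hd; have [v v0 vn] := perp_exists d.2.
by have [k [_ _ h _]] := perp_on_ring hd v0 vn; exists (d.1.1 + k *: v).
Qed.

(** For v orthogonal to the normal of d, the ring contains two opposite points c + k v and c - k v.
    Both satisfy the equations of e, which makes v orthogonal to the normal of e and to the
    difference of the centres. *)
Lemma ring_of_inj d e : is_ring_data d -> is_ring_data e ->
  ring_of d = ring_of e ->
  [/\ d.1.1 = e.1.1, d.1.2 = e.1.2 & exists s : bool, d.2 = (-1) ^+ s *: e.2].
Proof.
move=> hd he de; have [rd nd] := hd; have [re ne] := he.
have key v : dot v d.2 = 0 ->
    dot v e.2 = 0 /\ dot (d.1.1 - e.1.1) v = 0.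
  move=> vd; have [->|v0] := eqVneq v 0.
    by split; rewrite dotE !mxE; ring.
  have [k [k0 _]] := perp_on_ring hd v0 vd; rewrite de.
  rewrite /ring_of /= => -[p1 p2] [m1 m2].
  have eP : d.1.1 + k *: v - e.1.1 = (d.1.1 - e.1.1) + k *: v by rewrite addrAC.
  have eM : d.1.1 - k *: v - e.1.1 = (d.1.1 - e.1.1) - k *: v by rewrite addrAC.
  move: p1 p2 m1 m2; rewrite eP eM; move: (d.1.1 - e.1.1) => w.
  rewrite !dotE' (dotC v w) => p1 p2 m1 m2.
  split; apply: (mulfI k0); rewrite mulr0; lra.
have [v v0 vd] := perp_exists d.2.
have [k [k0 kv pd _]] := perp_on_ring hd v0 vd.
set c := dot e.2 d.2.
have [] := key (e.2 - c *: d.2).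
  by rewrite !dotE' nd /c; ring.
rewrite !dotE' ne (dotC d.2) -/c => c1 c2.
have hc : c ^+ 2 = 1 by rewrite expr2; lra.
have en : e.2 = c *: d.2.
  apply/eqP; rewrite -subr_eq0; apply/eqP/dot_eq0.
  by rewrite !dotE' ne nd (dotC d.2) -/c; lra.
have dn : d.2 = c *: e.2 by rewrite en scalerA -expr2 hc scale1r.
have ew : dot (d.1.1 - e.1.1) e.2 = 0.
  move: pd; rewrite de /ring_of /= => -[+ _].
  have -> : d.1.1 + k *: v - e.1.1 = (d.1.1 - e.1.1) + k *: v by rewrite addrAC.
  by rewrite (dotDl (_ - _)) dotZl (key v vd).1 mulr0 addr0.
have ec : d.1.1 = e.1.1.
  apply/eqP; rewrite -subr_eq0; apply/eqP.
  move: ew key; move: (d.1.1 - e.1.1) => w ew key.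
  have wd : dot w d.2 = 0 by rewrite dn dotZr ew mulr0.
  by apply: dot_eq0; have [] := key w wd.
split=> //.
  move: pd; rewrite de /ring_of /= ec => -[_].
  rewrite addrAC subrr add0r !dotE' mulrA -expr2 kv => /eqP.
  by rewrite eqrXn2 ?ltW// => /eqP.
have [c0|c0] := leP 0 c.
  exists false; rewrite expr0 dn; congr (_ *: _); nra.
exists true; rewrite expr1 dn; congr (_ *: _); nra.
Qed.

Definition flip (s : bool) d : ring_data R := (d.1, (-1) ^+ s *: d.2).

Lemma ring_of_flip s d : ring_of (flip s d) = ring_of d.
Proof.
apply/seteqP; split=> x; rewrite /ring_of /= => -[h1 h2]; split=> //.
  move: h1; rewrite dotZr => /eqP; rewrite mulf_eq0 signr_eq0 /= => /eqP; exact.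
by rewrite dotZr h1 mulr0.
Qed.

Lemma flip_ring_data s d : is_ring_data d -> is_ring_data (flip s d).
Proof.
by move=> [r0 n1]; split=> //=; rewrite dotZl dotZr n1 mulr1 -signr_addb addbb.
Qed.

End RingGeometry.

Section Relabelling.
Context (R : realType) (n : nat).
Local Notation E3 := 'rV[R]_3.
Local Notation L := (labelled_config R n).
Implicit Types (a b : L).

Lemma configP a : ring_config_set (\val a).
Proof. by case: a => a /= /set_mem. Qed.

Lemma config_data a i : is_ring_data (\val a i).
Proof. exact: (configP a).1. Qed.

Lemma config_ring_inj a i j : ring_of (\val a i) = ring_of (\val a j) -> i = j.
Proof.
move=> e; apply/eqP; apply: contraT => ij.
have [] := (configP a).2 _ _ ij; rewrite e setIid => h _.
by have [x] := ring_nonempty (config_data a j); rewrite h.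
Qed.

Fact relabel_subproof (s : 'I_n -> 'I_n) (f : 'I_n -> bool) b : injective s ->
  ring_config_set ((fun i => flip (f i) (\val b (s i))) : labelled_data R n).
Proof.
move=> s_inj; split=> [i|i j ij]; first exact/flip_ring_data/config_data.
by rewrite !ring_of_flip; apply: (configP b).2; rewrite inj_eq.
Qed.

Definition relabel (s : 'I_n -> 'I_n) (f : 'I_n -> bool) (hs : injective s) b : L :=
  mk_config (relabel_subproof f b hs).

Lemma config_of_relabel s f (hs : injective s) b :
  config_of (relabel f hs b) = config_of b.
Proof.
have [s' s'K sK] := injF_bij hs.
apply/config_ofP/seteqP; split=> _ [j _ <-] /=.
  by exists (s j) => //; rewrite ring_of_flip.
by exists (s' j) => //=; rewrite ring_of_flip sK.
Qed.

(** The fibres of the quotient are orbits of signed permutations, which act by isometries of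
    [config_dist]. This is the covering structure behind the lifting of squares. *)
Lemma config_of_eq a b : config_of a = config_of b ->
  exists s f (hs : injective s), a = relabel f hs b.
Proof.
move=> /config_ofP e.
have h i : exists j, ring_of (\val b j) = ring_of (\val a i).
  have : rings a (ring_of (\val a i)) by exists i.
  by rewrite e => -[j _ <-]; exists j.
have [s hs] := choice h.
have s_inj : injective s.
  by move=> i j ij; apply: (@config_ring_inj a); rewrite -!hs ij.
have h' i : exists t : bool, \val a i = flip t (\val b (s i)).
  have [e1 e2 [t e3]] := ring_of_inj (config_data a i) (config_data b (s i)) (esym (hs i)).
  exists t; rewrite /flip -e3; move: e1 e2; case: (\val a i) => -[c r] nu /=.
  by case: (\val b (s i)) => -[c' r'] nu' /= -> ->.
have [f hf] := choice h'.
exists s, f, s_inj; apply: val_inj; apply/funext => i; exact: hf.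
Qed.

Definition config_dist a b : R := \sum_i (`|(\val a i).1.1 - (\val b i).1.1|
  + `|(\val a i).1.2 - (\val b i).1.2| + `|(\val a i).2 - (\val b i).2|).

Lemma config_dist_relabel s f (hs : injective s) a b :
  config_dist (relabel f hs a) (relabel f hs b) = config_dist a b.
Proof.
rewrite /config_dist [RHS](reindex_inj hs); apply: eq_bigr => i _ /=.
by rewrite -scalerBr normrZ normr_sign mul1r.
Qed.

Lemma config_distC a b : config_dist a b = config_dist b a.
Proof.
by apply: eq_bigr => i _; rewrite (distrC (\val a i).1.1) (distrC (\val a i).1.2)
  (distrC (\val a i).2).
Qed.

Lemma config_distD b a c : config_dist a c <= config_dist a b + config_dist b c.
Proof.
rewrite /config_dist -big_split; apply: ler_sum => i _ /=.
have h1 := ler_distD (\val b i).1.1 (\val a i).1.1 (\val c i).1.1.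
have h2 := ler_distD (\val b i).1.2 (\val a i).1.2 (\val c i).1.2.
have h3 := ler_distD (\val b i).2 (\val a i).2 (\val c i).2.
lra.
Qed.

Lemma config_dist_ge a b i : [/\ `|(\val a i).1.1 - (\val b i).1.1| <= config_dist a b,
  `|(\val a i).1.2 - (\val b i).1.2| <= config_dist a b &
  `|(\val a i).2 - (\val b i).2| <= config_dist a b].
Proof.
rewrite /config_dist (bigD1 i)//=.
set S := \sum_(j | j != i) _.
have S0 : 0 <= S by apply: sumr_ge0 => j _; rewrite !addr_ge0.
have := normr_ge0 ((\val a i).1.1 - (\val b i).1.1).
have := normr_ge0 ((\val a i).1.2 - (\val b i).1.2).
have := normr_ge0 ((\val a i).2 - (\val b i).2).
by split; lra.
Qed.

End Relabelling.

Section RingSpaceTheory.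
Context (R : realType) (n : nat).
Local Notation E3 := 'rV[R]_3.
Local Notation L := (labelled_config R n).
Local Notation Q := (ring_space R n).

Definition on_ring (q : Q) (x : E3) : Prop := exists2 A, rings (repr q) A & A x.

Lemma on_ringP (a : L) x : on_ring (config_of a) x <-> exists i, ring_of (\val a i) x.
Proof.
have e : rings (repr (config_of a)) = rings a.
  by apply/config_ofP; rewrite /config_of reprK.
rewrite /on_ring e; split=> [[_ [i _ <-] h]|[i h]]; first by exists i.
by exists (ring_of (\val a i)) => //; exists i.
Qed.

Lemma continuous_label i : continuous (fun a : L => \val a i).
Proof.
move=> a; apply: (@continuous_comp _ _ _ (\val : L -> labelled_data R n) (fun d => d i)).
  exact: initial_continuous.
exact: (@proj_continuous _ _ i).
Qed.

Lemma continuous_centre i : continuous (fun a : L => (\val a i).1.1).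
Proof.
move=> a; apply: (@continuous_comp _ _ _ (fun a : L => \val a i) (fun d => d.1.1)).
  exact: continuous_label.
apply: (@continuous_comp _ _ _ fst fst); exact: cvg_fst.
Qed.

Lemma continuous_radius i : continuous (fun a : L => (\val a i).1.2).
Proof.
move=> a; apply: (@continuous_comp _ _ _ (fun a : L => \val a i) (fun d => d.1.2)).
  exact: continuous_label.
apply: (@continuous_comp _ _ _ fst snd); [exact: cvg_fst|exact: cvg_snd].
Qed.

Lemma continuous_normal i : continuous (fun a : L => (\val a i).2).
Proof.
move=> a; apply: (@continuous_comp _ _ _ (fun a : L => \val a i) snd).
  exact: continuous_label.
exact: cvg_snd.
Qed.

Lemma continuous_sumf (T : topologicalType) (I : finType) (f : I -> T -> R) :
  (forall i, continuous (f i)) -> continuous (fun t => \sum_i f i t).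
Proof.
move=> cf t; apply: cvg_big => [|i _]; [exact: add_continuous|exact: cf].
Qed.

Definition config_span (a : L) : R :=
  \sum_i (`|(\val a i).1.1 0 1| + (\val a i).1.2).

Lemma config_span_relabel s f (hs : injective s) (a : L) :
  config_span (relabel f hs a) = config_span a.
Proof. by rewrite /config_span [RHS](reindex_inj hs). Qed.

Lemma config_span_continuous : continuous config_span.
Proof.
apply: continuous_sumf => i; apply: continuous_addf; last exact: continuous_radius.
move=> a; apply: continuous_comp; last exact: norm_continuous.
apply: (@continuous_comp _ _ _ (fun a : L => (\val a i).1.1) (fun v : E3 => v 0 1)).
  exact: continuous_centre.
exact: coord_continuous.
Qed.

(** The maximum with n makes the height constant along the loops [rho_loop], where all centres are
    on the axis and all radii are at most 1. The far point then stands still during an exchange. *)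
Definition height (q : Q) : R := Num.max n%:R (config_span (repr q)) + 2.

Lemma heightE (a : L) : height (config_of a) = Num.max n%:R (config_span a) + 2.
Proof.
rewrite /height; have [s [f [hs ->]]] : exists s f (hs : injective s),
    repr (config_of a) = relabel f hs a.
  by apply: config_of_eq; rewrite /config_of reprK.
by rewrite config_span_relabel.
Qed.

Lemma height_continuous : continuous height.
Proof.
apply/quotient_continuous.
have -> : height \o \pi_Q = fun a : L => Num.max n%:R (config_span a) + 2.
  by apply/funext => a; exact: heightE.
apply: continuous_addf; last exact: cst_continuous.
move=> a; apply: (@continuous_max R L (fun=> n%:R) config_span).
  exact: cst_continuous.
exact: config_span_continuous.
Qed.

(** The abscissa 2 is that of the gap before the first ring of the base configuration. *)
Definition far_point (q : Q) : E3 := vec3 2 (height q) 0.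

Lemma far_point_continuous : continuous far_point.
Proof.
apply: continuous_vec3; [exact: cst_continuous|exact: height_continuous|].
exact: cst_continuous.
Qed.

Lemma far_point_off (q : Q) : ~ on_ring q (far_point q).
Proof.
rewrite -[q]reprK -[\pi_Q _]/(config_of (repr q)) => /on_ringP[i [_ h]].
have [r0 _] := config_data (repr q) i.
have : `|(\val (repr q) i).1.1 0 1| + (\val (repr q) i).1.2 + 2 <= height q.
  rewrite lerD2r le_max; apply/orP; right; rewrite /config_span (bigD1 i)//= lerDl.
  apply: sumr_ge0 => j _; rewrite addr_ge0//.
  by have [/ltW] := config_data (repr q) j.
move: h r0; rewrite /far_point /config_of reprK dotE !mxE /=.
move: (height q) => M; move: (\val (repr q) i).1 => [c r] /=.
have := ler_norm (c 0 1); have := normr_ge0 (c 0 1); move: (`|c 0 1|) => k.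
move=> k0 ck h r0 hM.
have {ck k0 hM} : r < M - c 0 1 by lra.
by move: (M - c 0 1) (2 - c 0 0) (0 - c 0 2%:R) h r0 => u v w; nra.
Qed.

End RingSpaceTheory.

Section FunctionClass.
Context (R : realType) (X : topologicalType) (x0 : X).
Local Notation I := (unit_itv R).
Local Notation pi1 := (fundamental_group R x0).

(** A class for bare functions: end points that are only provably equal then never occur in
    types. *)
Definition fun_class (f : I -> X) : pi1 :=
  if pselect (continuous f) is left cf
  then path_class x0 (mk_path cf erefl erefl : {path I from f zero to f one}) else 1%g.

Lemma path_class_fun x y (p : {path I from x to y}) : path_class x0 p = fun_class p.
Proof.
rewrite /fun_class; case: pselect => [cp|[]]; last exact: cts_fun.
have e0 : p zero = x := path_zero (s := p); have e1 : p one = y := path_one (s := p).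
transitivity (path_class x0 (mk_path cp e0 e1 : {path I from x to y})).
  by congr (path_class x0 _); exact/path_eqP.
move: (p : I -> X) cp e0 e1 => f cp e0 e1.
by case: x / e0 {p}; case: y / e1.
Qed.

Lemma eq_fun_class (f g : I -> X) : f =1 g -> fun_class f = fun_class g.
Proof. by move=> /funext ->. Qed.

Lemma fun_class_const (x : X) : fun_class (fun=> x) = 1%g.
Proof. by rewrite -(path_class_const R x0 x) path_class_fun. Qed.

Lemma fun_class_square (K : I * I -> X) : continuous K ->
  (fun_class (fun t => K (t, zero)) * fun_class (fun t => K (one, t)) =
   fun_class (fun t => K (zero, t)) * fun_class (fun t => K (t, one)))%g.
Proof.
move=> cK.
have cid : continuous (@id I) by move=> t; exact: cvg_id.
have c1 (z : I) : continuous (fun t => K (t, z)).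
  move=> t; apply: (@continuous_comp _ _ _ (fun t : I => (t, z)) K); last exact: cK.
  exact: (continuous_pair cid (@cst_continuous _ _ z)).
have c2 (z : I) : continuous (fun t => K (z, t)).
  move=> t; apply: (@continuous_comp _ _ _ (fun t : I => (z, t)) K); last exact: cK.
  exact: (continuous_pair (@cst_continuous _ _ z) cid).
have := square_class x0 (K := K)
  (bot := mk_path (c1 zero) erefl erefl) (right := mk_path (c2 one) erefl erefl)
  (left := mk_path (c2 zero) erefl erefl) (top := mk_path (c1 one) erefl erefl) cK
  (fun=> erefl) (fun=> erefl) (fun=> erefl) (fun=> erefl).
by rewrite !path_class_fun.
Qed.

Lemma fun_class_halves (f : I -> X) : continuous f ->
  fun_class f = (fun_class (fun t => f (to_itv (2^-1 * \val t + 0))) *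
                 fun_class (fun t => f (to_itv (2^-1 * \val t + 2^-1))))%g.
Proof.
move=> cf.
have cl (c : R) : continuous (fun t : I => f (to_itv (2^-1 * \val t + c))).
  move=> t; apply: (@continuous_comp _ _ _
    (@to_itv R \o (fun t : I => 2^-1 * \val t + c)) f); last exact: cf.
  exact/continuous_to_itv/continuous_affine_val/continuous_val.
have e0 : f (to_itv (2^-1 * \val (zero : I) + 0)) = f zero.
  by rewrite val_zero mulr0 addr0.
have e1 : f (to_itv (2^-1 * \val (one : I) + 0)) = f (to_itv 2^-1).
  by rewrite val_one mulr1 addr0.
have e2 : f (to_itv (2^-1 * \val (zero : I) + 2^-1)) = f (to_itv 2^-1).
  by rewrite val_zero mulr0 add0r.
have e3 : f (to_itv (2^-1 * \val (one : I) + 2^-1)) = f one.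
  by rewrite val_one mulr1 -to_itv1; congr (f (to_itv _)); lra.
rewrite -(path_class_fun (mk_path (cl 0) e0 e1)).
rewrite -(path_class_fun (mk_path (cl 2^-1) e2 e3)).
rewrite -path_class_concat path_class_fun; apply: eq_fun_class => t.
have /= t01 := Defs.itv_bound t.
rewrite concatvE -[in LHS](to_itvK t) /=; case: ifPn => h; rewrite /mk_path /=.
  by congr (f (to_itv _)); rewrite clip_id; lra.
by congr (f (to_itv _)); rewrite clip_id; lra.
Qed.

End FunctionClass.

(** * Segments and tracks in the total space *)

Section TotalSpace.
Context (R : realType) (n : nat).
Local Notation E3 := 'rV[R]_3.
Local Notation I := (unit_itv R).
Local Notation Q := (ring_space R n).

Definition off_ring_set : set (Q * E3)%type := [set u | ~ on_ring u.1 u.2].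

Definition pointed_space : Type := off_ring_set.
HB.instance Definition _ := Topological.on pointed_space.
Local Notation E := pointed_space.

Definition mk_pointed (q : Q) (x : E3) (h : ~ on_ring q x) : E :=
  exist _ (q, x) (mem_set (h : off_ring_set (q, x))).

Lemma pointed_off (e : E) : ~ on_ring (\val e).1 (\val e).2.
Proof. by case: e => e /= /set_mem. Qed.

Lemma continuous_pointed (T : topologicalType) (f : T -> E) :
  continuous (fun t => (\val (f t)).1) -> continuous (fun t => (\val (f t)).2) ->
  continuous f.
Proof.
move=> c1 c2; apply: (@continuous_comp_initial E _ _ \val).
have -> : \val \o f = fun t => ((\val (f t)).1, (\val (f t)).2).
  by apply/funext => t /=; case: (sval (f t)).
exact: continuous_pair.
Qed.

Lemma continuous_pointed_conf : continuous (fun e : E => (\val e).1).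
Proof.
move=> e; apply: (@continuous_comp _ _ _ (\val : E -> Q * E3) fst).
  exact: initial_continuous.
exact: cvg_fst.
Qed.

Lemma continuous_pointed_pt : continuous (fun e : E => (\val e).2).
Proof.
move=> e; apply: (@continuous_comp _ _ _ (\val : E -> Q * E3) snd).
  exact: initial_continuous.
exact: cvg_snd.
Qed.

Definition far_section (q : Q) : E := mk_pointed (@far_point_off R n q).

Lemma far_section_continuous : continuous far_section.
Proof.
apply: continuous_pointed => /=; first by move=> q; exact: cvg_id.
exact: far_point_continuous.
Qed.

(* The value far_section q is junk, for the points on the rings. *)
Definition planar_pointed (q : Q) (x y : R) : E :=
  if pselect (~ on_ring q (vec3 x y 0)) is left h then mk_pointed h
  else far_section q.

Definition planar_off (q : Q) (x y : R) := ~ on_ring q (vec3 x y 0).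

Lemma planar_pointedE q x y (h : planar_off q x y) : planar_pointed q x y = mk_pointed h.
Proof.
by rewrite /planar_pointed; case: pselect => // h'; apply: val_inj.
Qed.

Lemma planar_pointed_continuous (T : topologicalType) (q : T -> Q) (x y : T -> R) :
  continuous q -> continuous x -> continuous y ->
  (forall t, planar_off (q t) (x t) (y t)) ->
  continuous (fun t => planar_pointed (q t) (x t) (y t)).
Proof.
move=> cq cx cy h.
have -> : (fun t => planar_pointed (q t) (x t) (y t)) = fun t => mk_pointed (h t).
  by apply/funext => t; exact: planar_pointedE.
apply: continuous_pointed => //=.
by apply: continuous_vec3 => //; exact: cst_continuous.
Qed.

Lemma far_section_planar q : far_section q = planar_pointed q 2 (height q).
Proof. by rewrite (planar_pointedE (@far_point_off _ _ q)). Qed.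

Context (e0 : E).
Local Notation pi1 := (fundamental_group R e0).
Local Notation cls := (@fun_class R E e0).

Definition lin (a b t : R) : R := (1 - t) * a + t * b.

Lemma lin0 a b : lin a b 0 = a. Proof. by rewrite /lin; ring. Qed.
Lemma lin1 a b : lin a b 1 = b. Proof. by rewrite /lin; ring. Qed.
Lemma linaa a t : lin a a t = a. Proof. by rewrite /lin; ring. Qed.

Lemma continuous_lin (T : topologicalType) (a b t : T -> R) :
  continuous a -> continuous b -> continuous t ->
  continuous (fun u => lin (a u) (b u) (t u)).
Proof.
move=> ca cb ct; apply: continuous_addf; apply: continuous_mulf => //.
exact: continuous_onem_val.
Qed.

Implicit Types P S T : R * R.

Definition segment (q : Q) P S : pi1 :=
  cls (fun t => planar_pointed q (lin P.1 S.1 (\val t)) (lin P.2 S.2 (\val t))).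

Definition segment_off (q : Q) P S := forall t : R, 0 <= t <= 1 ->
  planar_off q (lin P.1 S.1 t) (lin P.2 S.2 t).

Definition triangle_off (q : Q) P S T := forall a b c : R,
  0 <= a -> 0 <= b -> 0 <= c -> a + b + c = 1 ->
  planar_off q (a * P.1 + b * S.1 + c * T.1) (a * P.2 + b * S.2 + c * T.2).

Lemma segment_refl q P : segment q P P = 1%g.
Proof.
rewrite -[RHS](@fun_class_const R E e0 (planar_pointed q P.1 P.2)).
by apply: eq_fun_class => t; rewrite !linaa.
Qed.

(** The triangle is swept as the cone with apex P over the segment from S to T. *)
Lemma segment_triangle q P S T : triangle_off q P S T ->
  (segment q P S * segment q S T)%g = segment q P T.
Proof.
move=> h; pose K (u : I * I) := planar_pointed q
  (lin P.1 (lin S.1 T.1 (\val u.2)) (\val u.1))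
  (lin P.2 (lin S.2 T.2 (\val u.2)) (\val u.1)).
have cc (c : R) : continuous (fun _ : I * I => c) by exact: cst_continuous.
have c2 := @continuous_proj2 R; have c1 := @continuous_proj1 R.
have cK : continuous K.
  apply: planar_pointed_continuous; [exact: cst_continuous| | |].
  - exact: (continuous_lin (cc _) (continuous_lin (cc _) (cc _) c2) c1).
  - exact: (continuous_lin (cc _) (continuous_lin (cc _) (cc _) c2) c1).
  - move=> u; have /andP[u10 u11] := Defs.itv_bound u.1.
    have /andP[u20 u21] := Defs.itv_bound u.2.
    have := h (1 - \val u.1) (\val u.1 * (1 - \val u.2)) (\val u.1 * \val u.2).
    rewrite subr_ge0 u11 !mulr_ge0 ?subr_ge0// => /(_ isT isT isT).
    move: (\val u.1) (\val u.2) => s t.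
    have -> : 1 - s + s * (1 - t) + s * t = 1 by ring.
    move=> /(_ erefl); rewrite /lin.
    by congr planar_off; ring.
have := @fun_class_square R E e0 K cK.
have -> : cls (fun t => K (t, zero)) = segment q P S.
  by apply: eq_fun_class => t; rewrite /K /= clip0 !lin0.
have -> : cls (fun t => K (t, one)) = segment q P T.
  by apply: eq_fun_class => t; rewrite /K /= clip1 !lin1.
have -> : cls (fun t => K (one, t)) = segment q S T.
  by apply: eq_fun_class => t; rewrite /K /= clip1 !lin1.
have -> : cls (fun t => K (zero, t)) = 1%g.
  rewrite -[RHS](@fun_class_const R E e0 (planar_pointed q P.1 P.2)).
  by apply: eq_fun_class => t; rewrite /K /= clip0 !lin0.
by rewrite mul1g.
Qed.

Lemma segment_rev q P S : segment_off q P S -> segment q S P = ((segment q P S)^-1)%g.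
Proof.
move=> h; apply/esym/mulg1_eq; rewrite segment_triangle ?segment_refl//.
move=> a b c a0 b0 c0 abc; have := h b; rewrite /lin => hb.
have -> : a * P.1 + b * S.1 + c * P.1 = (1 - b) * P.1 + b * S.1 by rewrite -abc; ring.
have -> : a * P.2 + b * S.2 + c * P.2 = (1 - b) * P.2 + b * S.2 by rewrite -abc; ring.
by apply: hb; lra.
Qed.

Definition track (q : I -> Q) P : pi1 := cls (fun t => planar_pointed (q t) P.1 P.2).

(** In the square one parameter moves the configuration and the other moves the point along the
    segment. This is how segments are transported through an exchange. *)
Lemma track_segment (q : I -> Q) qa qb P S : continuous q ->
  q zero = qa -> q one = qb -> (forall t, segment_off (q t) P S) ->
  (track q P * segment qb P S = segment qa P S * track q S)%g.
Proof.
move=> cq <- <- h; pose K (u : I * I) := planar_pointed (q u.1)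
  (lin P.1 S.1 (\val u.2)) (lin P.2 S.2 (\val u.2)).
have cc (c : R) : continuous (fun _ : I * I => c) by exact: cst_continuous.
have c2 := @continuous_proj2 R.
have cK : continuous K.
  apply: planar_pointed_continuous.
  - move=> u; apply: (@continuous_comp _ _ _ fst q); [exact: cvg_fst|exact: cq].
  - exact: (continuous_lin (cc _) (cc _) c2).
  - exact: (continuous_lin (cc _) (cc _) c2).
  - by move=> u; apply: h; exact: Defs.itv_bound.
have := @fun_class_square R E e0 K cK.
have -> : cls (fun t => K (t, zero)) = track q P.
  by apply: eq_fun_class => t; rewrite /K /= clip0 !lin0.
have -> // : cls (fun t => K (t, one)) = track q S.
by apply: eq_fun_class => t; rewrite /K /= clip1 !lin1.
Qed.

Lemma track_halves (q : I -> Q) P : continuous q ->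
  (forall t, planar_off (q t) P.1 P.2) ->
  track q P = (track (fun t => q (to_itv (2^-1 * \val t + 0))) P *
               track (fun t => q (to_itv (2^-1 * \val t + 2^-1))) P)%g.
Proof.
move=> cq h; apply: fun_class_halves.
by apply: planar_pointed_continuous => //; exact: cst_continuous.
Qed.

End TotalSpace.

Lemma conj_quotient (G : groupType) (s s' u0 u v : G) :
  (s * u0 = u0 * s' -> u * s' = s * v -> (u0 / u) ^ s = u0 / v)%g.
Proof.
move=> e0 e1; rewrite conjgE; apply: (mulgI s); apply: (mulIg v).
by rewrite !grpE -(mulgA _ s) -e1 !grpE e0.
Qed.

(** * The action of the exchanges on the loops through the rings *)

Section Transport.
Context (R : realType) (n : nat).
Local Notation E3 := 'rV[R]_3.
Local Notation I := (unit_itv R).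
Local Notation Q := (ring_space R n).
Local Notation E := (pointed_space R n).
Local Notation q0 := (base_point R n).

Definition base_pointed : E := far_section q0.
Local Notation e0 := base_pointed.
Local Notation Gamma := (fundamental_group R e0).

(** The ring k - 1 has its centre at 4k and the ring k at 4k + 4. *)
Definition gap (k : nat) : R := 4 * k%:R + 2.
Definition ceil : R := n%:R + 2.
Definition upper (k : nat) : R * R := (gap k, ceil).
Definition lower (k : nat) : R * R := (gap k, 0).

Local Notation seg := (@segment R n e0 q0).

(* From the base point through the k-th gap between the rings down to the
   axis. *)
Definition gap_path (k : nat) : Gamma :=
  (seg (upper 0) (upper k) * seg (upper k) (lower k) * seg (lower k) (lower 0))%g.

(** It corresponds to x_0 ... x_{k-1}: down through the gap 0, along the axis through the first k
    rings, up through the gap k. *)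
Definition gap_loop (k : nat) : Gamma := (gap_path 0 / gap_path k)%g.

Lemma gapE k : gap k.+1 = base_center R k + 2.
Proof. by rewrite /gap /base_center. Qed.

Lemma on_ring_axial (a r : 'I_n -> R) (h : ring_config_set
    ((fun i => axial (a i) (r i)) : labelled_data R n)) x y :
  on_ring (config_of (mk_config h)) (vec3 x y 0) ->
  exists j, x = a j /\ y ^+ 2 = r j ^+ 2.
Proof.
move=> /on_ringP[j] /= /ring_axialP; rewrite !vec3E => -[e1 e2].
by exists j; split=> //; move: e2; rewrite expr0n addr0.
Qed.

(** * One exchange, seen in the half-plane *)

Section OneGenerator.
Context (i : 'I_n.-1).
Local Notation D := (base_center R i).

(** An index i exists only for n >= 2. The bound lets the slanted segments from the tops of the
    neighbouring gaps to [crossing] pass above the points that they have to avoid. *)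
Lemma ceil_ge4 : 4 <= ceil.
Proof.
have n2 : (2 <= n)%N by case: (i) => j /=; lia.
have : 2%:R <= n%:R :> R by rewrite ler_nat.
by rewrite /ceil; lra.
Qed.

Lemma on_ring_rho (t : I) x y : 0 <= y -> on_ring (rho_loop R i t) (vec3 x y 0) ->
  [\/ x = D + 4 * \val t /\ y = 1 - 2 * \val t * (1 - \val t),
      x = D + 4 - 4 * \val t /\ y = 1 |
      y = 1 /\ exists j : nat, [/\ x = base_center R j, j <> i & j <> i.+1]].
Proof.
move=> y0 /on_ring_axial[j [xj]].
have [rad0 _] := rho_planar_conf i t; have r0 := rad0 j.
move=> /eqP; rewrite eqrXn2// ?(ltW r0)// => /eqP yj; move: xj yj.
rewrite /rho_center /rho_radius.
have [->|ji] := eqVneq (j : nat) i; first by constructor 1.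
have [->|ji1] := eqVneq (j : nat) i.+1; first by rewrite base_centerS; constructor 2.
by move=> -> ->; constructor 3; split=> //; exists j; split=> //; apply/eqP.
Qed.

Lemma base_center_off (j : nat) : j <> i -> j <> i.+1 ->
  base_center R j <= D - 4 \/ D + 8 <= base_center R j.
Proof.
move=> ji ji1; have [lt_ij|lt_ji] : (i.+1 < j)%N \/ (j < i)%N by lia.
  by right; have := base_center_lt R lt_ij; rewrite base_centerS; lra.
by left; have := base_center_lt R lt_ji; lra.
Qed.

Lemma off_upper (t : I) x y : 1 < y -> planar_off (rho_loop R i t) x y.
Proof.
move=> y1 /on_ring_rho; case=> [|[_ h]|[_ h]|[h _]]; try lra.
by have /andP[] := Defs.itv_bound t; move: h; move: (\val t) => s h s0 s1; nra.
Qed.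

Lemma off_lower (t : I) x y : 0 <= y -> y < 2^-1 -> planar_off (rho_loop R i t) x y.
Proof.
move=> y0 y1 /on_ring_rho; case=> [|[_ h]|[_ h]|[h _]]; try lra.
by have /andP[] := Defs.itv_bound t; move: h; move: (\val t) => s h s0 s1; have := sqr_ge0 (2 * s - 1); rewrite expr2; lra.
Qed.

Lemma off_middle (t : I) x y : 0 <= y -> D - 4 < x < D + 8 ->
  (x = D + 4 * \val t -> y <> 1 - 2 * \val t * (1 - \val t)) ->
  (x = D + 4 - 4 * \val t -> y <> 1) -> planar_off (rho_loop R i t) x y.
Proof.
move=> y0 xD h1 h2 /on_ring_rho; case=> // [[/h1]|[/h2]|[_ [j [xj ji ji1]]]] //.
by have [] := base_center_off ji ji1; rewrite -xj; lra.
Qed.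

Lemma off_gap (t : I) k x y : 0 <= y -> (k <> i.+1)%N -> x = gap k ->
  planar_off (rho_loop R i t) x y.
Proof.
move=> y0 ki ->.
have gap_off : gap k <= D - 2 \/ D + 6 <= gap k.
  have [lt_ik|lt_ki] : (i.+2 <= k)%N \/ (k <= i)%N by lia.
    right; rewrite /gap /base_center.
    have : i.+2%:R <= k%:R :> R by rewrite ler_nat.
    by rewrite -[i.+2%:R]natr1; lra.
  left; rewrite /gap /base_center -natr1.
  have : k%:R <= i%:R :> R by rewrite ler_nat.
  by lra.
have /= t01 := Defs.itv_bound t.
move=> /on_ring_rho; case=> // [[h _]|[h _]|[_ [j [h _ _]]]]; try (simpl in *; lra).
have [lt_kj|lt_jk] := leqP k j.
  have : k%:R <= j%:R :> R by rewrite ler_nat.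
  by move: h; rewrite /gap /base_center -natr1; lra.
have : j.+1%:R <= k%:R :> R by rewrite ler_nat.
by move: h; rewrite /gap /base_center; lra.
Qed.

Local Notation rho_half t := (rho_loop R i (to_itv (2^-1 * \val t + 0))).
Local Notation rho_half' t := (rho_loop R i (to_itv (2^-1 * \val t + 2^-1))).
Local Notation trk := (track e0 (rho_loop R i)).
Local Notation k := i.+1.

Let rho0 : (rho_loop R i : I -> Q) zero = q0 := path_zero (s := rho_loop R i).
Let rho1 : (rho_loop R i : I -> Q) one = q0 := path_one (s := rho_loop R i).

Lemma rho_seg P S : (forall t, segment_off (rho_loop R i t) P S) ->
  (trk P * seg P S = seg P S * trk S)%g.
Proof.
move=> h; apply: track_segment => //; exact: cts_fun.
Qed.

Lemma upper_segment_off t a b : segment_off (rho_loop R i t) (upper a) (upper b).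
Proof.
move=> s _; apply: off_upper; rewrite /= linaa; have := ceil_ge4; lra.
Qed.

Lemma lower_segment_off t a b : segment_off (rho_loop R i t) (lower a) (lower b).
Proof. by move=> s _; apply: off_lower; rewrite /= linaa; lra. Qed.

Lemma upper_triangle a b c : (seg (upper a) (upper b) * seg (upper b) (upper c))%g =
  seg (upper a) (upper c).
Proof.
apply: segment_triangle => x y z x0 y0 z0 xyz; rewrite -rho0; apply: off_upper => /=.
rewrite -!mulrDl xyz mul1r; have := ceil_ge4; lra.
Qed.

Lemma lower_triangle a b c : (seg (lower a) (lower b) * seg (lower b) (lower c))%g =
  seg (lower a) (lower c).
Proof.
apply: segment_triangle => x y z x0 y0 z0 xyz; rewrite -rho0.
by apply: off_lower; rewrite /= !mulr0 !addr0; lra.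
Qed.

Lemma gap_segment_off t j : j <> k -> segment_off (rho_loop R i t) (upper j) (lower j).
Proof.
move=> jk s s01; apply: (off_gap (k := j)) => //=; last exact: linaa.
by rewrite /lin mulr0 addr0 mulr_ge0//; have := ceil_ge4; lra.
Qed.

(** All three segments stay off the rings during the whole exchange: the upper one is above them,
    the column is in an undisturbed gap, and the lower one runs on the axis, inside every ring. *)
Lemma gap_path_comm j : j <> k -> (trk (upper 0) * gap_path j = gap_path j * trk (lower 0))%g.
Proof.
move=> jk; rewrite /gap_path !mulgA.
rewrite rho_seg; last by move=> t; exact: upper_segment_off.
rewrite -(mulgA (seg (upper 0) (upper j))) rho_seg; last by move=> t; exact: gap_segment_off.
rewrite !mulgA -[LHS]mulgA rho_seg ?mulgA//.
by move=> t; exact: lower_segment_off.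
Qed.

(** At time 1/2 the two moving points are over the gap i + 1 at heights 1/2 and 1; this point lies
    between them. *)
Definition crossing : R * R := (gap k, 3 / 4).
Local Notation T := (upper k).
Local Notation B := (lower k).
Local Notation LT := (upper i).
Local Notation LB := (lower i).
Local Notation RT := (upper i.+2).
Local Notation RB := (lower i.+2).
Local Notation C := crossing.

Let gap_k : gap k = D + 2. Proof. exact: gapE. Qed.
Let gap_L : gap i = D - 2. Proof. by rewrite /gap /base_center -natr1; ring. Qed.
Let gap_R : gap i.+2 = D + 6. Proof. by rewrite gapE base_centerS; ring. Qed.

Let near_mid (P : R * R) := 0 <= P.2 /\ D - 2 <= P.1 <= D + 6.

Lemma convex_mid a b c P S U : 0 <= a -> 0 <= b -> 0 <= c -> a + b + c = 1 ->
  near_mid P -> near_mid S -> near_mid U ->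
  0 <= a * P.2 + b * S.2 + c * U.2 /\
  D - 4 < a * P.1 + b * S.1 + c * U.1 < D + 8.
Proof.
move=> a0 b0 c0 abc [P0 /andP[P1 P2]] [S0 /andP[S1 S2]] [U0 /andP[U1 U2]].
split; first by rewrite !addr_ge0 ?mulr_ge0.
have aD : a * D + b * D + c * D = D by rewrite -!mulrDl abc mul1r.
have := ler_wpM2l a0 P1; have := ler_wpM2l b0 S1; have := ler_wpM2l c0 U1.
have := ler_wpM2l a0 P2; have := ler_wpM2l b0 S2; have := ler_wpM2l c0 U2.
rewrite !mulrBr !mulrDr; lra.
Qed.

(* Over the interval between the gaps i and i + 2 only the rings i and i + 1 meet
   the half-plane, in the two points that occur in the hypothesis. *)
Lemma triangle_mid t q P S U : rho_loop R i t = q ->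
  near_mid P -> near_mid S -> near_mid U ->
  (forall a b c : R, 0 <= a -> 0 <= b -> 0 <= c -> a + b + c = 1 ->
    let x := a * P.1 + b * S.1 + c * U.1 in
    let y := a * P.2 + b * S.2 + c * U.2 in
    (x = D + 4 * \val t -> y <> 1 - 2 * \val t * (1 - \val t)) /\
    (x = D + 4 - 4 * \val t -> y <> 1)) ->
  triangle_off q P S U.
Proof.
move=> <- hP hS hU h a b c a0 b0 c0 abc.
have [y0 x0] := convex_mid a0 b0 c0 abc hP hS hU.
by have [h1 h2] := h a b c a0 b0 c0 abc; exact: off_middle.
Qed.

Lemma triangle_base P S U : near_mid P -> near_mid S -> near_mid U ->
  (forall a b c : R, 0 <= a -> 0 <= b -> 0 <= c -> a = 1 - b - c ->
    let x := a * P.1 + b * S.1 + c * U.1 in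
    let y := a * P.2 + b * S.2 + c * U.2 in y = 1 -> x <> D /\ x <> D + 4) ->
  triangle_off q0 P S U.
Proof.
move=> hP hS hU h; apply: (triangle_mid rho0) => // a b c a0 b0 c0 abc x y.
have ea : a = 1 - b - c by lra.
have {}h := h a b c a0 b0 c0 ea; rewrite val_zero !mulr0 mul0r !subr0 addr0.
by split=> e /h[]; rewrite -/x e.
Qed.

Let midT : near_mid T. Proof. by rewrite /near_mid /= gap_k; have := ceil_ge4; split; lra. Qed.
Let midB : near_mid B. Proof. by rewrite /near_mid /= gap_k; have := ceil_ge4; split; lra. Qed.
Let midLT : near_mid LT. Proof. by rewrite /near_mid /= gap_L; have := ceil_ge4; split; lra. Qed.
Let midLB : near_mid LB. Proof. by rewrite /near_mid /= gap_L; have := ceil_ge4; split; lra. Qed.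
Let midRT : near_mid RT. Proof. by rewrite /near_mid /= gap_R; have := ceil_ge4; split; lra. Qed.
Let midRB : near_mid RB. Proof. by rewrite /near_mid /= gap_R; have := ceil_ge4; split; lra. Qed.
Let midC : near_mid C. Proof. by rewrite /near_mid /= gap_k; split; lra. Qed.

Lemma column_split : (seg T C * seg C B)%g = seg T B.
Proof.
apply/segment_triangle/triangle_base => // a b c a0 b0 c0 ea x y _.
have -> : x = D + 2 by rewrite /x /= gap_k ea; ring.
split; lra.
Qed.

Lemma column_split' : (seg B C * seg C T)%g = seg B T.
Proof.
apply/segment_triangle/triangle_base => // a b c a0 b0 c0 ea x y _.
have -> : x = D + 2 by rewrite /x /= gap_k ea; ring.
split; lra.
Qed.

Lemma left_detour0 : (seg T LT * seg LT C)%g = seg T C.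
Proof.
apply/segment_triangle/triangle_base => // a b c a0 b0 c0 ea x y.
have -> : x = D + 2 - 4 * b by rewrite /x /= gap_k gap_L ea; ring.
have -> : y = (1 - c) * (ceil - 3 / 4) + 3 / 4 by rewrite /y /= ea; field.
have c1 : 0 <= 1 - c by lra.
by have := ler_wpM2l c1 ceil_ge4; split; lra.
Qed.

Lemma right_detour0 : (seg C RB * seg RB B)%g = seg C B.
Proof.
apply/segment_triangle/triangle_base => // a b c a0 b0 c0 ea x y.
have -> : y = a * (3 / 4) by rewrite /y /=; ring.
split; lra.
Qed.

Lemma left_detour1 : (seg LB B * seg B C)%g = seg LB C.
Proof.
apply/segment_triangle/triangle_base => // a b c a0 b0 c0 ea x y.
have -> : y = c * (3 / 4) by rewrite /y /=; ring.
split; lra.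
Qed.

Lemma right_detour1 : (seg C T * seg T RT)%g = seg C RT.
Proof.
apply/segment_triangle/triangle_base => // a b c a0 b0 c0 ea x y.
have -> : x = D + 2 + 4 * c by rewrite /x /= gap_k gap_R ea; ring.
have -> : y = (1 - a) * (ceil - 3 / 4) + 3 / 4 by rewrite /y /= ea; field.
have a1 : 0 <= 1 - a by lra.
by have := ler_wpM2l a1 ceil_ge4; split; lra.
Qed.

Local Notation half := (to_itv (2^-1 : R)).
Local Notation qh := (rho_loop R i half).
Local Notation segh := (@segment R n e0 qh).

Lemma val_half : \val half = 2^-1.
Proof. by rewrite val_to_itv clip_id; lra. Qed.

(** At time 1/2 both moving points are on the vertical line through [C], which the triangle meets in
    [C] alone. *)
Lemma left_detour_half : (segh LT LB * segh LB C)%g = segh LT C.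
Proof.
apply/segment_triangle/(triangle_mid erefl) => // a b c a0 b0 c0 abc x y.
have ea : a = 1 - b - c by lra.
rewrite val_half.
have -> : x = D + 2 - 4 * (1 - c) by rewrite /x /= gap_k gap_L ea; ring.
have -> : y = a * ceil + c * (3 / 4) by rewrite /y /=; ring.
have h : 1 - c = 0 -> a * ceil + c * (3 / 4) = 3 / 4.
  move=> c1; have -> : a = 0 by lra.
  have -> : c = 1 by lra.
  ring.
by split=> e; rewrite h; lra.
Qed.

Lemma right_detour_half : (segh C RT * segh RT RB)%g = segh C RB.
Proof.
apply/segment_triangle/(triangle_mid erefl) => // a b c a0 b0 c0 abc x y.
have ea : a = 1 - b - c by lra.
rewrite val_half.
have -> : x = D + 2 + 4 * (1 - a) by rewrite /x /= gap_k gap_R ea; ring.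
have -> : y = b * ceil + a * (3 / 4) by rewrite /y /=; ring.
have h : 1 - a = 0 -> b * ceil + a * (3 / 4) = 3 / 4.
  move=> c1; have -> : b = 0 by lra.
  have -> : a = 1 by lra.
  ring.
by split=> e; rewrite h; lra.
Qed.

Lemma segment_mid t P S : near_mid P -> near_mid S ->
  (forall u : R, 0 <= u <= 1 -> let x := lin P.1 S.1 u in let y := lin P.2 S.2 u in
    (x = D + 4 * \val t -> y <> 1 - 2 * \val t * (1 - \val t)) /\
    (x = D + 4 - 4 * \val t -> y <> 1)) ->
  segment_off (rho_loop R i t) P S.
Proof.
move=> hP hS h u u01; have [h1 h2] := h u u01.
have [] := @convex_mid (1 - u) u 0 P S S; rewrite ?mul0r ?addr0//; try lra.
by move=> y0 x0; exact: off_middle.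
Qed.

(** The point of ring i + 1 reaches the upper part of the column from the right, that of ring i the
    lower part from the left. In the first half of the exchange the two parts are therefore bent to
    [LT] and [RB]. In the second half, with the moving points on the other sides, the ends are [LB]
    and [RT]. *)
Lemma left_low_off t : \val t <= 2^-1 -> segment_off (rho_loop R i t) LT C.
Proof.
have /andP[] := Defs.itv_bound t; move: (\val t) (@segment_mid t) => s h s0 _ s2.
apply: h => // u /andP[u0 u1] x y.
have -> : x = D - 2 + 4 * u by rewrite /x /lin /= gap_k gap_L; ring.
have -> : y = 3 / 4 + (1 - u) * (ceil - 3 / 4) by rewrite /y /lin /=; field.
have u1' : 0 <= 1 - u by lra.
have c4 := ler_wpM2l u1' ceil_ge4.
split=> e; last first.
  have -> : u = 1 by lra.
  lra.
have eu : u = s + 2^-1 by lra.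
have s3 : 0 <= 2^-1 - s by lra.
have := mulr_ge0 s0 s3; rewrite eu in c4 *; lra.
Qed.

Lemma right_low_off t : \val t <= 2^-1 -> segment_off (rho_loop R i t) C RB.
Proof.
have /andP[] := Defs.itv_bound t; move: (\val t) (@segment_mid t) => s h s0 _ s2.
apply: h => // u /andP[u0 u1] x y.
have -> : x = D + 2 + 4 * u by rewrite /x /lin /= gap_k gap_R; ring.
have -> : y = 3 / 4 * (1 - u) by rewrite /y /lin /=; ring.
split=> e; last by lra.
have -> : u = 0 by lra.
have -> : s = 2^-1 by lra.
lra.
Qed.

Lemma left_high_off t : 2^-1 <= \val t -> segment_off (rho_loop R i t) LB C.
Proof.
have /andP[] := Defs.itv_bound t; move: (\val t) (@segment_mid t) => s h _ s1 s2.
apply: h => // u /andP[u0 u1] x y.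
have -> : x = D - 2 + 4 * u by rewrite /x /lin /= gap_k gap_L; ring.
have -> : y = 3 / 4 * u by rewrite /y /lin /=; ring.
split=> e; last by lra.
have -> : u = 1 by lra.
have -> : s = 2^-1 by lra.
lra.
Qed.

Lemma right_high_off t : 2^-1 <= \val t -> segment_off (rho_loop R i t) C RT.
Proof.
have /andP[] := Defs.itv_bound t; move: (\val t) (@segment_mid t) => s h _ s1 s2.
apply: h => // u /andP[u0 u1] x y.
have -> : x = D + 2 + 4 * u by rewrite /x /lin /= gap_k gap_R; ring.
have -> : y = 3 / 4 + u * (ceil - 3 / 4) by rewrite /y /lin /=; field.
have c4 := ler_wpM2l u0 ceil_ge4.
split=> e; last first.
  have -> : u = 0 by lra.
  lra.
have es : s = u + 2^-1 by lra.
have u2 : 0 <= 2^-1 - u by lra.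
have := mulr_ge0 u0 u2; rewrite es; lra.
Qed.

Local Notation first_half := (fun t : I => rho_loop R i (to_itv (2^-1 * \val t + 0))).
Local Notation second_half := (fun t : I => rho_loop R i (to_itv (2^-1 * \val t + 2^-1))).
Local Notation trk1 := (track e0 first_half).
Local Notation trk2 := (track e0 second_half).

Lemma first_half_seg P S : (forall t, \val t <= 2^-1 -> segment_off (rho_loop R i t) P S) ->
  (trk1 P * segh P S = seg P S * trk1 S)%g.
Proof.
move=> h; apply: track_segment.
- apply: continuous_path_clip.
  exact/continuous_affine_val/continuous_val.
- by rewrite val_zero mulr0 addr0.
- by rewrite val_one mulr1 addr0.
- move=> t; apply: h; rewrite val_to_itv clip_id; have := Defs.itv_bound t; lra.
Qed.

Lemma second_half_seg P S : (forall t, 2^-1 <= \val t -> segment_off (rho_loop R i t) P S) ->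
  (trk2 P * seg P S = segh P S * trk2 S)%g.
Proof.
move=> h; apply: track_segment.
- apply: continuous_path_clip.
  exact/continuous_affine_val/continuous_val.
- by rewrite val_zero mulr0 add0r.
- by rewrite val_one mulr1 path_one_ge//; lra.
- move=> t; apply: h; rewrite val_to_itv clip_id; have := Defs.itv_bound t; lra.
Qed.

(** At time 0 the column is T LT C RB B. At time 1/2 the slanted segments may be replaced by LT LB C
    and C RT RB, and at time 1 by LB B C and C T RT. The piece B C T left in the middle is the
    column reversed. *)
Lemma gap_crossing : (seg T B * trk B =
  trk T * seg T LT * seg LT LB * seg LB B / seg T B * seg T RT * seg RT RB * seg RB B)%g.
Proof.
have offT t : planar_off (rho_loop R i t) T.1 T.2.
  by apply: off_upper => /=; have := ceil_ge4; lra.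
have offB t : planar_off (rho_loop R i t) B.1 B.2.
  by apply: off_lower => /=; lra.
have halves P : (forall t, planar_off (rho_loop R i t) P.1 P.2) ->
    (trk P = trk1 P * trk2 P)%g.
  by move=> h; apply: track_halves => //; exact: cts_fun.
have ext (a b c d : Gamma) : (a * b = c * d -> forall g, g * a * b = g * c * d)%g.
  by move=> e g; rewrite -!mulgA e.
have ext1 (a b c : Gamma) : (a * b = c -> forall g, g * a * b = g * c)%g.
  by move=> e g; rewrite -mulgA e.
have iS : i <> k :> nat by lia.
have i2S : i.+2 <> k by lia.
have revTB : (seg T B)^-1%g = seg B T.
  apply/esym/segment_rev; rewrite -rho0; apply: segment_mid => // u /andP[u0 u1] x y.
  have -> : x = D + 2 by rewrite /x /lin /= gap_k; ring.
  by rewrite val_zero; split; lra.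
have s1 P S h g := ext _ _ _ _ (@first_half_seg P S h) g.
have s2 P S h g := ext _ _ _ _ (@second_half_seg P S h) g.
have upp a b t := @upper_segment_off t a b; have low a b t := @lower_segment_off t a b.
rewrite !halves// revTB -column_split' -column_split -left_detour0 -right_detour0.
rewrite !mulgA.
rewrite (ext1 _ _ _ left_detour1) (ext1 _ _ _ right_detour1).
(* The second half of the track moves to the right through the path at time 1 and turns it into a
   path at time 1/2; after the detours are removed there, the first half of the track follows. *)
rewrite (s2 T LT (fun t _ => upp _ _ t)).
rewrite (s2 LT LB (fun t _ => gap_segment_off (t := t) iS)).
rewrite (s2 LB C left_high_off) (s2 C RT right_high_off).
rewrite (s2 RT RB (fun t _ => gap_segment_off (t := t) i2S)).
rewrite (s2 RB B (fun t _ => low _ _ t)).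
rewrite (ext1 _ _ _ left_detour_half) (ext1 _ _ _ right_detour_half).
rewrite (first_half_seg (fun t _ => upp _ _ t)).
rewrite (s1 LT C left_low_off) (s1 C RB right_low_off).
by rewrite (s1 RB B (fun t _ => low _ _ t)).
Qed.

Lemma gap_path_crossing : (gap_path k * trk (lower 0) =
  trk (upper 0) * gap_path i / gap_path k * gap_path i.+2)%g.
Proof.
have offU t a b := @upper_segment_off t a b; have offL t a b := @lower_segment_off t a b.
rewrite /gap_path -[LHS]mulgA -(rho_seg (fun t => offL t k 0)) !mulgA.
rewrite -(mulgA (seg (upper 0) T)) gap_crossing !mulgA -(rho_seg (fun t => offU t 0 k)).
rewrite -(upper_triangle 0 k i) -(upper_triangle 0 k i.+2) -(lower_triangle i k 0).
by rewrite -(lower_triangle i.+2 k 0) !grpE.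
Qed.

End OneGenerator.

Lemma height_rho (i : 'I_n.-1) (t : I) : height (rho_loop R i t) = ceil.
Proof.
rewrite [rho_loop R i t]/(config_of _) heightE /ceil; congr (_ + _).
apply/max_idPl; rewrite /config_span /=.
rewrite -[leRHS]mulr1 -[n in n%:R]card_ord -sum1_card natr_sum mulr_suml.
apply: ler_sum => j _; rewrite !mxE /= mulr0 normr0 add0r mul1r /rho_radius.
case: ifP => // _; have /andP[] := Defs.itv_bound t.
by move=> t0 t1; rewrite gerBl !mulr_ge0 ?subr_ge0.
Qed.

Definition ring_lift : ring_group R n -> Gamma := pi1_map (@far_section_continuous R n) (x0 := q0).

Lemma ring_liftM : {morph ring_lift : a b / (a * b)%g}.
Proof. exact: pi1_mapM. Qed.

Lemma ring_lift_rho (i : 'I_n.-1) :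
  ring_lift (rho R i) = track e0 (rho_loop R i) (upper 0).
Proof.
rewrite /ring_lift /rho pi1_map_pi -path_class_loop path_class_fun.
apply: eq_fun_class => t /=.
transitivity (far_section (rho_loop R i t)) => //.
by rewrite far_section_planar height_rho /gap mulr0 add0r.
Qed.

(** With [gap_loop k] read as x_0 ... x_{k-1} this is [artin i]. *)
Lemma gap_loop_conj (i : 'I_n.-1) j :
  (gap_loop j ^ ring_lift (rho R i) =
   if j == i.+1 then gap_loop i.+2 / gap_loop i.+1 * gap_loop i else gap_loop j)%g.
Proof.
have h0 := @gap_path_comm i 0 (fun e => O_S _ e).
rewrite ring_lift_rho /gap_loop; case: eqP => [->|/= ji].
  rewrite (conj_quotient h0 (v := gap_path i / gap_path i.+1 * gap_path i.+2)%g).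
    move: (gap_path 0) (gap_path i) (gap_path i.+1) (gap_path i.+2) => a b c d.
    by rewrite !grpE.
  by rewrite gap_path_crossing !mulgA.
by apply: (conj_quotient h0); rewrite -gap_path_comm.
Qed.

End Transport.

(** * Lifting and straightening squares of configurations *)

Section Lifting.
Context (R : realType) (n : nat).
Local Notation E3 := 'rV[R]_3.
Local Notation L := (labelled_config R n).
Local Notation Q := (ring_space R n).
Local Notation V := (R * R)%type.
Implicit Types (a b : L) (u v : V).

Lemma fin_lower_bound (T : finType) (g : T -> R) : (forall t, 0 < g t) ->
  exists2 d, 0 < d & forall t, d <= g t.
Proof.
move=> g0; exists (\big[Num.min/1]_t g t).
  by apply: (big_ind (fun x => 0 < x)) => // x y x0 y0; rewrite lt_min x0.
by move=> t; rewrite (bigD1 t)//= ge_min lexx.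
Qed.

Lemma config_dist_eq0 a b : config_dist a b = 0 -> a = b.
Proof.
move=> ab; apply/val_inj/funext => i.
have [] := config_dist_ge a b i; rewrite ab !normr_le0 !subr_eq0.
case: (\val a i) => -[c r] nu; case: (\val b i) => -[c' r'] nu' /=.
by move=> /eqP -> /eqP -> /eqP ->.
Qed.

Lemma config_distxx a : config_dist a a = 0.
Proof. by rewrite /config_dist big1// => i _; rewrite !subrr !normr0 !addr0. Qed.

Lemma continuous_norm_sub (X : normedModType R) (T : topologicalType) (x : X)
    (f : T -> X) : continuous f -> continuous (fun t => `|x - f t|).
Proof.
by move=> cf t; apply: cvg_norm; apply: cvgB; [exact: cvg_cst|exact: cf].
Qed.

Lemma config_dist_continuous a : continuous (config_dist a).
Proof.
apply: continuous_sumf => i.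
apply: continuous_addf; [apply: continuous_addf|]; apply: continuous_norm_sub.
- exact: continuous_centre.
- exact: continuous_radius.
- exact: continuous_normal.
Qed.

Lemma config_dist_near a e : 0 < e -> \forall b \near a, config_dist a b < e.
Proof.
move=> e0; have /cvgrPdist_lt/(_ _ e0) := @config_dist_continuous a a.
apply: filterS => b.
by rewrite config_distxx sub0r normrN; exact/le_lt_trans/ler_norm.
Qed.

Lemma continuous_config_dist (T : topologicalType) (f : T -> L) :
  (forall t e, 0 < e -> \forall t' \near t, config_dist (f t) (f t') < e) ->
  continuous f.
Proof.
move=> h; apply: continuous_config => i.
have near_lt (X : normedModType R) (g : L -> X) :
    (forall a b, `|g a - g b| <= config_dist a b) -> continuous (fun t => g (f t)).
  move=> gd t; apply/cvgrPdist_lt => e e0; near=> t'.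
  by apply: le_lt_trans (gd _ _) _; near: t'; exact: h.
have -> : (fun t => \val (f t) i) =
    fun t => ((\val (f t) i).1.1, (\val (f t) i).1.2, (\val (f t) i).2).
  by apply/funext => t'; case: (\val (f t') i) => -[].
apply: continuous_pair; [apply: continuous_pair|].
- by apply: (near_lt _ (fun a => (\val a i).1.1)) => a b; have [] := config_dist_ge a b i.
- by apply: (near_lt _ (fun a => (\val a i).1.2)) => a b; have [] := config_dist_ge a b i.
- by apply: (near_lt _ (fun a => (\val a i).2)) => a b; have [] := config_dist_ge a b i.
Unshelve. all: by end_near. Qed.

(** Discreteness, with an explicit radius, of the fibre of the quotient map through a. *)
Definition separated a (s : R) :=
  forall b, config_of b = config_of a -> config_dist a b < s -> b = a.

Lemma opp_vec_eq (v : E3) : - v = v -> v = 0.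
Proof.
move=> e; have h k : v 0 k = 0.
  by have := congr1 (fun v : E3 => v 0 k) e; rewrite mxE; lra.
by apply: vec3P; rewrite !h mxE.
Qed.

(** Signed permutations act freely: distinct labels carry distinct rings, and a unit normal differs
    from its opposite. *)
Lemma relabel_id s f (hs : injective s) a b : relabel f hs a = a ->
  relabel f hs b = b.
Proof.
move=> e.
have ei i : flip (f i) (\val a (s i)) = \val a i.
  by rewrite -[in RHS]e.
have si i : s i = i.
  by apply: (@config_ring_inj _ _ a); rewrite -[RHS](congr1 (@ring_of R) (ei i)) ring_of_flip.
have fi i : f i = false.
  have := ei i; rewrite si; case: (f i) => // /(congr1 snd) /=.
  have [_ +] := config_data a i; move: (\val a i).2 => v vv.
  by rewrite expr1 scaleN1r => /opp_vec_eq v0; move: vv; rewrite v0 dotE !mxE; lra.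
apply/val_inj/funext => i /=; rewrite fi si /flip expr0 scale1r.
by case: (\val b i).
Qed.

Lemma separated_relabel a b s : config_of b = config_of a ->
  separated a s -> separated b s.
Proof.
move=> /esym/config_of_eq[p [f [hp ->]]] sa c cb bc.
have := sa (relabel f hp c); rewrite !config_of_relabel config_dist_relabel.
move=> /(_ cb bc) e; apply: config_dist_eq0.
by rewrite -(config_dist_relabel f hp) e config_distxx.
Qed.

Lemma separated_near a b s : separated a (s + s + s) -> config_dist a b < s ->
  separated b s.
Proof.
move=> sa ab c /config_of_eq[p [f [hp ->]]] bc; apply: (@relabel_id _ _ _ a).
apply: sa; first exact: config_of_relabel.
have h1 := config_distD b a (relabel f hp a).
have h2 := config_distD (relabel f hp b) b (relabel f hp a).
have := config_dist_relabel f hp b a; rewrite (config_distC b a); lra.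
Qed.

Lemma separated_exists a : exists2 s, 0 < s & separated a s.
Proof.
(* For a nontrivial triple (i, j, f), [g] bounds from below the displacement of a relabelling that
   puts ring j, with flip f, at label i. The trivial triples get the harmless value 1. *)
pose g (t : 'I_n * 'I_n * bool) : R :=
  if (t.1.1 == t.1.2) && ~~ t.2 then 1 else
  `|(\val a t.1.1).1.1 - (\val a t.1.2).1.1| + `|(\val a t.1.1).1.2 - (\val a t.1.2).1.2|
  + `|(\val a t.1.1).2 - (-1) ^+ t.2 *: (\val a t.1.2).2|.
have g0 t : 0 < g t.
  rewrite /g; case: ifPn => // h.
  rewrite lt_def !addr_ge0// andbT; apply: contra h.
  rewrite paddr_eq0 ?addr_ge0// paddr_eq0// !normr_eq0 !subr_eq0.
  move=> /andP[/andP[/eqP e1 /eqP e2] /eqP e3].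
  have et : t.1.1 = t.1.2.
    apply: (@config_ring_inj _ _ a).
    rewrite -[RHS](ring_of_flip t.2) /flip -e3; congr ring_of.
    by move: e1 e2; case: (\val a t.1.1) => -[c r] nu /= -> ->; case: (\val a t.1.2) => -[].
  rewrite et eqxx /=; apply/negP => t2; move: e3; rewrite t2 et expr1 scaleN1r.
  have [_] := config_data a t.1.2; move: (\val a t.1.2).2 => v vv.
  by move=> /esym/opp_vec_eq v0; move: vv; rewrite v0 dotE !mxE; lra.
have [d d0 dg] := fin_lower_bound g0.
exists (Num.min d 1); first by rewrite lt_min d0 ltr01.
move=> b /config_of_eq[p [f [hp ->]]]; rewrite lt_min => /andP[ab _].
have h i : p i = i /\ f i = false.
  have gi : g (i, p i, f i) <= config_dist a (relabel f hp a) ->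
      (i == p i) && ~~ f i.
    move=> le_g; apply: contraT => ne.
    by have := dg (i, p i, f i); have := le_lt_trans le_g ab; lra.
  have : (i == p i) && ~~ f i.
    apply: contraT => ne; move: (ne); apply: contraNT => _; apply: gi.
    rewrite /g /= (negPf ne) /config_dist (bigD1 i)//= lerDl.
    by apply: sumr_ge0 => j _; rewrite !addr_ge0.
  by move=> /andP[/eqP <- /negPf].
apply/val_inj/funext => i /=; have [-> ->] := h i.
by rewrite /flip expr0 scale1r; case: (\val a i).
Qed.

(** The quotient map is open, since relabellings are isometries. *)
Lemma near_lift (q : Q) a e : config_of a = q -> 0 < e ->
  \forall q' \near q, exists2 b, config_of b = q' & config_dist a b < e.
Proof.
move=> <- e0.
pose W : set Q := [set q' | exists2 b, config_of b = q' & config_dist a b < e].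
have oW : open W.
  suff : open (@config_of R n @^-1` W) by [].
  rewrite openE => b [b' eb ab]; rewrite /interior.
  have [p [f [hp eb']]] := config_of_eq eb.
  have d0 : 0 < e - config_dist a b' by lra.
  apply: filterS (config_dist_near b d0) => c bc; exists (relabel f hp c); first exact: config_of_relabel.
  have := config_distD b' a (relabel f hp c).
  by rewrite {2}eb' config_dist_relabel; lra.
by apply: open_nbhs_nbhs; split=> //; exists a; rewrite ?config_distxx.
Qed.

Definition unit_square : set V := `[0, 1] `*` `[0, 1].

Lemma unit_square_compact : compact unit_square.
Proof. exact: compact_setX (@segment_compact _ _ _) (@segment_compact _ _ _). Qed.

(** Turns a modulus that works locally into one that works on a whole compact set. *)
Lemma compact_uniform (T : topologicalType) (K : set T) (P : R -> T -> Prop) :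
  compact K -> (forall x, K x -> \forall x' \near x & d \near 0^'+, P d x') ->
  exists2 d, 0 < d & forall x, K x -> P d x.
Proof.
move=> /compact_near_coveringP cK /cK nd.
near (0 : R)^'+ => d; exists d; first by near: d; exact: nbhs_right_gt.
have : K `<=` P d by near: d; exact: nd.
by [].
Unshelve. all: by end_near. Qed.

(** The retraction onto the unit square; with it all maps are defined and continuous on the whole
    plane. *)
Definition clip2 (u : V) : V := (clip u.1, clip u.2).

Lemma clip2_in u : unit_square (clip2 u).
Proof.
by split; rewrite /= in_itv; [exact: (Defs.itv_bound (to_itv u.1))|
  exact: (Defs.itv_bound (to_itv u.2))].
Qed.

Lemma clip2_continuous : continuous clip2.
Proof.
apply: (@continuous_pair V _ _ (@clip R \o fst) (@clip R \o snd)) => u.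
  by apply: continuous_comp; [exact: cvg_fst|exact: clip_continuous].
by apply: continuous_comp; [exact: cvg_snd|exact: clip_continuous].
Qed.

Lemma unit_square_scale (t : R) u : 0 <= t <= 1 -> unit_square u ->
  unit_square (t *: u).
Proof.
move=> /andP[t0 t1] [/=]; rewrite !in_itv /= => /andP[x0 x1] /andP[y0 y1].
by split; rewrite /= in_itv /= mulr_ge0//= mulr_ile1.
Qed.

(** The square is contracted to the origin in N steps shorter than d. Lifting and deformation both
    start from the constant family and gain one step at a time; that the origin never moves makes
    the deformation the identity there. *)
Lemma radial_steps (d : R) : 0 < d -> exists (N : nat) (v : nat -> V -> V),
  (forall u, v 0%N u = 0) /\ (forall u, v N u = clip2 u) /\
  (forall k, continuous (v k)) /\
  (forall k u, (k <= N)%N -> unit_square (v k u)) /\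
  (forall k u, (k < N)%N -> ball (v k u) d (v k.+1 u)) /\
  (forall k, v k 0 = 0).
Proof.
move=> d0; have [N dN] : exists N : nat, d^-1 < N%:R.
  by exists (Num.trunc d^-1).+1; rewrite truncnS_gt.
have N0 : 0 < N%:R :> R by apply: lt_trans dN; rewrite invr_gt0.
exists N, (fun k u => (k%:R / N%:R) *: clip2 u).
have clip20 : clip2 0 = 0 by rewrite /clip2 /= clip0.
split; first by move=> u; rewrite mul0r scale0r.
split; first by move=> u; rewrite divff ?scale1r// gt_eqF.
split.
  move=> k u; apply: (@continuous_comp _ _ _ clip2 ( *:%R (k%:R / N%:R))).
    exact: clip2_continuous.
  exact: scaler_continuous.
split.
  move=> k u le_k; apply: unit_square_scale; last exact: clip2_in.
  by rewrite divr_ge0//= ler_pdivrMr// mul1r ler_nat.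
split; last by move=> k; rewrite clip20 scaler0.
move=> k u lt_k; rewrite -ball_normE /ball_ /=.
rewrite -scalerBl -mulrBl -natr1 opprD addrA subrr sub0r mulN1r normrZ normrN.
rewrite normfV ger0_norm ?ltW//.
have : `|clip2 u| <= 1.
  have [] := clip2_in u; rewrite /= !in_itv /= => /andP[x0 x1] /andP[y0 y1].
  by rewrite ge_max !ger0_norm// x1 y1.
move=> h; apply: le_lt_trans (_ : N%:R^-1 * 1 < d).
  by apply: ler_wpM2l => //; rewrite invr_ge0 ltW.
by rewrite mulr1 -[d]invrK ltf_pV2 ?posrE ?invr_gt0.
Qed.

Context (H : V -> Q).
Hypothesis cH : continuous H.

Lemma lift_modulus e : 0 < e -> exists2 d, 0 < d & forall u v a,
  unit_square u -> ball u d v -> config_of a = H u ->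
  exists2 b, config_of b = H v & config_dist a b < e.
Proof.
move=> e0.
pose P (d : R) u := forall v a, ball u d v -> config_of a = H u ->
  exists2 b, config_of b = H v & config_dist a b < e.
suff [d d0 hd] : exists2 d, 0 < d & forall u, unit_square u -> P d u.
  by exists d => // u v a /hd; exact.
apply: compact_uniform unit_square_compact _ => u0 _.
  pose a0 := repr (H u0).
  have e2 : 0 < e / 2 by rewrite divr_gt0.
  have := @near_lift (H u0) a0 (e / 2) (reprK (H u0)) e2.
  move=> /(@cH u0) /nbhs_ballP[r /= r0 hr].
  have r2 : 0 < r / 2 by rewrite divr_gt0.
  near=> u d => v a uv ea.
  have u0u : ball u0 (r / 2) u by near: u; exact: nbhsx_ballx.
  have dr : d < r / 2 by near: d; exact: nbhs_right_lt.
  have [b1 eb1 ab1] : exists2 b, config_of b = H u & config_dist a0 b < e / 2.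
    by apply: hr; apply: le_ball u0u; rewrite [leRHS]splitr lerDl ltW.
  have [b2 eb2 ab2] : exists2 b, config_of b = H v & config_dist a0 b < e / 2.
    apply: hr; rewrite [r]splitr; apply: ball_triangle u0u _.
    by apply: le_ball uv; exact: ltW.
  have [p [f [hp ->]]] : exists p f (hp : injective p), a = relabel f hp b1.
    by apply: config_of_eq; rewrite ea.
  exists (relabel f hp b2); first by rewrite config_of_relabel.
  rewrite config_dist_relabel.
  by have := config_distD a0 b1 b2; rewrite (config_distC b1 a0); lra.
Unshelve. all: by end_near. Qed.

Lemma separation_modulus : exists2 s, 0 < s & forall u a,
  unit_square u -> config_of a = H u -> separated a s.
Proof.
pose P (s : R) u := forall a, config_of a = H u -> separated a s.
suff [d d0 hd] : exists2 d, 0 < d & forall u, unit_square u -> P d u.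
  by exists d => // u a /hd; exact.
apply: compact_uniform unit_square_compact _ => u0 _.
  pose a0 := repr (H u0).
  have [s0 s00 sep] := separated_exists a0.
  have s3 : 0 < s0 / 3 by rewrite divr_gt0.
  have hr := @cH u0 _ (@near_lift (H u0) a0 (s0 / 3) (reprK (H u0)) s3).
  near=> u s => a ea.
  have [b eb ab] : exists2 b, config_of b = H u & config_dist a0 b < s0 / 3.
    by near: u; exact: hr.
  have sepb : separated b (s0 / 3).
    apply: separated_near ab.
    by have -> : s0 / 3 + s0 / 3 + s0 / 3 = s0 by field.
  have ss : s < s0 / 3 by near: s; exact: nbhs_right_lt.
  have : separated a (s0 / 3) by apply: separated_relabel sepb; rewrite ea.
  by move=> sa c ec ac; apply: sa ec _; exact: lt_trans ss.
Unshelve. all: by end_near. Qed.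

(** At each radial step the new lift is taken within s/2 of the previous one. It exists by
    [lift_modulus] and is unique since lifts are separated by s; uniqueness makes this choice
    continuous. *)
Theorem square_lift : exists h : V -> L, continuous h /\
  forall u, config_of (h u) = H (clip2 u).
Proof.
have [s s0 sep] := separation_modulus.
have s2 : 0 < s / 2 by rewrite divr_gt0.
have [d d0 mod] := lift_modulus s2.
have [N [v [v0 [vN [cv [vin [vstep _]]]]]]] := radial_steps d0.
suff : forall k, (k <= N)%N -> exists h : V -> L, continuous h /\
    forall u, config_of (h u) = H (v k u).
  move=> /(_ N (leqnn N))[h [ch hE]]; exists h; split=> // u.
  by rewrite hE vN.
elim=> [_|k IH lt_k].
  exists (fun=> repr (H 0)); split; first exact: cst_continuous.
  by move=> u; rewrite v0; exact: reprK.
have [h [ch hE]] := IH (ltnW lt_k).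
have ex u : exists b, config_of b = H (v k.+1 u) /\ config_dist (h u) b < s / 2.
  have [b] := mod _ _ (h u) (vin k u (ltnW lt_k)) (vstep _ u lt_k) (hE u).
  by exists b.
have [h' h'P] := choice ex.
exists h'; split; last by move=> u; have [] := h'P u.
apply: continuous_config_dist => u0 e e0.
have [e1 hd0] := h'P u0.
have r0 : 0 < s / 2 - config_dist (h u0) (h' u0) by lra.
(* The slack of the choice at [u0]: a lift close to [h' u0] over a nearby point is still within s/2
   of [h u], hence equals [h' u]. *)
set r := _ - _ in r0.
have m0 : 0 < Num.min e (r / 2) by rewrite lt_min e0 divr_gt0.
have near1 := @cv k.+1 u0 _ (@cH (v k.+1 u0) _ (near_lift e1 m0)).
have r2 : 0 < r / 2 by rewrite divr_gt0.
have near2 : \forall u \near u0, config_dist (h u0) (h u) < r / 2.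
  exact: (ch u0 _ (config_dist_near (h u0) r2)).
near=> u.
have [b eb] : exists2 b, config_of b = H (v k.+1 u) &
    config_dist (h' u0) b < Num.min e (r / 2) by near: u; exact: near1.
rewrite lt_min => /andP[be br].
have hu : config_dist (h u0) (h u) < r / 2 by near: u; exact: near2.
have [eu hu'] := h'P u.
suff -> : h' u = b by [].
apply: (sep _ b (vin k.+1 u lt_k) eb); first by rewrite eu.
have := config_distD (h u) b (h' u).
have := config_distD (h u0) (h u) b; have := config_distD (h' u0) (h u0) b.
rewrite (config_distC b (h u)) (config_distC (h u) (h u0)) /r in hu br *; lra.
Unshelve. all: by end_near. Qed.

End Lifting.

Section VectorContinuity.
Context (R : realType) (T : topologicalType).
Local Notation E3 := 'rV[R]_3.
Implicit Types (f g : T -> E3) (s : T -> R).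

Lemma continuous_addv f g : continuous f -> continuous g ->
  continuous (fun t => f t + g t).
Proof. by move=> cf cg t; apply: cvgD; [exact: cf|exact: cg]. Qed.

Lemma continuous_subv f g : continuous f -> continuous g ->
  continuous (fun t => f t - g t).
Proof. by move=> cf cg t; apply: cvgB; [exact: cf|exact: cg]. Qed.

Lemma continuous_scalev s f : continuous s -> continuous f ->
  continuous (fun t => s t *: f t).
Proof. by move=> cs cf t; apply: cvgZ; [exact: cs|exact: cf]. Qed.

Lemma continuous_sumv (J : finType) (f : J -> T -> E3) :
  (forall j, continuous (f j)) -> continuous (fun t => \sum_j f j t).
Proof.
by move=> cf t; apply: cvg_big => [|j _]; [exact: add_continuous|exact: cf].
Qed.

Lemma continuous_dot f g : continuous f -> continuous g ->
  continuous (fun t => dot (f t) (g t)).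
Proof.
move=> cf cg.
have cc (h : T -> E3) (k : 'I_3) : continuous h -> continuous (fun t => h t 0 k).
  move=> ch t; apply: (@continuous_comp T E3 R h (fun v : E3 => v 0 k)); first exact: ch.
  exact: coord_continuous.
by apply: continuous_sumf => k; apply: continuous_mulf; exact: cc.
Qed.

End VectorContinuity.

(** * Similarities that carry one ring to another *)

Section Similarity.
Context (R : realType).
Local Notation E3 := 'rV[R]_3.
Implicit Types (d : ring_data R) (x y : E3).

(** A polynomial substitute for the distance to the ring. *)
Definition ring_eq d x : R :=
  (dot (x - d.1.1) (x - d.1.1) - d.1.2 ^+ 2) ^+ 2 + dot (x - d.1.1) d.2 ^+ 2.

Lemma ring_eq_ge0 d x : 0 <= ring_eq d x.
Proof. by rewrite addr_ge0 ?sqr_ge0. Qed.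

Lemma ring_eq0P d x : ring_eq d x = 0 <-> ring_of d x.
Proof.
rewrite /ring_eq /ring_of /=; split=> [/eqP|[-> ->]]; last by rewrite subrr expr0n addr0.
rewrite paddr_eq0 ?sqr_ge0// !sqrf_eq0 subr_eq0 => /andP[/eqP e1 /eqP e2].
by split.
Qed.

(* The rotation taking the unit vector v to the unit vector v', truncated when
   v and v' are far apart so that it is always continuous. *)
Definition rotate (v' v y : E3) : E3 :=
  y - (dot y (v + v') / Num.max (1 + dot v v') 2^-1) *: (v + v') + (2 * dot y v) *: v'.

Lemma rotate_id v y : dot v v = 1 -> rotate v v y = y.
Proof.
move=> vv; rewrite /rotate vv (max_idPl _); last by lra.
rewrite dotDr -!mulr2n -[v *+ 2]scaler_nat scalerA -addrA -scaleNr -scalerDl.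
rewrite [X in X *: v](_ : _ = 0) ?scale0r ?addr0//.
by rewrite -mulr_natl; field.
Qed.

Lemma rotate_dot v v' y : dot v v = 1 -> dot v' v' = 1 -> 2^-1 <= 1 + dot v v' ->
  dot (rotate v' v y) v' = dot y v /\ dot (rotate v' v y) (rotate v' v y) = dot y y.
Proof.
move=> vv v'v' h; rewrite /rotate (max_idPl h).
have q0 : 1 + dot v v' != 0 by rewrite gt_eqF//; lra.
split; rewrite !dotE' ?(dotC v' v) ?vv ?v'v'; first by field.
by rewrite ?(dotC v y) ?(dotC v' y); field.
Qed.

Definition similarity (d' d : ring_data R) x : E3 :=
  d'.1.1 + (d'.1.2 / d.1.2) *: rotate d'.2 d.2 (x - d.1.1).

Lemma similarity_id d x : is_ring_data d -> similarity d d x = x.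
Proof.
move=> [r0 nn]; rewrite /similarity divff ?gt_eqF// scale1r rotate_id//.
by rewrite addrC subrK.
Qed.

Lemma similarity_ring d d' x : is_ring_data d -> is_ring_data d' ->
  2^-1 <= 1 + dot d.2 d'.2 -> ring_of d' (similarity d' d x) -> ring_of d x.
Proof.
move=> [r0 nn] [r0' nn'] h; rewrite /ring_of /similarity /= [_ + _ - _]addrAC subrr add0r.
have [e1 e2] := rotate_dot (x - d.1.1) nn nn' h.
have k0 : d'.1.2 / d.1.2 != 0 by rewrite mulf_neq0// ?invr_eq0 gt_eqF.
rewrite !dotZl dotZr e1 e2 => -[/eqP]; rewrite mulf_eq0 (negPf k0) /= => /eqP h1 h2.
split=> //; apply: (mulfI k0); apply: (mulfI k0); rewrite h2.
by rewrite mulrA -expr2 expr_div_n divfK// sqrf_eq0 gt_eqF.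
Qed.

Lemma ring_eq_bound d x : ring_eq d x < 1 ->
  dot (x - d.1.1) (x - d.1.1) < d.1.2 ^+ 2 + 1.
Proof.
rewrite /ring_eq; move: (dot _ _) (d.1.2 ^+ 2) => s t h.
have := sqr_ge0 (dot (x - d.1.1) d.2); nra.
Qed.

End Similarity.

Section SimilarityContinuity.
Context (R : realType) (T : topologicalType).
Local Notation E3 := 'rV[R]_3.
Context (d d' : T -> ring_data R) (x : T -> E3).
Hypotheses (cx : continuous x) (cc : continuous (fun t => (d t).1.1))
  (cr : continuous (fun t => (d t).1.2)) (cn : continuous (fun t => (d t).2))
  (cc' : continuous (fun t => (d' t).1.1)) (cr' : continuous (fun t => (d' t).1.2))
  (cn' : continuous (fun t => (d' t).2)) (r0 : forall t, 0 < (d t).1.2).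

Lemma ring_eq_continuous : continuous (fun t => ring_eq (d t) (x t)).
Proof.
have cxc := continuous_subv cx cc.
rewrite /ring_eq; apply: continuous_addf.
  have c : continuous (fun t => dot (x t - (d t).1.1) (x t - (d t).1.1) - (d t).1.2 ^+ 2).
    by apply: continuous_subf; [exact: continuous_dot|exact: continuous_mulf].
  exact: (continuous_mulf c c).
have c := continuous_dot cxc cn.
exact: (continuous_mulf c c).
Qed.

Lemma continuous_invf (s : T -> R) : continuous s -> (forall t, s t != 0) ->
  continuous (fun t => (s t)^-1).
Proof. by move=> cs s0 t; apply: cvgV; [exact: s0|exact: cs]. Qed.

Lemma similarity_continuous : continuous (fun t => similarity (d' t) (d t) (x t)).
Proof.
have cxc := continuous_subv cx cc.
have c2 (c : R) : continuous (fun _ : T => c) by exact: cst_continuous.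
apply: (continuous_addv cc'); apply: continuous_scalev.
  by apply: (continuous_mulf cr'); apply: continuous_invf => // t; rewrite gt_eqF.
rewrite /rotate; apply: continuous_addv; last first.
  apply: continuous_scalev => //; apply: (continuous_mulf (c2 2)).
  exact: continuous_dot.
apply: (continuous_subv cxc); apply: continuous_scalev; last exact: continuous_addv.
have cd : continuous (fun t => dot (x t - (d t).1.1) ((d t).2 + (d' t).2)).
  exact: (continuous_dot cxc (continuous_addv cn cn')).
apply: (continuous_mulf cd); apply: continuous_invf => [|t]; last by rewrite gt_eqF// lt_max invr_gt0 ltr0n orbT.
move=> t; apply: (@continuous_max R T (fun t => 1 + dot (d t).2 (d' t).2) (fun=> 2^-1)).
  by apply: (continuous_addf (c2 1)); exact: continuous_dot.
exact: c2.
Qed.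

End SimilarityContinuity.

Section CompactBounds.
Context (R : realType) (T : topologicalType) (K : set T).
Hypothesis cK : compact K.

Lemma pos_lower_bound (f : T -> R) : continuous f -> (forall x, K x -> 0 < f x) ->
  exists2 e, 0 < e & forall x, K x -> e <= f x.
Proof.
move=> cf f0; apply: (compact_uniform cK) => x /f0 fx0.
have fx2 : 0 < f x / 2 by rewrite divr_gt0.
near=> x' d => /=; apply: ltW.
have d2 : d < f x / 2 by near: d; exact: nbhs_right_lt.
have : `|f x - f x'| < f x / 2.
  by near: x'; have /cvgrPdist_lt := cf x; exact.
by move=> /ltr_normlP[? ?]; lra.
Unshelve. all: by end_near. Qed.

Lemma upper_bound (f : T -> R) : continuous f -> exists B, forall x, K x -> f x <= B.
Proof.
move=> cf; have [d d0 h] : exists2 d, 0 < d & forall x, K x -> f x * d <= 1.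
  apply: (compact_uniform cK) => x _; near=> x' d => /=.
  have fx : f x' < `|f x| + 1.
    have : `|f x - f x'| < 1 by near: x'; have /cvgrPdist_lt := cf x; exact.
    by have := ler_norm (f x); move=> ? /ltr_normlP[? ?]; lra.
  have d0 : 0 < d by near: d; exact: nbhs_right_gt.
  have d1 : d < (`|f x| + 1)^-1.
    by near: d; apply: nbhs_right_lt; rewrite invr_gt0 ltr_wpDl.
  apply: le_trans (_ : (`|f x| + 1) * (`|f x| + 1)^-1 <= 1).
    apply: le_trans (_ : (`|f x| + 1) * d <= _).
      by rewrite ler_pM2r// ltW.
    by rewrite ler_wpM2l ?addr_ge0// ltW.
  by rewrite mulfV// gt_eqF// ltr_wpDl.
by exists d^-1 => x Kx; rewrite -[_^-1]div1r ler_pdivlMr//; exact: h.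
Unshelve. all: by end_near. Qed.

(** A continuous function that vanishes for u' = u is small for u' near u, uniformly over the
    compact sets. *)
Lemma diagonal_modulus (A : set (R * R)%type) (f : (R * R) * ((R * R) * T) -> R) e :
  compact A -> continuous f -> 0 < e ->
  (forall u x, A u -> K x -> f (u, (u, x)) = 0) ->
  exists2 d, 0 < d & forall u u' x, A u -> K x -> ball u d u' -> `|f (u', (u, x))| < e.
Proof.
move=> cA cf e0 f0.
suff [d d0 hd] : exists2 d, 0 < d & forall z, (A `*` K) z ->
    forall u', ball z.1 d u' -> `|f (u', z)| < e.
  by exists d => // u u' x Au Kx uu'; apply: (hd (u, x)).
apply: compact_uniform (compact_setX cA cK) _ => -[u0 x0] [/= Au0 Kx0].
have : \forall z \near (u0, (u0, x0)), `|f z| < e.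
  have /cvgrPdist_lt/(_ _ e0) := cf (u0, (u0, x0)).
  by apply: filterS => z; rewrite f0// sub0r normrN.
case=> -[B1 B2] /= [/nbhs_ballP[r /= r0 hr] [[B3 B4] /= [/nbhs_ballP[r' /= r'0 hr'] nB4] B34]] B12.
have r2 : 0 < r / 2 by rewrite divr_gt0.
exists ((ball u0 (r / 2) `&` ball u0 r') `*` B4, [set d | d < r / 2]).
  split=> /=.
    exists (ball u0 (r / 2) `&` ball u0 r', B4) => //; split=> //=.
    by apply: filterI; exact: nbhsx_ballx.
  exact: nbhs_right_lt.
move=> [[u x] d] /= [[[u0u u0u'] B4x] dr] u' uu'.
apply: (B12 (u', (u, x))); split=> /=.
  apply: hr; rewrite [r]splitr; apply: ball_triangle u0u _.
  by apply: le_ball uu'; exact: ltW.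
by apply: B34; split=> //=; exact: hr'.
Qed.

End CompactBounds.

(** * Deforming space along a square of configurations *)

Section Deformation.
Context (R : realType) (n : nat).
Local Notation E3 := 'rV[R]_3.
Local Notation L := (labelled_config R n).
Local Notation V := (R * R)%type.
Context (h : V -> L).
Hypothesis ch : continuous h.

Local Notation data j u := (\val (h u) j).

Let dot_ge (i : 'I_3) (x : E3) : x 0 i ^+ 2 <= dot x x.
Proof.
rewrite dotE -!expr2; have := sqr_ge0 (x 0 0); have := sqr_ge0 (x 0 1).
have := sqr_ge0 (x 0 2%:R); case: i => -[|[|[|//]]] hi.
- by rewrite (_ : Ordinal hi = 0); [lra|exact/val_inj].
- by rewrite (_ : Ordinal hi = 1); [lra|exact/val_inj].
- by rewrite (_ : Ordinal hi = 2%:R); [lra|exact/val_inj].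
Qed.

Definition box (B : R) : set E3 := [set x | forall i, `[- B, B]%classic (x ord0 i)].

Lemma box_compact B : compact (box B).
Proof.
by apply: (@rV_compact R 3 (fun=> `[- B, B]%classic)) => i; exact: segment_compact.
Qed.

Lemma continuous_data (T : topologicalType) (u : T -> V) j : continuous u ->
  [/\ continuous (fun t => (data j (u t)).1.1), continuous (fun t => (data j (u t)).1.2) &
      continuous (fun t => (data j (u t)).2)].
Proof.
move=> cu; have chu : continuous (h \o u).
  by move=> t; apply: continuous_comp; [exact: cu|exact: ch].
split=> t.
- by apply: (@continuous_comp _ _ _ (h \o u) (fun a : L => (\val a j).1.1));
    [exact: chu|exact: continuous_centre].
- by apply: (@continuous_comp _ _ _ (h \o u) (fun a : L => (\val a j).1.2));
    [exact: chu|exact: continuous_radius].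
- by apply: (@continuous_comp _ _ _ (h \o u) (fun a : L => (\val a j).2));
    [exact: chu|exact: continuous_normal].
Qed.

(** Space is not compact; this confines all rings over the unit square, with neighbourhoods, to one
    compact box. *)
Lemma ring_box : exists B, forall u j x, unit_square u -> ring_eq (data j u) x < 1 ->
  box B x.
Proof.
pose f (u : V) := \sum_j (1 + dot (data j u).1.1 (data j u).1.1 + (data j u).1.2).
have cid : continuous (@id V) by move=> u; exact: cvg_id.
have cf : continuous f.
  apply: continuous_sumf => j; have [c1 c2 c3] := continuous_data j cid.
  apply: continuous_addf => //; apply: continuous_addf; first exact: cst_continuous.
  exact: continuous_dot.
have [B hB] := upper_bound (@unit_square_compact R) cf.
exists (B + 1) => u j x Au /ring_eq_bound xe i.
suff : - (B + 1) <= x 0 i <= B + 1 by rewrite /= in_itv.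
have [r0 _] := config_data (h u) j.
have hj : 1 + dot (data j u).1.1 (data j u).1.1 + (data j u).1.2 <= B.
  apply: le_trans (hB u Au); rewrite /f (bigD1 j)//= lerDl.
  apply: sumr_ge0 => k _; have [/ltW rk _] := config_data (h u) k.
  by rewrite !addr_ge0// dot_ge0.
have := dot_ge i (x - (data j u).1.1); have := dot_ge i (data j u).1.1.
have := dot_ge0 (data j u).1.1.
rewrite !mxE.
move: (data j u) (dot (x - _) _) (dot (data j u).1.1 _) r0 hj xe => d s t r0 hj xe t0 ht hs.
have h1 : `|d.1.1 0 i| <= 1 + t.
  rewrite -(ler_pXn2r (n := 2)) ?nnegrE ?addr_ge0// real_normK ?num_real//; nra.
have h2 : `|x 0 i - d.1.1 0 i| <= 1 + d.1.2.
  rewrite -(ler_pXn2r (n := 2)) ?nnegrE ?addr_ge0 ?(ltW r0)// real_normK ?num_real//; nra.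
move: h1 h2; rewrite !ler_norml => /andP[? ?] /andP[? ?]; apply/andP; split; lra.
Qed.

(** Since the rings are disjoint, the sum of two of the functions [ring_eq] has a positive minimum;
    a third of it separates the neighbourhoods. *)
Lemma ring_margin B : exists2 e, 0 < e & forall u x j k, unit_square u -> box B x ->
  j != k -> ring_eq (data j u) x <= e -> e < ring_eq (data k u) x.
Proof.
have c1 : continuous (fst : V * E3 -> V) by move=> z; exact: cvg_fst.
have c2 : continuous (snd : V * E3 -> E3) by move=> z; exact: cvg_snd.
have cE j : continuous (fun z : V * E3 => ring_eq (data j z.1) z.2).
  by have [d1 d2 d3] := continuous_data j c1; exact: ring_eq_continuous.
have cKB := compact_setX (@unit_square_compact R) (@box_compact B).
have ex (t : 'I_n * 'I_n) : exists e, 0 < e /\ (t.1 != t.2 -> forall u x,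
    unit_square u -> box B x -> e <= ring_eq (data t.1 u) x + ring_eq (data t.2 u) x).
  have [->|ne] := eqVneq t.1 t.2; first by exists 1.
  have [|e e0 he] := pos_lower_bound cKB (continuous_addf (cE t.1) (cE t.2)).
    move=> z _; rewrite lt_def addr_ge0 ?ring_eq_ge0// andbT paddr_eq0 ?ring_eq_ge0//.
    apply/negP => /andP[/eqP/ring_eq0P x1 /eqP/ring_eq0P x2].
    have [h12 _] := (configP (h z.1)).2 _ _ ne.
    suff : (ring_of (data t.1 z.1) `&` ring_of (data t.2 z.1)) z.2 by rewrite h12.
    by [].
  by exists e; split=> // _ u x Au Bx; exact: (he (u, x)).
have [g hg] := choice ex.
have [e e0 he] := fin_lower_bound (fun t => (hg t).1).
exists (e / 3); first by rewrite divr_gt0.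
move=> u x j k Au Bx jk xj.
have := (hg (j, k)).2 jk u x Au Bx; have := he (j, k) => /=; lra.
Qed.

(** A cutoff: 1 where [ring_eq] is at most e/2, and 0 where it is at least e. *)
Definition bump (e : R) j u x : R := clip (2 - 2 / e * ring_eq (data j u) x).

(** Close to ring j this is the similarity that carries it to its new position; far from all rings
    it is the identity. All that is asked of it is continuity and that it keeps points off the
    rings. *)
Definition push (e : R) (u' u : V) (x : E3) : E3 :=
  x + \sum_j bump e j u x *: (similarity (data j u') (data j u) x - x).

Lemma push_id e u x : push e u u x = x.
Proof.
rewrite /push big1 ?addr0// => j _.
by rewrite similarity_id ?subrr ?scaler0//; exact: config_data.
Qed.

Lemma push_continuous e (T : topologicalType) (u' u : T -> V) (x : T -> E3) :
  continuous u' -> continuous u -> continuous x ->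
  continuous (fun t => push e (u' t) (u t) (x t)).
Proof.
move=> cu' cu cx; apply: continuous_addv => //; apply: continuous_sumv => j.
have [c1 c2 c3] := continuous_data j cu; have [d1 d2 d3] := continuous_data j cu'.
apply: continuous_scalev.
  have c : continuous (fun t => 2 - 2 / e * ring_eq (data j (u t)) (x t)).
    apply: continuous_subf; first exact: cst_continuous.
    by apply: continuous_scale_val; exact: ring_eq_continuous.
  move=> t; apply: (@continuous_comp _ _ _
    (fun t => 2 - 2 / e * ring_eq (data j (u t)) (x t)) (@clip R)).
    exact: c.
  exact: clip_continuous.
apply: continuous_subv => //; apply: similarity_continuous => // t.
by have [] := config_data (h (u t)) j.
Qed.

(** By contraposition. If the image of x lies on ring j over u', then [ring_eq] for ring j was below
    e/2 at x. There [push] is exactly the similarity of ring j, under which only points of the ring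
    go to the ring. *)
Lemma push_off : exists e d, 0 < d /\ forall u u' x, unit_square u -> unit_square u' ->
  ball u d u' -> ~ on_ring (config_of (h u)) x ->
  ~ on_ring (config_of (h u')) (push e u' u x).
Proof.
have [B hB] := ring_box.
have [e1 e10 he1] := ring_margin B.
pose e := Num.min e1 1.
have e0 : 0 < e by rewrite lt_min e10 ltr01.
have e_1 : e <= 1 by rewrite ge_min lexx orbT.
have e2 : 0 < e / 2 by rewrite divr_gt0.
have margin u x j k : unit_square u -> box B x -> j != k ->
    ring_eq (data j u) x <= e -> e < ring_eq (data k u) x.
  move=> Au Bx jk le_e; apply: le_lt_trans (_ : e1 < _); first by rewrite ge_min lexx.
  by apply: he1 jk _ => //; apply: le_trans le_e _; rewrite ge_min lexx.
have cp1 : continuous (fun z : V * (V * E3) => z.1) by move=> z; exact: cvg_fst.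
have cp2 : continuous (fun z : V * (V * E3) => z.2.1).
  by move=> z; apply: (@continuous_comp _ _ _ snd fst); [exact: cvg_snd|exact: cvg_fst].
have cp3 : continuous (fun z : V * (V * E3) => z.2.2).
  by move=> z; apply: (@continuous_comp _ _ _ snd snd); exact: cvg_snd.
have ex1 j : exists d, 0 < d /\ forall u u' x, unit_square u -> box B x ->
    ball u d u' ->
    `|ring_eq (data j u') (push e u' u x) - ring_eq (data j u) x| < e / 2.
  have [b1 b2 b3] := continuous_data j cp1; have [c1 c2 c3] := continuous_data j cp2.
  have cf : continuous (fun z : V * (V * E3) =>
      ring_eq (data j z.1) (push e z.1 z.2.1 z.2.2) - ring_eq (data j z.2.1) z.2.2).
    apply: continuous_subf; last exact: ring_eq_continuous.
    by apply: ring_eq_continuous => //; exact: push_continuous.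
  have [|d d0 hd] := diagonal_modulus (@box_compact B) (@unit_square_compact R) cf e2.
    by move=> u x _ _ /=; rewrite push_id subrr.
  by exists d; split=> // u u' x Au Bx; exact: hd.
have ex2 j : exists d, 0 < d /\ forall u u', unit_square u -> ball u d u' ->
    2^-1 <= 1 + dot (data j u).2 (data j u').2.
  have [_ _ b3] := continuous_data j cp1; have [_ _ c3] := continuous_data j cp2.
  have cf : continuous (fun z : V * (V * E3) =>
      dot (data j z.2.1).2 (data j z.1).2 - 1).
    by apply: continuous_subf; [exact: continuous_dot|exact: cst_continuous].
  (* No point of space is involved, so the compact set of points is the one-point box. *)
  have [|d d0 hd] := diagonal_modulus (@box_compact 0) (@unit_square_compact R) cf ltr01.
    by move=> u x _ _ /=; have [_ ->] := config_data (h u) j; rewrite subrr.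
  exists d; split=> // u u' Au uu'.
  have [|? ?] := ltr_normlP _ _ (hd u u' 0 Au _ uu'); last by simpl in *; lra.
  by move=> i; rewrite /= mxE in_itv /= oppr0 lexx.
have [g1 hg1] := choice ex1; have [g2 hg2] := choice ex2.
have [d1 d10 hd1] := fin_lower_bound (fun j => (hg1 j).1).
have [d2 d20 hd2] := fin_lower_bound (fun j => (hg2 j).1).
exists e, (Num.min d1 d2); split; first by rewrite lt_min d10.
move=> u u' x Au Au' uu' xu /on_ringP[j] yj; apply: xu; apply/on_ringP; exists j.
have uu1 : ball u (g1 j) u'.
  by apply: le_ball uu'; apply: le_trans (hd1 j); rewrite ge_min lexx.
have uu2 : ball u (g2 j) u'.
  by apply: le_ball uu'; apply: le_trans (hd2 j); rewrite ge_min lexx orbT.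
have bump0 k : e <= ring_eq (data k u) x -> bump e k u x = 0.
  move=> le_e; apply: clip_le0; rewrite mulrAC subr_le0 ler_pdivlMr//.
  by rewrite ler_pM2l.
(* Either x is close to some ring over u, or [push] fixes x, which then lies itself on a ring over
   u'. *)
have Bx : box B x.
  have [[k xk]|no] := pselect (exists k, ring_eq (data k u) x < e).
    by apply: (hB u k) => //; exact: lt_le_trans e_1.
  apply: (hB u' j) => //; suff <- : push e u' u x = x.
    by move/ring_eq0P: yj => ->.
  rewrite /push big1 ?addr0// => k _; rewrite bump0 ?scale0r//.
  by rewrite leNgt; apply/negP => xk; apply: no; exists k.
have yj0 := (ring_eq0P _ _).2 yj.
have := (hg1 j).2 u u' x Au Bx uu1; rewrite yj0 sub0r normrN ger0_norm ?ring_eq_ge0//.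
move=> xj.
have xje : ring_eq (data j u) x <= e by lra.
have pushE : push e u' u x = similarity (data j u') (data j u) x.
  rewrite /push (bigD1 j)//= big1 => [|k kj].
    rewrite addr0 /bump clip_ge1 ?scale1r; first by rewrite addrC subrK.
    rewrite lerBrDr -lerBrDl mulrAC ler_pdivrMr//; lra.
  by rewrite bump0 ?scale0r//; apply/ltW/(margin _ _ j) => //; rewrite eq_sym.
apply: similarity_ring (config_data (h u) j) (config_data (h u') j) _ _.
  exact: (hg2 j).2.
by rewrite -pushE.
Qed.

(** Each stage first pushes the rings one step back along the ray to the origin and then applies the
    preceding stage. *)
Theorem square_deformation : exists G : V -> E3 -> E3,
  [/\ continuous (fun z : V * E3 => G z.1 z.2), (forall x, G 0 x = x) &
    forall u x, ~ on_ring (config_of (h (clip2 u))) x ->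
      ~ on_ring (config_of (h 0)) (G u x)].
Proof.
have [e [d [d0 hd]]] := push_off.
have [N [v [v0 [vN [cv [vin [vstep vk0]]]]]]] := radial_steps d0.
suff : forall k, (k <= N)%N -> exists G : V -> E3 -> E3,
  [/\ continuous (fun z : V * E3 => G z.1 z.2), (forall x, G 0 x = x) &
    forall u x, ~ on_ring (config_of (h (v k u))) x ->
      ~ on_ring (config_of (h 0)) (G u x)].
  move=> /(_ N (leqnn N))[G [cG G0 hG]]; exists G; split=> // u x.
  by rewrite -vN; exact: hG.
have c1 : continuous (fst : V * E3 -> V) by move=> z; exact: cvg_fst.
have c2 : continuous (snd : V * E3 -> E3) by move=> z; exact: cvg_snd.
elim=> [_|k IH lt_k].
  by exists (fun=> id); split=> // u x; rewrite v0.
have [G [cG G0 hG]] := IH (ltnW lt_k).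
exists (fun u x => G u (push e (v k u) (v k.+1 u) x)); split.
- have cw : continuous (fun z : V * E3 => (z.1, push e (v k z.1) (v k.+1 z.1) z.2)).
    apply: continuous_pair => //; apply: push_continuous => //.
    - by move=> z; apply: continuous_comp; [exact: c1|exact: cv].
    - by move=> z; apply: continuous_comp; [exact: c1|exact: cv].
  move=> z; apply: (@continuous_comp _ _ _
    (fun z : V * E3 => (z.1, push e (v k z.1) (v k.+1 z.1) z.2))
    (fun z : V * E3 => G z.1 z.2)).
    exact: cw.
  exact: cG.
- by move=> x; rewrite !vk0 push_id G0.
- move=> u x xu; apply: hG; apply: (hd _ _ _ (vin _ u lt_k) (vin _ u (ltnW lt_k))) => //.
  by apply: ball_sym; exact: vstep.
Qed.

End Deformation.

(** * Loops in the fibre *)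

Section Winding.
Context (R : realType) (Y : topologicalType) (F : groupType).
Local Notation I := (unit_itv R).
Context (phi : Y -> Y -> F).
Implicit Types f g : R -> Y.

Definition left_half f t := f (t / 2).
Definition right_half f t := f (t / 2 + 2^-1).

(* The product of phi along the dyadic subdivision of [0, 1] of mesh 2^-m. *)
Fixpoint winding (m : nat) f : F :=
  if m is m'.+1 then (winding m' (left_half f) * winding m' (right_half f))%g
  else phi (f 0) (f 1).

Lemma eq_winding m f g : (forall t : R, 0 <= t <= 1 -> f t = g t) ->
  winding m f = winding m g.
Proof.
elim: m f g => [|m IH] f g fg /=.
  by rewrite !fg ?lexx ?ler01.
by congr (_ * _)%g; apply: IH => t t01; apply: fg; lra.
Qed.

(** Where phi is the quotient of two values of a potential, the product telescopes. *)
Lemma winding_potential (w : R -> F) m f :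
  (forall s t : R, 0 <= s <= 1 -> 0 <= t <= 1 -> phi (f s) (f t) = (w s / w t)%g) ->
  winding m f = (w 0%R / w 1%R)%g.
Proof.
elim: m f w => [|m IH] f w h /=; first by rewrite h ?lexx ?ler01.
rewrite (IH _ (fun t => w (t / 2))) => [|s t s01 t01]; last by apply: h; lra.
rewrite (IH _ (fun t => w (t / 2 + 2^-1))) => [|s t s01 t01]; last by apply: h; lra.
have -> : 1 / 2 + 2^-1 = 1 :> R by lra.
by rewrite mul0r add0r mul1r !grpE.
Qed.

Lemma winding1 m f : (forall s t : R, 0 <= s <= 1 -> 0 <= t <= 1 -> phi (f s) (f t) = 1%g) ->
  winding m f = 1%g.
Proof.
by move=> h; rewrite (@winding_potential (fun=> 1%g)) ?grpE.
Qed.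

Lemma winding_rev m f : (forall x y, phi y x = (phi x y)^-1)%g ->
  winding m (fun t => f (1 - t)) = ((winding m f)^-1)%g.
Proof.
move=> phiV; elim: m f => [|m IH] f /=; first by rewrite subr0 subrr phiV.
rewrite invgM -!IH; congr (_ * _)%g; apply: eq_winding => t _.
  by rewrite /left_half /right_half; congr f; lra.
by rewrite /left_half /right_half; congr f; lra.
Qed.

Lemma winding_concat (X : topologicalType) (h : X -> Y) m x y z
    (p : {path I from x to y}) (q : {path I from y to z}) :
  winding m.+1 (fun t => h (concat p q (to_itv t))) =
  (winding m (fun t => h (p (to_itv t))) * winding m (fun t => h (q (to_itv t))))%g.
Proof.
congr (_ * _)%g; apply: eq_winding => t t01; congr h.
  rewrite concatvE /= clip_id; last by lra.
  by rewrite ifT; [congr (p (to_itv _))|]; lra.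
rewrite concatvE /= clip_id; last by lra.
case: ifPn => ht; last by congr (q (to_itv _)); lra.
rewrite (path_one_ge p); last by lra.
by rewrite (path_zero_le q) //; lra.
Qed.

Local Notation V := (R * R)%type.

Definition cocycle_on (W : set Y) :=
  forall a b c, W a -> W b -> W c -> (phi a b * phi b c = phi a c)%g.

Context (K : V -> Y).

(** Induction by cutting the square into four and pasting their identities. In the smallest squares
    the cocycle rule turns both sides into phi across the diagonal. *)
Lemma winding_square (d : R) :
  (forall u, unit_square u -> cocycle_on (K @` ball u d)) ->
  forall m (x y s : R), 0 <= s -> s / 2 ^+ m < d -> 0 <= x -> x + s <= 1 ->
    0 <= y -> y + s <= 1 ->
  (winding m (fun t => K (x + s * t, y)) * winding m (fun t => K (x + s, y + s * t))
   = winding m (fun t => K (x, y + s * t)) * winding m (fun t => K (x + s * t, y + s)))%g.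
Proof.
move=> hd; elim=> [|m IH] x y s s0 sd x0 x1 y0 y1 /=.
  rewrite !mulr0 !mulr1 !addr0; rewrite expr0 divr1 in sd.
  have uxy : unit_square (x, y) by split; rewrite /= in_itv /=; lra.
  have inb a b : 0 <= a <= s -> 0 <= b <= s -> (K @` ball (x, y) d) (K (x + a, y + b)).
    move=> a0s b0s; exists (x + a, y + b) => //.
    by split; rewrite /ball /= opprD addrA subrr sub0r normrN ger0_norm; lra.
  have i00 := inb 0 0; have i10 := inb s 0; have i01 := inb 0 s; have i11 := inb s s.
  rewrite ?addr0 in i00 i10 i01 i11.
  have z0s : (0 : R) <= 0 <= s by apply/andP.
  have zss : 0 <= s <= s by apply/andP.
  by rewrite (hd _ uxy _ _ _ (i00 z0s z0s) (i10 zss z0s) (i11 zss zss))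
    (hd _ uxy _ _ _ (i00 z0s z0s) (i01 z0s zss) (i11 zss zss)).
pose r := s / 2.
have r0 : 0 <= r by rewrite divr_ge0.
have rd : r / 2 ^+ m < d by rewrite /r -mulrA -invfM -exprS.
have sr : s = r + r by rewrite /r; lra.
have sum_half c : 0 <= c -> c + s <= 1 -> [/\ 0 <= c + r, c + r <= 1 & c + r + r <= 1].
  by move=> c0 c1; split; lra.
have [xr0 xr1 xrr1] := sum_half x x0 x1; have [yr0 yr1 yrr1] := sum_half y y0 y1.
have half1 c : left_half (fun t => K (x + s * t, c)) = fun t => K (x + r * t, c).
  by apply/funext => t; rewrite /left_half /r; congr (K (_, _)); lra.
have half2 c : right_half (fun t => K (x + s * t, c)) = fun t => K (x + r + r * t, c).
  by apply/funext => t; rewrite /right_half /r; congr (K (_, _)); lra.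
have half3 c : left_half (fun t => K (c, y + s * t)) = fun t => K (c, y + r * t).
  by apply/funext => t; rewrite /left_half /r; congr (K (_, _)); lra.
have half4 c : right_half (fun t => K (c, y + s * t)) = fun t => K (c, y + r + r * t).
  by apply/funext => t; rewrite /right_half /r; congr (K (_, _)); lra.
rewrite !(half1, half2, half3, half4).
have -> : x + s = x + r + r by lra.
have -> : y + s = y + r + r by lra.
rewrite !mulgA -(mulgA _ _ (winding m (fun t => K (x + r + r, y + r * t)))).
rewrite (IH (x + r) y r)// !mulgA (IH x y r)// -!mulgA (IH (x + r) (y + r) r)//.
by rewrite !mulgA -(mulgA (winding m _)) (IH x (y + r) r)// !mulgA.
Qed.

Lemma square_winding : continuous K ->
  (forall u, unit_square u -> exists2 W, nbhs (K u) W & cocycle_on W) ->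
  exists M, forall m, (M <= m)%N ->
  (winding m (fun t => K (t, 0%R)) * winding m (fun t => K (1%R, t))
   = winding m (fun t => K (0%R, t)) * winding m (fun t => K (t, 1%R)))%g.
Proof.
move=> cK hK.
have [d d0 hd] : exists2 d, 0 < d &
    forall u, unit_square u -> cocycle_on (K @` ball u d).
  apply: compact_uniform (@unit_square_compact R) _ => u0 Au0.
    have [W nW cW] := hK _ Au0.
    have [r /= r0 hr] := (iffLR (nbhs_ballP _ _) (cK u0 W nW)).
    have r2 : 0 < r / 2 by rewrite divr_gt0.
    near=> u d => a b c.
    suff sub : K @` ball u d `<=` W by move=> /sub Wa /sub Wb /sub; exact: cW.
    have u0u : ball u0 (r / 2) u by near: u; exact: nbhsx_ballx.
    have dr : d < r / 2 by near: d; exact: nbhs_right_lt.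
    move=> _ [v uv <-]; apply: hr; rewrite [r]splitr; apply: ball_triangle u0u _.
    by apply: le_ball uv; exact: ltW.
exists (Num.trunc d^-1).+1 => m le_m.
have := @winding_square d hd m 0 0 1; rewrite !add0r.
have eh (e : R) : (fun t => K (0 + 1 * t, e)) = fun t => K (t, e).
  by apply/funext => t; rewrite add0r mul1r.
have ev (e : R) : (fun t => K (e, 0 + 1 * t)) = fun t => K (e, t).
  by apply/funext => t; rewrite add0r mul1r.
rewrite !eh !ev; apply; rewrite ?lexx ?ler01//.
rewrite mul1r -[ltRHS]invrK ltf_pV2 ?posrE ?invr_gt0 ?exprn_gt0//.
apply: lt_le_trans (truncnS_gt _) _.
rewrite -natrX ler_nat; apply: leq_trans le_m _; exact/ltnW/ltn_expl.
Unshelve. all: by end_near. Qed.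

(** Asked for all large m, since squares require a fine mesh and a concatenation shifts m by one. *)
Definition winds f (g : F) := exists M, forall m, (M <= m)%N -> winding m f = g.

End Winding.

(** * Reading a word off a path in the fibre *)

Section RingCocycle.
Context (R : realType) (n : nat).
Local Notation E3 := 'rV[R]_3.
Local Notation F := free_group.
Local Notation I := (unit_itv R).
Local Notation Q := (ring_space R n).
Local Notation E := (pointed_space R n).
Local Notation q0 := (base_point R n).
Local Notation e0 := (base_pointed R n).
Local Notation Gamma := (fundamental_group R e0).
Local Notation V := (R * R)%type.

(** A potential on the axis, which gains the factor x_j at the plane of the ring j. *)
Fixpoint gap_word (m : nat) (c : R) : F :=
  if m is m'.+1 then
    (gap_word m' c * if base_center R m' <= c then free_gen m' else 1)%g
  else 1%g.

Lemma gap_word_near m c : (forall j, (j < m)%N -> c <> base_center R j) ->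
  \forall c' \near c, gap_word m c' = gap_word m c.
Proof.
elim: m => [|m IH] h /=; first by near=> c'.
have h1 := IH (fun j jm => h j (ltnW jm)); have /eqP := h m (ltnSn m).
rewrite neq_lt => /orP[lt_c|gt_c]; near=> c'.
  have -> : gap_word m c' = gap_word m c by near: c'.
  have lt_c' : c' < base_center R m by near: c'; exact: lt_nbhsl.
  by rewrite !leNgt lt_c lt_c'.
have -> : gap_word m c' = gap_word m c by near: c'.
have gt_c' : base_center R m < c' by near: c'; exact: lt_nbhsr.
by rewrite !ltW.
Unshelve. all: by end_near. Qed.

Lemma base_center_le_gap (j k : nat) : (base_center R j <= gap R k) = (j < k)%N.
Proof.
rewrite /base_center /gap; have [lt_jk|le_kj] := ltnP j k.
  have : j.+1%:R <= k%:R :> R by rewrite ler_nat.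
  by lra.
have : k%:R <= j%:R :> R by rewrite ler_nat.
by rewrite -natr1 => h; apply/negbTE; rewrite -ltNge; lra.
Qed.

Lemma gap_word_step m k :
  ((gap_word m (gap R k))^-1 * gap_word m (gap R k.+1))%g =
  if (k < m)%N then free_gen k else 1%g.
Proof.
elim: m => [|m] /=; first by rewrite !grpE.
rewrite !base_center_le_gap !ltnS invgM !mulgA -(mulgA _ _^-1)%g => ->.
by case: ltngtP => [_|_|->]; rewrite ?ltnn ?leqnn !grpE.
Qed.

Lemma gap_word0 m : gap_word m (gap R 0) = 1%g.
Proof. by elim: m => //= m ->; rewrite base_center_le_gap mulg1. Qed.

Definition axial_dist2 (x : E3) : R := x 0 1 ^+ 2 + x 0 2 ^+ 2.

(* Crossing the plane of a ring outside of its disc contributes the corresponding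
   free generator, crossing the disc contributes nothing. *)
Definition crossing_word (x y : E3) : F :=
  if (1 < axial_dist2 x) && (1 < axial_dist2 y)
  then (gap_word n (x 0 0) / gap_word n (y 0 0))%g else 1%g.

Lemma crossing_wordV x y : (crossing_word y x = (crossing_word x y)^-1)%g.
Proof.
rewrite /crossing_word andbC; case: ifP => _; last by rewrite invg1.
by rewrite invgM invgK.
Qed.

Lemma crossing_word_refl x : crossing_word x x = 1%g.
Proof. by rewrite /crossing_word mulgV if_same. Qed.

(** Inside the unit cylinder the word is trivial and outside it is a quotient of potentials. A point
    of the cylinder off the rings lies in no plane of a ring, so the potential is constant around it
    and both descriptions agree. *)
Lemma crossing_cocycle z : ~ on_ring q0 z ->
  exists2 W, nbhs z W & cocycle_on crossing_word W.
Proof.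
move=> zoff.
have c0 : continuous (fun x : E3 => x 0 0) := @coord_continuous _ _ _ 0 0.
have cd : continuous axial_dist2.
  have c1 : continuous (fun x : E3 => x 0 1) := @coord_continuous _ _ _ 0 1.
  have c2 : continuous (fun x : E3 => x 0 2) := @coord_continuous _ _ _ 0 2.
  exact: (continuous_addf (continuous_mulf c1 c1) (continuous_mulf c2 c2)).
have [lt_z|gt_z|eq_z] := ltgtP (axial_dist2 z) 1.
- exists [set x | axial_dist2 x < 1]; first exact: (cd z _ (lt_nbhsl lt_z)).
  move=> a b c /= /ltW a1 /ltW b1 _.
  by rewrite /crossing_word !ltNge a1 b1 mulg1.
- exists [set x | 1 < axial_dist2 x]; first exact: (cd z _ (lt_nbhsr gt_z)).
  move=> a b c /= a1 b1 c1.
  by rewrite /crossing_word a1 b1 c1 !grpE.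
- have zc j : (j < n)%N -> z 0 0 <> base_center R j.
    move=> jn zj; apply: zoff; apply/on_ringP; exists (Ordinal jn) => /=.
    by apply/ring_axialP; rewrite -zj expr1n.
  exists [set x | gap_word n (x 0 0) = gap_word n (z 0 0)].
    exact: (c0 z _ (gap_word_near zc)).
  move=> a b c /= ea eb ec; rewrite /crossing_word ea eb ec !grpE !if_same.
  by rewrite mulg1.
Qed.

Local Notation pt := (fun e : E => (\val e).2).

(** A relation, because it is not known beforehand that the class in the total space determines the
    word. *)
Definition fibre_path (x y : E) (a : Gamma) (g : F) :=
  exists p : {path I from x to y}, [/\ path_class e0 p = a,
    forall t, (\val (p t)).1 = q0 & winds crossing_word (fun t => pt (p (to_itv t))) g].

Lemma fibre_path_concat x y z a b g h : fibre_path x y a g -> fibre_path y z b h ->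
  fibre_path x z (a * b)%g (g * h)%g.
Proof.
move=> [p [<- hp [M wp]]] [q [<- hq [N wq]]]; exists (concat p q); split.
- by rewrite path_class_concat.
- by move=> t; rewrite concatvE; case: ifP.
- exists (maxn M N).+1 => -[//|m]; rewrite ltnS geq_max => /andP[Mm Nm].
  by rewrite (winding_concat _ pt) wp// wq.
Qed.

Lemma fibre_path_reverse x y a g : fibre_path x y a g -> fibre_path y x a^-1%g g^-1%g.
Proof.
move=> [p [<- hp [M wp]]]; exists (reverse p); split.
- by rewrite path_class_reverse.
- by move=> t; exact: hp.
- exists M => m Mm; rewrite -(wp m Mm) -winding_rev; last exact: crossing_wordV.
  apply: eq_winding => t t01; congr (\val _).2.
  by rewrite -[LHS]/(p (to_itv (1 - clip t))) clip_id.
Qed.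

Lemma fibre_path_const (x : E) : (\val x).1 = q0 -> fibre_path x x 1%g 1%g.
Proof.
move=> hx; exists (const_path R x); split=> //; first exact: path_class_const.
exists 0%N => m _; apply: winding1 => s t _ _; exact: crossing_word_refl.
Qed.

Lemma fibre_path_segment P S g : segment_off q0 P S ->
  winds crossing_word (fun t => vec3 (lin P.1 S.1 t) (lin P.2 S.2 t) 0) g ->
  fibre_path (planar_pointed q0 P.1 P.2) (planar_pointed q0 S.1 S.2)
    (segment e0 q0 P S) g.
Proof.
move=> off [M wg].
pose f (t : I) := planar_pointed q0 (lin P.1 S.1 (\val t)) (lin P.2 S.2 (\val t)).
have offt (t : I) := off _ (Defs.itv_bound t).
have cc (c : R) : continuous (fun _ : I => c) by exact: cst_continuous.
have cf : continuous f.
  apply: planar_pointed_continuous => //; first exact: cst_continuous.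
  - exact: (continuous_lin (cc _) (cc _) (@continuous_val R)).
  - exact: (continuous_lin (cc _) (cc _) (@continuous_val R)).
have ft t : \val (f t) = (q0, vec3 (lin P.1 S.1 (\val t)) (lin P.2 S.2 (\val t)) 0).
  by rewrite /f (planar_pointedE (offt t)).
have f0 : f zero = planar_pointed q0 P.1 P.2 by rewrite /f val_zero !lin0.
have f1 : f one = planar_pointed q0 S.1 S.2 by rewrite /f val_one !lin1.
exists (mk_path cf f0 f1); split.
- exact: path_class_fun.
- by move=> t; exact: (congr1 fst (ft t)).
- exists M => m Mm; rewrite -(wg m Mm); apply: eq_winding => t t01.
  by apply: etrans (congr1 snd (ft (to_itv t))) _; rewrite /= clip_id.
Qed.

Lemma crossing_square (K : V -> E3) : continuous K ->
  (forall u, unit_square u -> ~ on_ring q0 (K u)) ->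
  exists M, forall m, (M <= m)%N ->
  (winding crossing_word m (fun t => K (t, 0%R)) *
     winding crossing_word m (fun t => K (1%R, t))
   = winding crossing_word m (fun t => K (0%R, t)) *
     winding crossing_word m (fun t => K (t, 1%R)))%g.
Proof.
by move=> cK hK; apply: square_winding => // u /hK; exact: crossing_cocycle.
Qed.

(* A null-homotopy of a loop in the fibre over q0 moves the configuration as
   well; deforming space along with the configuration brings it back into the
   fibre, up to the image of the track of the far point. *)
Theorem fibre_loop_trivial g : fibre_path e0 e0 1%g g -> g = 1%g.
Proof.
move=> [p [p1 hp wp]].
have [H0 [cH0 [H0b H0t] [H0l H0r]]] : homotopic p (const_path R e0).
  by apply: (iffLR (pi_homotopicP p (const_path R e0))); rewrite -path_class_loop p1.
pose K (u : V) := H0 (to_itv u.1, to_itv u.2).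
have cf : continuous (fst : V -> R) by move=> u; exact: cvg_fst.
have cs : continuous (snd : V -> R) by move=> u; exact: cvg_snd.
have cK : continuous K by exact: continuous_homot.
have to_clip t : to_itv (clip t) = to_itv t :> I by rewrite -val_to_itv to_itvK.
have Kclip u : K (clip2 u) = K u by rewrite /K /= !to_clip.
pose H u := (\val (K u)).1.
have cH : continuous H.
  by move=> u; apply: (@continuous_comp _ _ _ K (fun e : E => (\val e).1));
    [exact: cK|exact: continuous_pointed_conf].
have cx : continuous (fun u => pt (K u)).
  by move=> u; apply: (@continuous_comp _ _ _ K pt);
    [exact: cK|exact: continuous_pointed_pt].
have [h [ch hE]] := square_lift cH.
have [G [cG G0 hG]] := square_deformation ch.
have Kb t : K (t, 0) = p (to_itv t) by rewrite /K /= to_itv0 H0b.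
have Kt t : K (t, 1) = e0 by rewrite /K /= to_itv1 H0t.
have Kl t : K (0, t) = e0 by rewrite /K /= to_itv0 H0l.
have Kr t : K (1, t) = e0 by rewrite /K /= to_itv1 H0r.
have Hb t : H (t, 0) = q0 by rewrite /H Kb.
have h0 : config_of (h 0) = q0 by rewrite hE /H Kclip -[0]/(0, 0) -/(H (0, 0)) Hb.
have offG u x : ~ on_ring (H u) x -> ~ on_ring q0 (G u x).
  by move=> ux; rewrite -h0; apply: hG; rewrite hE /H !Kclip.
have cGc (a : V -> V) (x : V -> E3) : continuous a -> continuous x ->
    continuous (fun u => G (a u) (x u)).
  move=> ca cx' u; apply: (@continuous_comp _ _ _ (fun u => (a u, x u))
    (fun z : V * E3 => G z.1 z.2)); last exact: cG.
  exact: continuous_pair.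
have cid : continuous (@id V) by move=> u; exact: cvg_id.
(* First square: the null-homotopy, deformed into the fibre. *)
have [M1 h1] := crossing_square (cGc _ _ cid cx)
  (fun u _ => offG u _ (@pointed_off _ _ (K u))).
have cfar : continuous (fun u => far_point (H u)).
  by move=> u; apply: (@continuous_comp _ _ _ H (@far_point R n)); [exact: cH|exact: far_point_continuous].
(* Second square: the far point over the same configurations, under the same deformation. Its left,
   right and upper sides agree with those of the first square. *)
have [M2 h2] := crossing_square (cGc _ _ cid cfar)
  (fun u _ => offG u _ (@far_point_off _ _ (H u))).
(* Third square: [G] is known to be the identity at the origin, so the loop p is compared with its
   image along the bottom side by shrinking the parameter of [G] to 0. *)
have cm : continuous (fun u : V => (u.1 * u.2, 0) : V).
  by apply: continuous_pair; [exact: continuous_mulf|exact: cst_continuous].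
have cp : continuous (fun u : V => pt (p (to_itv u.1))).
  move=> u; apply: (@continuous_comp _ _ _ (fun u : V => p (to_itv u.1)) pt).
    exact: continuous_path_clip.
  exact: continuous_pointed_pt.
have offp (u : V) : ~ on_ring (H (u.1 * u.2, 0)) (pt (p (to_itv u.1))).
  by rewrite Hb -(hp (to_itv u.1)); exact: pointed_off.
have [M3 h3] := crossing_square (cGc _ _ cm cp) (fun u _ => offG _ _ (offp u)).
have [M4 h4] := wp; pose m : nat := (M1 + M2 + M3 + M4)%N.
have [l1 l2 l3 l4] : [/\ M1 <= m, M2 <= m, M3 <= m & M4 <= m]%N.
  by rewrite /m; split; lia.
pose w f := winding (R := R) crossing_word m f; pose b := far_point q0.
pose A t := G (t, 0) (pt (p (to_itv t))); pose B t := G (t, 0) b.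
pose C := (w (fun t => G (0%R, t) b) * w (fun t => G (t, 1%R) b) / w (fun t => G (1%R, t) b))%g.
have eA : w A = C.
  apply: (canRL (mulgK _)); apply: etrans (etrans _ (h1 m l1)) _.
  - by congr (_ * _)%g; apply: eq_winding => t _; rewrite ?Kb ?Kr.
  - by congr (_ * _)%g; apply: eq_winding => t _; rewrite ?Kl ?Kt.
have eB : w B = C.
  apply: (canRL (mulgK _)); apply: etrans (etrans _ (h2 m l2)) _.
  - by congr (_ * _)%g; apply: eq_winding => t _; rewrite ?Hb // /H Kr.
  - by congr (_ * _)%g; apply: eq_winding => t _; rewrite /H ?Kl ?Kt.
have eg : (g * w B = w A)%g.
  rewrite -(h4 m l4).
  apply: etrans (etrans _ (h3 m l3)) _.
  - congr (_ * _)%g; apply: eq_winding => t _ /=.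
      by rewrite mulr0 -[(0, 0)]/(0 : V) G0.
    by rewrite mul1r to_itv1 path_one.
  - rewrite -[RHS]mul1g; congr (_ * _)%g.
      apply: winding1 => s t _ _ /=.
      by rewrite !mul0r crossing_word_refl.
    by apply: eq_winding => t _ /=; rewrite mulr1.
by apply: (mulIg (w B)); rewrite eg mul1g eA eB.
Qed.

Lemma on_ring_base x y : on_ring q0 (vec3 x y 0) ->
  (exists j, x = base_center R j) /\ y ^+ 2 = 1.
Proof.
by move=> /on_ring_axial[j [-> ->]]; rewrite expr1n; split=> //; exists j.
Qed.

Lemma height_base : height q0 = ceil R n.
Proof.
rewrite /base_point heightE /ceil; congr (_ + _).
apply/max_idPl; rewrite /config_span /= -[in leRHS](card_ord n) -sum1_card natr_sum.
by apply: ler_sum => j _; rewrite !mxE /= mulr0 normr0 add0r.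
Qed.

Lemma base_pointedE : e0 = planar_pointed q0 (upper R n 0).1 (upper R n 0).2.
Proof.
by rewrite /base_pointed far_section_planar height_base /= /gap mulr0 add0r.
Qed.

Lemma ceil_gt1 : 1 < ceil R n.
Proof. by have := ler0n R n; rewrite /ceil; lra. Qed.

Lemma fibre_upper a b : fibre_path
  (planar_pointed q0 (upper R n a).1 (upper R n a).2)
  (planar_pointed q0 (upper R n b).1 (upper R n b).2)
  (segment e0 q0 (upper R n a) (upper R n b))
  (gap_word n (gap R a) / gap_word n (gap R b))%g.
Proof.
have c1 : 1 < ceil R n ^+ 2 by rewrite -[ltLHS](expr1n _ 2) ltrXn2r//; have := ceil_gt1; lra.
apply: fibre_path_segment.
  by move=> t _ /on_ring_base[_] /=; rewrite linaa; lra.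
exists 0%N => m _.
rewrite (@winding_potential _ _ _ _ (fun t => gap_word n (lin (gap R a) (gap R b) t))).
  by rewrite lin0 lin1.
move=> s t _ _; rewrite /crossing_word /axial_dist2 !vec3E /= !linaa.
by rewrite expr0n addr0 c1.
Qed.

Lemma fibre_column k : fibre_path
  (planar_pointed q0 (upper R n k).1 (upper R n k).2)
  (planar_pointed q0 (lower R k).1 (lower R k).2)
  (segment e0 q0 (upper R n k) (lower R k)) 1%g.
Proof.
apply: fibre_path_segment.
  move=> t _ /on_ring_base[[j] /=]; rewrite linaa => e _.
  have := base_center_le_gap j k; have := base_center_le_gap k j.
  rewrite -e lexx => _ /esym jk.
  have : j.+1%:R <= k%:R :> R by rewrite ler_nat.
  by move: e; rewrite /gap /base_center; lra.
exists 0%N => m _; apply: winding1 => s t _ _.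
by rewrite /crossing_word !vec3E /= !linaa mulgV if_same.
Qed.

Lemma fibre_lower a b : fibre_path
  (planar_pointed q0 (lower R a).1 (lower R a).2)
  (planar_pointed q0 (lower R b).1 (lower R b).2)
  (segment e0 q0 (lower R a) (lower R b)) 1%g.
Proof.
apply: fibre_path_segment.
  by move=> t _ /on_ring_base[_] /=; rewrite linaa; lra.
exists 0%N => m _; apply: winding1 => s t _ _.
by rewrite /crossing_word /axial_dist2 !vec3E /= !linaa expr0n addr0 ltr10.
Qed.

Lemma fibre_gap_path k : fibre_path e0
  (planar_pointed q0 (lower R 0).1 (lower R 0).2) (gap_path R n k)
  (gap_word n (gap R k))^-1%g.
Proof.
have := fibre_path_concat (fibre_path_concat (fibre_upper 0 k) (fibre_column k))
  (fibre_lower k 0).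
by rewrite -base_pointedE gap_word0 !grpE.
Qed.

Lemma fibre_gap_loop k : fibre_path e0 e0 (gap_loop R n k) (gap_word n (gap R k)).
Proof.
have := fibre_path_concat (fibre_gap_path 0) (fibre_path_reverse (fibre_gap_path k)).
by rewrite gap_word0 invg1 mul1g invgK.
Qed.

(** This is [gap_path j / gap_path j.+1]: down through the gap before the ring j, along the axis
    through it, and up through the next gap. *)
Definition ring_gen (j : nat) : Gamma := ((gap_loop R n j)^-1 * gap_loop R n j.+1)%g.

Definition fibre_loop : F -> Gamma := free_hom ring_gen.

Lemma fibre_loopP g : fibre_path e0 e0 (fibre_loop g) (free_trunc n g).
Proof.
have homM := (free_homM ring_gen, @free_truncM n).
have homV := (free_homV ring_gen, morph_mulV (@free_truncM n)).
have gen j : fibre_path e0 e0 (fibre_loop (free_gen j)) (free_trunc n (free_gen j)).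
  rewrite /fibre_loop free_hom_gen free_trunc_gen -gap_word_step.
  exact: fibre_path_concat (fibre_path_reverse (fibre_gap_loop j)) (fibre_gap_loop j.+1).
move: g; apply: free_ind => [|j g hg|j g hg].
- rewrite /fibre_loop (morph_mul1 (free_homM _)) (morph_mul1 (@free_truncM n)).
  exact: fibre_path_const.
- by rewrite /fibre_loop !homM; exact: fibre_path_concat.
- rewrite /fibre_loop !homM !homV; apply: fibre_path_concat hg.
  exact: fibre_path_reverse.
Qed.

Lemma fibre_loop_faithful g : fibre_loop g = 1%g -> free_trunc n g = 1%g.
Proof. by move=> g1; apply: fibre_loop_trivial; rewrite -g1; exact: fibre_loopP. Qed.

Lemma fibre_loop_artin (i : 'I_n.-1) j :
  (fibre_loop (free_gen j) ^ ring_lift (rho R i) =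
   fibre_loop (artin i (free_gen j)))%g.
Proof.
have homM := free_homM ring_gen; have homV := free_homV ring_gen.
have conj k := gap_loop_conj R i k.
rewrite {1}/fibre_loop free_hom_gen /ring_gen conjMg conjVg !conj eqSS.
have [->|ji] := eqVneq j i.
  rewrite artin_eq /fibre_loop !homM !homV !free_hom_gen /ring_gen.
  by rewrite ltn_eqF ?grpE.
have [->|jSi] := eqVneq j i.+1.
  rewrite artin_eqS /fibre_loop !free_hom_gen /ring_gen.
  by rewrite !grpE.
by rewrite artin_neq // /fibre_loop free_hom_gen.
Qed.

Lemma braid_to_ring_faithful b : @braid_to_ring R n b = 1%g -> b = 1%g.
Proof.
move=> b1; apply: (@braid_hom_faithful n _ (@ring_lift R n \o @braid_to_ring R n) fibre_loop).
- by move=> x y /=; rewrite braid_to_ringM ring_liftM.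
- exact: free_homM.
- by move=> i j /=; rewrite braid_to_ring_sigma fibre_loop_artin.
- exact: fibre_loop_faithful.
- by rewrite /= b1 (morph_mul1 (@ring_liftM R n)).
Qed.

End RingCocycle.

Local Close Scope ring_scope.
Local Close Scope classical_set_scope.
Local Close Scope quotient_scope.

(** * Injectivity of the map from the braid group *)

Theorem proposition4p3 (R : realType) (n : nat) (hn : (1 <= n)%N) :
  exists f : {multiplicative braid_group n -> ring_group R n},
    (forall i : 'I_n.-1, f (sigma i) = rho R i) /\ injective f.
Proof.
have fM : {morph @braid_to_ring R n : x y / (x * y)%g} := @braid_to_ringM R n.
pose m := isMultiplicative.Build _ _ (@braid_to_ring R n) fM.
exists (HB.pack_for {multiplicative braid_group n -> ring_group R n}
  (@braid_to_ring R n) m); split; first exact: braid_to_ring_sigma.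
move=> x y /= xy; apply/eqP; rewrite -divg_eq1; apply/eqP.
apply: (@braid_to_ring_faithful R).
by rewrite fM (morph_mulV fM) xy mulgV.
Qed.
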